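(* Let $G=(V,E)$ be a connected simple graph with a fixed total order on $E$ and a fixed root vertex $v_d$, and let $CST^{*,*}(G)$ be the spanning tree complex described in the context. Then $CST^{*,*}(G)$ is a bigraded cochain complex which is chain homotopy equivalent to the chromatic complex $C^{*,*}_{\mathcal{A}_2}(G)$. In particular, for all $i,j$, \[ HST^{i,j}(G)\cong H^{i,j}_{\mathcal{A}_2}(G), \] where $HST^{*,*}(G)$ is the homology of $CST^{*,*}(G)$ and $H^{*,*}_{\mathcal{A}_2}(G)$ is chromatic homology.
   Context: Chromatic complex. Let $\mathcal{A}_m=\mathbb{Z}[x]/(x^m)$, $m\ge 2$. An enhanced state of $G$ is a pair $(H,\epsilon)$ where $H$ is a spanning subgraph ($V(H)=V$, $E(H)\subseteq E$) and $\epsilon$ assigns to each connected component of $H$ an element of $\{1,x,\dots,x^{m-1}\}$. $C^{i}_{\mathcal{A}_m}(G)$ is the free abelian group on enhanced states with $|E(H)|=i$; the quantum grading of $(H,\epsilon)$ is $j=\sum_C k_C$ where $\epsilon(C)=x^{k_C}$. The differential is $d(H,\epsilon)=\sum_{e\in E\setminus E(H)}(-1)^{\#\{e'\in E(H):\,e'<e\}}(H\cup e,\epsilon_e)$, where if $e$ joins two distinct components $C_1,C_2$ of $H$ then $\epsilon_e$ gives the merged component the value $\epsilon(C_1)\epsilon(C_2)\in\mathcal{A}_m$ (the term is $0$ if this product is $0$) and agrees with $\epsilon$ elsewhere, and if $e$ joins two vertices of the same component then $\epsilon_e=\epsilon$. This preserves $j$ and raises $i$ by one; its homology is $H^{i,j}_{\mathcal{A}_m}(G)$.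 NBC trees and activities. A broken circuit is the edge set of a cycle of $G$ with its smallest edge removed; an NBC spanning tree is a spanning tree whose edge set contains no broken circuit. For a spanning tree $T$ and $e\in E(T)$, $\mathrm{cut}(T,e)$ is the set of edges of $G$ joining the two components of $T-e$ (it contains $e$); $e$ is internally active if it is the smallest edge of $\mathrm{cut}(T,e)$, internally inactive otherwise. $\mathrm{IA}(T)$, $\mathrm{IN}(T)$ denote the sets of internally active/inactive edges. For $f\in E\setminus E(T)$, $\mathrm{cyc}(T,f)$ is the edge set of the unique cycle in $T\cup f$. Spanning tree complex. For a vertex $v$, $P_v(T)$ is the path in $T$ from $v_d$ to $v$ and $L(P_v(T))$ is the number of edges of $\mathrm{IA}(T)$ on it. For $e\in E\setminus E(T)$ put $\xi(T,e)=\#\{g\in\mathrm{IN}(T): g<e\}$; $s_e(T)=(-1)^{L(P_v(T))}$ (for $v$ an endpoint of $e$) if $|\mathrm{IA}(T)\cap\mathrm{cyc}(T,e)|$ is even and $s_e(T)=0$ if it is odd; and $\psi_e(T)=(T\cup e)\setminus\{\max(\mathrm{IA}(T)\cap\mathrm{cyc}(T,e))\}$. $CST^{*,*}(G)$ is the free abelian group on symbols $T^+$ of bidegree $(|\mathrm{IN}(T)|,|\mathrm{IA}(T)|)$ and $T^-$ of bidegree $(|\mathrm{IN}(T)|,|\mathrm{IA}(T)|+1)$, $T$ ranging over NBC spanning trees, with differential $\partial T^-=0$ and \[\partial T^+=\sum_{e}(-1)^{\xi(T,e)}\,2\,s_e(T)\,\psi_e(T)^-,\] the sum over $e\in E\setminus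 E(T)$ such that $\psi_e(T)$ is an NBC spanning tree with $|\mathrm{IN}(\psi_e(T))|=|\mathrm{IN}(T)|+1$. *)

(* Defs.v *)
From HB Require Import structures.
From mathcomp Require Import all_boot all_order all_algebra.
From mathcomp Require Import generic_quotient ring_quotient.
From mathcomp Require Import boolp.

Set Implicit Arguments.
Unset Strict Implicit.
Unset Printing Implicit Defensive.

Import GRing.Theory.
Local Open Scope ring_scope.

(* The free abelian group on a finite set B, as integer-valued functions.     *)
Notation freeAb B := {ffun B -> int}.

Definition basisv (B : finType) (b : B) : freeAb B := [ffun c => (c == b)%:R].

Section LinearExtension.
Variables (B B' : finType) (f : B -> freeAb B').

Definition linext (x : freeAb B) : freeAb B' := \sum_b f b *~ x b.

Fact linext_is_zmod_morphism : zmod_morphism linext.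
Proof.
move=> x y; rewrite /linext -sumrB; apply: eq_bigr => b _.
by rewrite ffunE [in LHS]/= !ffunE mulrzBr.
Qed.

HB.instance Definition _ :=
  GRing.isZmodMorphism.Build (freeAb B) (freeAb B') linext
    linext_is_zmod_morphism.
End LinearExtension.

(* A free abelian group on a finite basis whose elements carry a bidegree     *)
(* (i, j), with an endomorphism.  That the endomorphism is a differential of  *)
(* bidegree (1, 0) is the separate predicate bigraded_cochain_complex.        *)
(* Bidegrees are natural numbers: the components in negative degrees of both  *)
(* complexes considered below vanish and are not represented.                 *)
Record bigradedEnd := BigradedEnd {
  bg_basis : finType;
  bg_deg : bg_basis -> nat * nat;
  bg_diff : {additive freeAb bg_basis -> freeAb bg_basis}
}.

Notation "''C[' X ]" := (freeAb (bg_basis X)) (format "''C[' X ]").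

Definition homog (X : bigradedEnd) (i j : nat) : {pred 'C[X]} :=
  [pred x : 'C[X] | [forall b, (x b != 0) ==> (bg_deg b == (i, j))]].

(* The component of bidegree (i - 1, j), which is 0 for i = 0.                *)
Definition homog_pred (X : bigradedEnd) (i j : nat) : {pred 'C[X]} :=
  [pred x : 'C[X] |
    [forall b, (x b != 0) ==> (((bg_deg b).1.+1, (bg_deg b).2) == (i, j))]].

Arguments homog : clear implicits.
Arguments homog_pred : clear implicits.

Definition bigraded_cochain_complex (X : bigradedEnd) : Prop :=
  (forall i j x, x \in homog X i j -> bg_diff X x \in homog X i.+1 j) /\
  (forall x, bg_diff X (bg_diff X x) = 0).

Definition cochain_map (X Y : bigradedEnd) (f : {additive 'C[X] -> 'C[Y]}) :
    Prop :=
  (forall i j x, x \in homog X i j -> f x \in homog Y i j) /\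
  (forall x, f (bg_diff X x) = bg_diff Y (f x)).

Definition homotopic_to_id (X : bigradedEnd) (u : 'C[X] -> 'C[X]) : Prop :=
  exists h : {additive 'C[X] -> 'C[X]},
    (forall i j x, x \in homog X i j -> h x \in homog_pred X i j) /\
    (forall x, u x - x = bg_diff X (h x) + h (bg_diff X x)).

Definition chain_homotopy_equivalent (X Y : bigradedEnd) : Prop :=
  exists (f : {additive 'C[X] -> 'C[Y]}) (g : {additive 'C[Y] -> 'C[X]}),
    [/\ cochain_map f, cochain_map g,
        homotopic_to_id (g \o f) & homotopic_to_id (f \o g)].

Section Homology.
Variables (X : bigradedEnd) (i j : nat).

Definition cocycles : {pred 'C[X]} :=
  [pred x | (x \in homog X i j) && (bg_diff X x == 0)].

Fact supp_zmod_closed (P : pred (bg_basis X)) :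
  zmod_closed [pred x : 'C[X] | [forall b, (x b != 0) ==> P b]].
Proof.
split=> [|x y].
  by apply/forallP => b; rewrite ffunE eqxx.
rewrite !inE => /forallP xP /forallP yP; apply/forallP => b.
move: (xP b) (yP b); case: (P b); rewrite ?implybT // !implybF !negbK.
by move=> /eqP xb /eqP yb; rewrite !ffunE xb yb subrr.
Qed.

Fact cocycles_zmod_closed : zmod_closed cocycles.
Proof.
have [h0 hB] := supp_zmod_closed (fun b => bg_deg b == (i, j)).
split=> [|x y]; first by rewrite inE raddf0 eqxx andbT.
rewrite ![_ \in cocycles]inE => /andP[xh /eqP dx] /andP[yh /eqP dy].
by rewrite raddfB /= dx dy subrr eqxx andbT; apply: hB.
Qed.

HB.instance Definition _ :=
  GRing.isZmodClosed.Build 'C[X] cocycles cocycles_zmod_closed.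

Definition cocycle : Type := {x : 'C[X] | x \in cocycles}.
HB.instance Definition _ := SubChoice.on cocycle.
HB.instance Definition _ := [SubChoice_isSubZmodule of cocycle by <:].

Definition coboundaries : {pred cocycle} :=
  [pred z : cocycle |
    `[< exists2 y, y \in homog_pred X i j & val z = bg_diff X y >]].

Fact coboundaries_zmod_closed : zmod_closed coboundaries.
Proof.
have [h0 hB] := supp_zmod_closed
  (fun b => ((bg_deg b).1.+1, (bg_deg b).2) == (i, j)).
split=> [|z z'].
  by rewrite inE; apply/asboolP; exists 0; rewrite ?raddf0.
rewrite !inE => /asboolP[y yh zy] /asboolP[y' yh' zy'].
by apply/asboolP; exists (y - y'); rewrite ?raddfB /= ?zy ?zy' //; apply: hB.
Qed.

HB.instance Definition _ :=
  GRing.isZmodClosed.Build cocycle coboundaries coboundaries_zmod_closed.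

Definition homology : zmodType := Quotient.quot coboundaries.

End Homology.

Definition isomorphic (A B : zmodType) : Prop :=
  exists f : {additive A -> B}, bijective f.

Record sgraph := SGraph {
  vert :> finType;
  adj : rel vert;
  adj_sym : symmetric adj;
  adj_irr : irreflexive adj
}.

Definition connected_graph (G : sgraph) : Prop :=
  forall x y : G, connect (@adj G) x y.

Definition is_edge (G : sgraph) (A : {set G}) : bool :=
  [exists x, exists y, adj x y && (A == [set x; y])].

Definition edge (G : sgraph) : finType := {A : {set G} | is_edge A}.

Definition ends (G : sgraph) (e : edge G) : {set G} := val e.

Definition total_order (T : Type) (le : rel T) : Prop :=
  [/\ reflexive le, antisymmetric le, transitive le & total le].

Section OrderedGraph.
Variables (G : sgraph) (le : rel (edge G)).
Implicit Types (S T A : {set edge G}) (e f g : edge G).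

Definition edge_lt e f : bool := (e != f) && le e f.

(* A spanning subgraph is identified with its edge set S.                     *)
Definition sadj S : rel G := [rel x y | [exists e in S, ends e == [set x; y]]].

Definition components S : {set {set G}} :=
  equivalence_partition (connect (sadj S)) [set: G].

Section Chromatic.
Variable m : nat.

(* The exponent k stands for the element x ^ k of Z[x] / (x ^ m).             *)
Definition enhanced_state : finType :=
  {S : {set edge G} & {ffun {C : {set G} | C \in components S} -> 'I_m}}.
Implicit Types s t : enhanced_state.

Definition estate_deg s : nat * nat :=
  (#|tag s|, \sum_C (tagged s C : nat))%N.

(* The exponent of eps_e on a component D of H + e: if D is not a component   *)
(* of H, it is the merger of the components of H containing an endpoint of e. *)
(* It can be m or more, in which case the product is zero.                    *)
Definition merge_exp s e (D : {set G}) : nat :=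
  if insub D is Some C then tagged s C
  else (\sum_(C : {C | C \in components (tag s)} | ~~ [disjoint val C & ends e])
          tagged s C)%N.

(* t is the state (H + e, eps_e).  There is no such t when eps_e involves a   *)
(* zero product, and exactly one otherwise.                                   *)
Definition adds_edge s e t : bool :=
  (tag t == e |: tag s) &&
  [forall D : {D | D \in components (tag t)},
     (tagged t D : nat) == merge_exp s e (val D)].

Definition chromatic_diff s : freeAb enhanced_state :=
  \sum_(e | e \notin tag s) \sum_(t | adds_edge s e t)
    basisv t *~ (-1) ^+ #|[set e' in tag s | edge_lt e' e]|.

Definition chromatic_complex : bigradedEnd :=
  BigradedEnd estate_deg (linext chromatic_diff).

End Chromatic.

(* The edges traversed by the walk x :: p.                                    *)
Definition walk_edges (x : G) (p : seq G) : {set edge G} :=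
  [set e | has (fun yz => ends e == [set yz.1; yz.2]) (zip (x :: p) p)].

Definition cycle_set A : bool :=
  `[< exists (x : G) (p : seq G),
      [/\ (1 < size p)%N, uniq (x :: p), path (@adj G) x (rcons p x)
        & A = walk_edges x (rcons p x)] >].

Definition spanning_tree T : bool :=
  [forall x, forall y, connect (sadj T) x y] &&
  [forall A, cycle_set A ==> ~~ (A \subset T)].

Definition smallest e A : bool := (e \in A) && [forall f in A, le e f].
Definition largest e A : bool := (e \in A) && [forall f in A, le f e].

Definition broken_circuit A : bool :=
  [exists Z, exists e, [&& cycle_set Z, smallest e Z & A == Z :\ e]].

Definition nbc_tree T : bool :=
  spanning_tree T && [forall A, broken_circuit A ==> ~~ (A \subset T)].

Definition cut T e : {set edge G} :=
  [set f | [exists x in ends f, exists y in ends f,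
              ~~ connect (sadj (T :\ e)) x y]].

Definition IA T : {set edge G} := [set e in T | smallest e (cut T e)].
Definition IN T : {set edge G} := T :\: IA T.

(* The unique cycle contained in T + f.                                       *)
Definition cyc T f : {set edge G} :=
  odflt set0 [pick A | cycle_set A && (A \subset f |: T)].

Section SpanningTreeComplex.
Variable vd : G.

(* The edge set of the unique path in T from vd to v.                         *)
Definition tree_path T (v : G) : {set edge G} :=
  odflt set0 [pick A | `[< exists p : seq G,
    [/\ path (sadj T) vd p, last vd p = v, uniq (vd :: p)
      & A = walk_edges vd p] >]].

Definition IA_length T (v : G) : nat := #|IA T :&: tree_path T v|.

Definition xi T e : nat := #|[set g in IN T | edge_lt g e]|.

Definition endpoint e : G := odflt vd [pick v in ends e].

(* When #|IA T :&: cyc T e| is even, the parity of IA_length T v is the same  *)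
(* for both endpoints v of e.                                                 *)
Definition sgn T e : int :=
  if odd #|IA T :&: cyc T e| then 0 else (-1) ^+ IA_length T (endpoint e).

(* If IA T :&: cyc T e is empty, no edge is removed and psi T e, containing a *)
(* cycle, is not a tree.                                                      *)
Definition psi T e : {set edge G} :=
  (e |: T) :\: [set g | largest g (IA T :&: cyc T e)].

Definition nbcTree : finType := {T : {set edge G} | nbc_tree T}.

(* (T, true) is T^+ and (T, false) is T^-.                                    *)
Definition st_deg (b : nbcTree * bool) : nat * nat :=
  (#|IN (val b.1)|, (#|IA (val b.1)| + ~~ b.2)%N).

Definition st_diff (b : nbcTree * bool) : freeAb (nbcTree * bool)%type :=
  if b.2 then
    \sum_(e | e \notin val b.1)
      \sum_(T' : nbcTree | (val T' == psi (val b.1) e) &&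
                           (#|IN (val T')| == #|IN (val b.1)|.+1))
        basisv (T', false) *~ ((-1) ^+ xi (val b.1) e * 2 * sgn (val b.1) e)
  else 0.

Definition spanning_tree_complex : bigradedEnd :=
  BigradedEnd st_deg (linext st_diff).

End SpanningTreeComplex.
End OrderedGraph.

(* Main.v *)
(** A state is an edge set [S] together with the union [X] of its components
    labelled x.  Two reductions of the chromatic complex give the spanning tree
    complex.

    First, the states whose edge set contains a broken circuit span a subcomplex.
    It is contractible: if [a] is the smallest edge whose ends are joined by
    larger edges of [S], then adding or removing [a] changes neither the
    components nor the choice of [a].  Hence the chromatic complex is homotopy
    equivalent to its quotient spanned by the states without broken circuits.

    Secondly, the sets without broken circuits are partitioned into the intervals
    [[IN(T), T]], [T] an NBC tree, and [#|IN(T)|] filters the quotient.  The block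
    of [T] is the chromatic complex of the tree [T / IN(T)], whose homology is
    spanned by T^- (every component of IN(T) labelled x) and by T^+ (the sum over
    the components [C], with alternating signs, of the states labelled 1 exactly
    on [C]).  Adding an active edge to T^+ gives two terms that cancel; adding an
    edge [e] outside [T] gives [0] or twice the state [IN(T) + e] with all labels
    x, which is T'^- for [T' = psi T e].  So T^+, T^- span a subcomplex of the
    quotient, equal to the spanning tree complex.

    In both cases the homotopy is built from a matching of the states that is
    correct up to terms of lower weight; inverting a unipotent endomorphism makes
    it exact. *)

Require Import Defs.
From HB Require Import structures.
From mathcomp Require Import all_boot all_order all_algebra.
From mathcomp Require Import generic_quotient ring_quotient boolp zify.

Set Implicit Arguments.
Unset Strict Implicit.
Unset Printing Implicit Defensive.

Import GRing.Theory.
Local Open Scope ring_scope.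

(** Activities and broken circuits are recast through one closure operator: [joined S e] says that
    [e] lies in the closure of [S] in the cycle matroid. An edge is active for an arbitrary [S] when
    the rest of [S] and all smaller edges together do not join its ends. Exchange shows that adding
    or removing an active edge changes no activity, which is why the intervals are disjoint; paths
    and cycles serve only to compare with the given definitions. Recording labels by [X] turns the
    vanishing of a product into a drop in the number of components inside [X]. The obstacle in the
    second reduction is that a pairing along an active edge must survive the addition of other
    active edges. Edges are therefore ranked by the size of the side of the tree away from the root,
    smallest first: an edge of larger key does not touch the far component of one of smaller key.
    The subcomplex and the quotient need dual perturbation lemmas. As the matching homotopy vanishes
    on the image of the inclusion (or is killed by the projection), that map itself stays a cochain
    map and only its homotopy inverse is corrected, so no differential has to be perturbed. *)

Section FreeAbelian.
Variables (B : finType).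
Implicit Types (x : freeAb B) (b c : B).

Lemma ffunMzE x (n : int) b : (x *~ n) b = x b *~ n.
Proof. by case: n => n; rewrite /intmul ?ffunE ffunMnE. Qed.

Lemma basisvE b c : basisv b c = (c == b)%:R.
Proof. by rewrite ffunE. Qed.

Lemma basisv_sum x : x = \sum_b basisv b *~ x b.
Proof.
apply/ffunP=> c; rewrite sum_ffunE (bigD1 c) //= big1 ?addr0 => [|b bc].
  by rewrite ffunMzE basisvE eqxx intz.
by rewrite ffunMzE basisvE eq_sym (negbTE bc) mul0rz.
Qed.

Lemma linext_basisv (B' : finType) (f : B -> freeAb B') b :
  linext f (basisv b) = f b.
Proof.
rewrite /linext (bigD1 b) //= big1 ?addr0 => [|c cb]; rewrite basisvE ?eqxx //.
by rewrite (negbTE cb).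
Qed.

Lemma additive_basisv (V : zmodType) (f : {additive freeAb B -> V}) x :
  f x = \sum_b f (basisv b) *~ x b.
Proof.
by rewrite {1}[x]basisv_sum raddf_sum; apply: eq_bigr => b _; rewrite raddfMz.
Qed.

Lemma additive_ext (V : zmodType) (f g : {additive freeAb B -> V}) :
  (forall b, f (basisv b) = g (basisv b)) -> f =1 g.
Proof.
by move=> fg x; rewrite !additive_basisv; apply: eq_bigr => b _; rewrite fg.
Qed.

Definition supported (P : pred B) : {pred freeAb B} :=
  [pred x : freeAb B | [forall b, (x b != 0) ==> P b]].

Lemma supportedP (P : pred B) x :
  reflect (forall b, x b != 0 -> P b) (x \in supported P).
Proof. by apply: (iffP forallP) => xP b; apply/implyP/xP. Qed.

Lemma supported_zmod_closed (P : pred B) : zmod_closed (supported P).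
Proof.
split=> [|x y]; first by apply/supportedP => b; rewrite ffunE eqxx.
move=> /supportedP xP /supportedP yP; apply/supportedP => b.
rewrite !ffunE; apply: contraNT => nP.
have [/eqP->] := (contraNT (xP b) nP, contraNT (yP b) nP).
by move/eqP->; rewrite subrr.
Qed.

HB.instance Definition _ P :=
  GRing.isZmodClosed.Build (freeAb B) (supported P) (supported_zmod_closed P).

Lemma supported_sub (P Q : pred B) x :
  (forall b, P b -> Q b) -> x \in supported P -> x \in supported Q.
Proof. by move=> PQ /supportedP xP; apply/supportedP => b /xP /PQ. Qed.

Lemma supported0 (P : pred B) x :
  (forall b, ~~ P b) -> x \in supported P -> x = 0.
Proof.
move=> nP /supportedP xP; apply/ffunP => b; rewrite ffunE; apply/eqP.
by apply: contraT => /xP; rewrite (negbTE (nP b)).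
Qed.

Lemma supported_basisv (P : pred B) b : P b -> basisv b \in supported P.
Proof.
by move=> Pb; apply/supportedP => c; rewrite basisvE; case: (c =P b) => [->|_] //; rewrite eqxx.
Qed.

Lemma supportedMz (P : pred B) x (n : int) :
  x \in supported P -> x *~ n \in supported P.
Proof. by move=> xP; case: n => n; rewrite ?NegzE /intmul ?rpredN rpredMn. Qed.

End FreeAbelian.

Lemma supported_map (B B' : finType) (f : {additive freeAb B -> freeAb B'})
    (P : pred B) (Q : pred B') x :
  (forall b, P b -> f (basisv b) \in supported Q) ->
  x \in supported P -> f x \in supported Q.
Proof.
move=> fPQ /supportedP xP; rewrite additive_basisv; apply: rpred_sum => b _.
have [->|/xP/fPQ] := eqVneq (x b) 0; first by rewrite mulr0z rpred0.
exact: supportedMz.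
Qed.

(** * Inverting unipotent endomorphisms *)

Section Unipotent.
Variables (B : finType) (v : {additive freeAb B -> freeAb B}) (n : nat).

Definition nilpart x := x - v x.

Fact nilpart_is_zmod_morphism : zmod_morphism nilpart.
Proof.
move=> x y; rewrite /nilpart raddfB !opprB [LHS]addrACA [RHS]addrACA.
by rewrite [- y + _]addrC.
Qed.

HB.instance Definition _ := GRing.isZmodMorphism.Build _ _ nilpart
  nilpart_is_zmod_morphism.

Definition geom x : freeAb B := \sum_(k < n) iter k nilpart x.

Fact geom_is_zmod_morphism : zmod_morphism geom.
Proof.
move=> x y; rewrite /geom -sumrB; apply: eq_bigr => k _.
by elim: (k : nat) => //= m ->; rewrite raddfB.
Qed.

HB.instance Definition _ := GRing.isZmodMorphism.Build _ _ geom
  geom_is_zmod_morphism.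

Variable w : B -> nat.
Hypothesis w_lt : forall b, (w b < n)%N.
Hypothesis v_tri :
  forall b, v (basisv b) - basisv b \in supported (fun c => w c < w b)%N.

Lemma nilpart_supported k x : x \in supported (fun c => w c < k.+1)%N ->
  nilpart x \in supported (fun c => w c < k)%N.
Proof.
apply: supported_map => b; rewrite ltnS => wb.
rewrite /= /nilpart -opprB rpredN; apply: supported_sub (v_tri b) => c /leq_trans; exact.
Qed.

Lemma iter_nilpart x : iter n nilpart x = 0.
Proof.
have xn : x \in supported (fun c => w c < n)%N by apply/supportedP.
have iterP k : (k <= n)%N ->
    iter k nilpart x \in supported (fun c => w c < n - k)%N.
  elim: k => [|k IHk] kn /=; first by rewrite subn0.
  by apply: nilpart_supported; rewrite -subSn // subSS; apply/IHk/ltnW.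
by apply: supported0 (iterP n (leqnn n)) => b; rewrite subnn.
Qed.

(** The sum telescopes, as [v] is the identity minus [nilpart]; the remaining n-th power of
    [nilpart] vanishes because each application lowers the bound on the weight by one. *)
Lemma unipotent_geom x : v (geom x) = x.
Proof.
have vE y : v y = y - nilpart y by rewrite /nilpart subKr.
rewrite vE -[RHS]subr0 -[in RHS](iter_nilpart x) /geom raddf_sum -sumrB.
by elim: n => [|k IHk]; rewrite ?big_ord0 ?subrr // big_ord_recr /= IHk addrA subrK.
Qed.

Lemma geom_unipotent x : geom (v x) = x.
Proof.
have vE y : v y = y - nilpart y by rewrite /nilpart subKr.
rewrite vE raddfB -[RHS]subr0 -[in RHS](iter_nilpart x) /geom -sumrB.
by elim: n => [|k IHk]; rewrite ?big_ord0 ?subrr // big_ord_recr /= IHk -iterSr addrA subrK.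
Qed.

(** The inverse is a polynomial in [v], so it inherits every support condition that [v] preserves;
    this is how gradings survive the inversion. *)
Lemma geom_supported (P : pred B) x :
  (forall y, y \in supported P -> v y \in supported P) ->
  x \in supported P -> geom x \in supported P.
Proof.
move=> vP xP; apply: rpred_sum => k _; elim: (k : nat) => //= m IHm.
by apply: rpredB => //; apply: vP.
Qed.

End Unipotent.

Lemma unipotent_inverse (B : finType) (v : {additive freeAb B -> freeAb B})
    (n : nat) (w : B -> nat) :
  (forall b, w b < n)%N ->
  (forall b, v (basisv b) - basisv b \in supported (fun c => w c < w b)%N) ->
  exists V : {additive freeAb B -> freeAb B},
    [/\ cancel V v, cancel v V & forall P : pred B,
        (forall y, y \in supported P -> v y \in supported P) ->
        forall x, x \in supported P -> V x \in supported P].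
Proof.
move=> w_lt v_tri; exists (geom v n); split=> [x|x|P vP x].
- exact: (unipotent_geom w_lt).
- exact: (geom_unipotent w_lt).
- exact: geom_supported.
Qed.

(** * Homotopy equivalences from unipotent perturbations *)

Section Homogeneous.
Variable X : bigradedEnd.

Lemma homog_predS i j (x : 'C[X]) :
  (x \in homog_pred X i.+1 j) = (x \in homog X i j).
Proof.
by rewrite !inE; apply: eq_forallb => b; rewrite [bg_deg b]surjective_pairing.
Qed.

Lemma homog_pred0 j (x : 'C[X]) : x \in homog_pred X 0 j -> x = 0.
Proof. by apply: supported0 => b; apply/negP => /eqP[]. Qed.

Lemma homog_supported i j (x : 'C[X]) :
  (x \in homog X i j) = (x \in supported (fun b => bg_deg b == (i, j))).
Proof. by []. Qed.

Lemma homog_pred_supported i j (x : 'C[X]) : (x \in homog_pred X i j) =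
  (x \in supported (fun b => ((bg_deg b).1.+1, (bg_deg b).2) == (i, j))).
Proof. by []. Qed.

Lemma diff_homog_pred i j (d : {additive 'C[X] -> 'C[X]}) (x : 'C[X]) :
  (forall i j x, x \in homog X i j -> d x \in homog X i.+1 j) ->
  x \in homog_pred X i j -> d x \in homog X i j.
Proof.
move=> dX; case: i => [|i]; last by rewrite homog_predS => /dX.
by move/homog_pred0->; rewrite raddf0 homog_supported rpred0.
Qed.

End Homogeneous.

Definition homotopy_operator (X : bigradedEnd) (h : 'C[X] -> 'C[X]) :=
  forall i j x, x \in homog X i j -> h x \in homog_pred X i j.

Definition graded_map (X Y : bigradedEnd) (f : 'C[X] -> 'C[Y]) :=
  forall i j x, x \in homog X i j -> f x \in homog Y i j.

(** Matchings produce u + dh + hd = 1, opposite in sign to the convention of [homotopic_to_id]; the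
    homotopy is therefore -h. *)
Lemma homotopic_to_idN (X : bigradedEnd) (u : 'C[X] -> 'C[X])
    (h : {additive 'C[X] -> 'C[X]}) :
  homotopy_operator h ->
  (forall x, u x + (bg_diff X (h x) + h (bg_diff X x)) = x) ->
  homotopic_to_id u.
Proof.
move=> hh uh; exists (GRing.opp \o h); split=> [i j x /hh xh|x] /=.
  by rewrite homog_pred_supported rpredN.
by rewrite raddfN -opprD -{2}(uh x) [in LHS]opprD [LHS]addrA subrr add0r.
Qed.

Section Perturbation.
Variables X Y : bigradedEnd.
Hypothesis dY : forall i j x, x \in homog Y i j -> bg_diff Y x \in homog Y i.+1 j.
Hypothesis dd0 : forall x, bg_diff Y (bg_diff Y x) = 0.
Variable h : {additive 'C[Y] -> 'C[Y]}.
Hypothesis hh : homotopy_operator h.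
Variables (n : nat) (w : bg_basis Y -> nat).
Hypothesis w_lt : forall b, (w b < n)%N.
Local Notation d := (bg_diff Y).

Section Pert.
Variable p : {additive 'C[Y] -> 'C[Y]}.
Hypothesis p_graded : graded_map p.

Definition pert y := p y + (d (h y) + h (d y)).

Fact pert_is_zmod_morphism : zmod_morphism pert.
Proof.
move=> x y; rewrite /pert !raddfB /=.
by rewrite [X in _ + X]addrACA -opprD [LHS]addrACA -opprD.
Qed.

HB.instance Definition _ := GRing.isZmodMorphism.Build _ _ pert
  pert_is_zmod_morphism.

Lemma pert_graded : graded_map pert.
Proof.
move=> i j x xh; rewrite homog_supported !rpredD -?homog_supported //.
- exact: p_graded.
- by apply: diff_homog_pred (hh xh).
- by rewrite -homog_predS; apply/hh/dY.
Qed.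

(** Since d squares to zero, dh + hd commutes with d, and only [p] can fail to. *)
Lemma diff_pert y : d (pert y) - pert (d y) = d (p y) - p (d y).
Proof.
by rewrite /pert dd0 raddf0 addr0 !raddfD /= dd0 add0r addrACA subrr addr0.
Qed.

End Pert.

(** The homotopy inverse of [i] is [r \o V], with [V] inverse to v = ir + dh + hd. As ri = 1 and hi
    = 0, [V] fixes the image of [i], and the commutator of [V] with d lands in that image, where [h]
    vanishes. Hence rV is a cochain map and vV = 1 becomes the homotopy identity. *)
Lemma injection_homotopy_equivalence
    (i : {additive 'C[X] -> 'C[Y]}) (r : {additive 'C[Y] -> 'C[X]}) :
  cochain_map i -> graded_map r -> (forall x, r (i x) = x) ->
  (forall x, h (i x) = 0) ->
  (forall b, pert (i \o r) (basisv b) - basisv b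
             \in supported (fun c => w c < w b)%N) ->
  chain_homotopy_equivalent X Y.
Proof.
move=> [i_gr i_d] r_gr ri hi tri.
have p_gr : graded_map (i \o r) by move=> a b x /r_gr/i_gr.
have [V [vV Vv Vs]] := unipotent_inverse w_lt tri.
have V_gr : graded_map V by move=> a b; apply: Vs => y; apply: pert_graded.
have Vi x : V (i x) = i x.
  by rewrite -[RHS]Vv /= /pert /= ri hi raddf0 add0r -i_d hi addr0.
(* Vd - dV = V(dv - vd)V, and the inner commutator is that of ir. *)
have Vd y : V (d y) - d (V y) = i (bg_diff X (r (V y))) - i (r (d (V y))).
  rewrite -[y in V (d y)]vV -[d (V y) in LHS]Vv -raddfB diff_pert /=.
  by rewrite -i_d raddfB !Vi.
have r_d y : bg_diff X (r (V y)) = r (V (d y)).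
  by apply/eqP; rewrite -subr_eq0 -[V (d y)](subrK (d (V y))) Vd raddfD raddfB !ri subrK subrr.
exists i, (r \o V); split.
- by split.
- by split=> [a b x /V_gr/r_gr|x] //=; rewrite r_d.
- exists \0; split=> [a b x _|x] /=; first by rewrite homog_pred_supported rpred0.
  by rewrite Vi ri subrr raddf0 addr0.
apply: (@homotopic_to_idN _ _ (h \o V)) => [a b x /V_gr/hh|x] //=.
rewrite -[V (d x)](subrK (d (V x))) Vd raddfD raddfB !hi subrr add0r.
exact: vV.
Qed.

(** Dual argument: ps = 1 and ph = 0 give pv = p, hence pV = p. The inverse of [p] is [V \o s] and
    the homotopy is Vh up to sign; the commutator of [V] with d factors through [p], so it vanishes
    on the image of [h]. *)
Lemma surjection_homotopy_equivalence
    (p : {additive 'C[Y] -> 'C[X]}) (s : {additive 'C[X] -> 'C[Y]}) :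
  cochain_map p -> graded_map s -> (forall x, p (s x) = x) ->
  (forall y, p (h y) = 0) ->
  (forall b, pert (s \o p) (basisv b) - basisv b
             \in supported (fun c => w c < w b)%N) ->
  chain_homotopy_equivalent X Y.
Proof.
move=> [p_gr p_d] s_gr ps ph tri.
have sp_gr : graded_map (s \o p) by move=> a b x /p_gr/s_gr.
have [V [vV Vv Vs]] := unipotent_inverse w_lt tri.
have V_gr : graded_map V by move=> a b; apply: Vs => y; apply: pert_graded.
have pV y : p (V y) = p y.
  by rewrite -[y in RHS]vV /= /pert !raddfD /= ps p_d !ph raddf0 !addr0.
have Vd y : V (d y) - d (V y) = V (d (s (p y)) - s (bg_diff X (p y))).
  rewrite -[y in V (d y)]vV -[d (V y) in LHS]Vv -raddfB diff_pert /=.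
  by rewrite p_d pV.
exists (V \o s), p; split.
- split=> [a b x /s_gr/V_gr|x] //=.
  by have := Vd (s x); rewrite !ps raddfB => /addrI/oppr_inj.
- by split.
- exists \0; split=> [a b x _|x] /=; first by rewrite homog_pred_supported rpred0.
  by rewrite pV ps subrr raddf0 addr0.
apply: (@homotopic_to_idN _ _ (V \o h)) => [a b x /hh|x] /=.
  rewrite homog_pred_supported; apply: Vs => y.
  rewrite -homog_pred_supported; case: a => [/homog_pred0->|a].
    by rewrite raddf0 homog_pred_supported rpred0.
  rewrite homog_predS => yh; rewrite homog_predS; exact: pert_graded.
have <- : V (d (h x)) = d (V (h x)).
  by apply/eqP; rewrite -subr_eq0 Vd ph !(raddf0, addr0).
by rewrite -!raddfD; apply: Vv.
Qed.

End Perturbation.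

(** * Chain homotopy equivalences *)

Lemma graded_homog_pred (X Y : bigradedEnd) (f : {additive 'C[X] -> 'C[Y]}) i j
    (x : 'C[X]) :
  graded_map f -> x \in homog_pred X i j -> f x \in homog_pred Y i j.
Proof.
move=> fg; case: i => [/homog_pred0->|i]; last first.
  by rewrite homog_predS => /fg; rewrite homog_predS.
by rewrite raddf0 homog_pred_supported rpred0.
Qed.

(** guf - 1 = g(u - 1)f + (gf - 1), so gkf + h is a homotopy. *)
Lemma homotopic_to_id_comp (X Y : bigradedEnd) (f : {additive 'C[X] -> 'C[Y]})
    (g : {additive 'C[Y] -> 'C[X]}) (u : 'C[Y] -> 'C[Y]) :
  cochain_map f -> cochain_map g ->
  homotopic_to_id (g \o f) -> homotopic_to_id u -> homotopic_to_id (g \o u \o f).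
Proof.
move=> [fg fd] [gg gd] [h [hh hE]] [k [kk kE]].
exists ((g \o k \o f) \+ h); split=> [i j x xh|x] /=.
  rewrite homog_pred_supported rpredD // -homog_pred_supported; last exact: hh.
  by apply: graded_homog_pred => //; apply/kk/fg.
have -> : g (u (f x)) - x = g (u (f x) - f x) + (g (f x) - x).
  by rewrite raddfB addrA subrK.
by rewrite kE hE fd !raddfD /= !gd addrACA.
Qed.

Lemma che_sym X Y :
  chain_homotopy_equivalent X Y -> chain_homotopy_equivalent Y X.
Proof. by move=> [f [g [? ? ? ?]]]; exists g, f. Qed.

Lemma cochain_map_comp X Y Z (f : {additive 'C[X] -> 'C[Y]})
    (g : {additive 'C[Y] -> 'C[Z]}) :
  cochain_map f -> cochain_map g -> cochain_map (g \o f).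
Proof.
by move=> [fg fd] [gg gd]; split=> [i j x /fg/gg|x] //=; rewrite fd gd.
Qed.

Lemma che_trans X Y Z : chain_homotopy_equivalent X Y ->
  chain_homotopy_equivalent Y Z -> chain_homotopy_equivalent X Z.
Proof.
move=> [f [g [fc gc gf fg]]] [f' [g' [fc' gc' gf' fg']]].
exists (f' \o f), (g \o g'); split.
- exact: cochain_map_comp.
- exact: cochain_map_comp.
- exact: (homotopic_to_id_comp fc gc gf gf').
- exact: (homotopic_to_id_comp gc' fc' fg' fg).
Qed.

Lemma relabel_homotopy_equivalence (X Y : bigradedEnd)
    (phi : bg_basis X -> bg_basis Y) (psi : bg_basis Y -> bg_basis X) :
  cancel phi psi -> cancel psi phi ->
  (forall b, bg_deg (phi b) = bg_deg b) ->
  (forall b, linext (fun b => basisv (phi b)) (bg_diff X (basisv b)) =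
             bg_diff Y (basisv (phi b))) ->
  chain_homotopy_equivalent X Y.
Proof.
move=> phiK psiK degE diffE.
pose f : {additive 'C[X] -> 'C[Y]} := linext (fun b => basisv (phi b)).
pose g : {additive 'C[Y] -> 'C[X]} := linext (fun b => basisv (psi b)).
have fb b : f (basisv b) = basisv (phi b) by apply: linext_basisv.
have gb b : g (basisv b) = basisv (psi b) by apply: linext_basisv.
have fK : cancel f g.
  by apply: (@additive_ext _ _ (g \o f) idfun) => b /=; rewrite fb gb phiK.
have gK : cancel g f.
  by apply: (@additive_ext _ _ (f \o g) idfun) => b /=; rewrite gb fb psiK.
have fd x : f (bg_diff X x) = bg_diff Y (f x).
  apply: (@additive_ext _ _ (f \o bg_diff X) (bg_diff Y \o f)) => b /=.
  by rewrite fb -diffE.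
have id0 Z (u : 'C[Z] -> 'C[Z]) : u =1 id -> homotopic_to_id u.
  move=> uE; exists \0; split=> [i j x _|x] /=.
    by rewrite homog_pred_supported rpred0.
  by rewrite uE subrr raddf0 addr0.
exists f, g; split; [split=> // i j x|split=> [i j x|x]|exact: id0|exact: id0].
- rewrite !homog_supported; apply: supported_map => b db.
  by rewrite fb supported_basisv // degE.
- rewrite !homog_supported; apply: supported_map => b db.
  by rewrite gb supported_basisv // -degE psiK.
- by rewrite -[x in LHS]gK -fd fK.
Qed.

(** * Maps induced on homology *)

Section HomologyMap.
Variables (X Y : bigradedEnd) (f : {additive 'C[X] -> 'C[Y]}).
Hypothesis f_cochain : cochain_map f.
Variables i j : nat.

Fact cocycle_map_subproof (z : cocycle X i j) : f (val z) \in @cocycles Y i j.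
Proof.
have [fg fd] := f_cochain; have /andP[zh /eqP dz] := valP z.
by apply/andP; split; [apply: fg | rewrite -fd dz raddf0].
Qed.

Definition cocycle_map (z : cocycle X i j) : cocycle Y i j :=
  Sub (f (val z)) (cocycle_map_subproof z).

Fact cocycle_map_is_zmod_morphism : zmod_morphism cocycle_map.
Proof. by move=> x y; apply: val_inj; rewrite /= !raddfB. Qed.

HB.instance Definition _ := GRing.isZmodMorphism.Build _ _ cocycle_map
  cocycle_map_is_zmod_morphism.


Lemma cocycle_map_coboundaries (z : cocycle X i j) :
  z \in @coboundaries X i j -> cocycle_map z \in @coboundaries Y i j.
Proof.
have [fg fd] := f_cochain; rewrite !inE => /asboolP[y yh zy].
apply/asboolP; exists (f y); first exact: graded_homog_pred.
by rewrite -fd -zy.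
Qed.

Definition homology_map (c : homology X i j) : homology Y i j :=
  \pi_(homology Y i j)%qT (cocycle_map (repr c)).

(** Independence of the representative picked by [repr]: two of them differ by a coboundary, which
    goes to a coboundary. *)
Lemma homology_map_pi (z : cocycle X i j) :
  homology_map (\pi_(homology X i j)%qT z) = \pi_(homology Y i j)%qT (cocycle_map z).
Proof.
apply/eqP; rewrite -Quotient.idealrBE -raddfB; apply: cocycle_map_coboundaries.
by rewrite Quotient.idealrBE reprK.
Qed.

Fact homology_map_is_zmod_morphism : zmod_morphism homology_map.
Proof.
move=> c c'; rewrite -[c]reprK -[c']reprK -raddfB !homology_map_pi -raddfB.
by rewrite -[in RHS]raddfB.
Qed.

HB.instance Definition _ := GRing.isZmodMorphism.Build _ _ homology_map
  homology_map_is_zmod_morphism.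

End HomologyMap.

Lemma homology_mapK X Y (f : {additive 'C[X] -> 'C[Y]})
    (g : {additive 'C[Y] -> 'C[X]}) (fc : cochain_map f) (gc : cochain_map g)
    i j :
  homotopic_to_id (g \o f) ->
  cancel (homology_map fc (i := i) (j := j)) (homology_map gc (i := i) (j := j)).
Proof.
move=> [h [hh hE]] c; rewrite -[c]reprK (homology_map_pi fc) homology_map_pi.
apply/eqP; rewrite -Quotient.idealrBE inE; apply/asboolP.
have /andP[zh /eqP dz] := valP (repr c).
exists (h (val (repr c))); first exact: hh.
by have := hE (val (repr c)); rewrite /= dz raddf0 addr0 => <-.
Qed.

Lemma che_isomorphic_homology X Y i j : chain_homotopy_equivalent X Y ->
  isomorphic (homology X i j) (homology Y i j).
Proof.
move=> [f [g [fc gc gf fg]]]; exists (homology_map fc (i := i) (j := j)).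
by exists (homology_map gc (i := i) (j := j)); apply: homology_mapK.
Qed.

(** * Connectivity of spanning subgraphs *)

Section Connectivity.
Variable G : sgraph.
Implicit Types (S T : {set edge G}) (X : {set G}) (e f g : edge G) (x y z : G).

Fact edge_pair e : exists xy : G * G, adj xy.1 xy.2 && (ends e == [set xy.1; xy.2]).
Proof.
by have /existsP[x /existsP[y exy]] := valP e; exists (x, y).
Qed.

Definition esrc e : G := (xchoose (edge_pair e)).1.
Definition edst e : G := (xchoose (edge_pair e)).2.

Lemma adj_esrc e : adj (esrc e) (edst e).
Proof. by have /andP[] := xchooseP (edge_pair e). Qed.

Lemma endsE e : ends e = [set esrc e; edst e].
Proof. by have /andP[_ /eqP] := xchooseP (edge_pair e). Qed.

Lemma esrc_in e : esrc e \in ends e. Proof. by rewrite endsE set21. Qed.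
Lemma edst_in e : edst e \in ends e. Proof. by rewrite endsE set22. Qed.

Lemma esrc_neq e : esrc e != edst e.
Proof. by apply/eqP => E; have := adj_esrc e; rewrite E adj_irr. Qed.

Lemma ends_inj e f : ends e = ends f -> e = f.
Proof. exact: val_inj. Qed.

Lemma set2_eq x y u v : [set x; y] = [set u; v] ->
  (x = u /\ y = v) \/ (x = v /\ y = u).
Proof.
move=> E; have: x \in [set u; v] by rewrite -E set21.
have: y \in [set u; v] by rewrite -E set22.
have: u \in [set x; y] by rewrite E set21.
have: v \in [set x; y] by rewrite E set22.
rewrite !inE => /orP[]/eqP-> /orP[]/eqP-> /orP[]/eqP H1 /orP[]/eqP H2;
  by [left | right | left; split; congruence | right; split; congruence].
Qed.

Lemma sadjP S x y :
  reflect (exists2 e, e \in S & ends e = [set x; y]) (sadj S x y).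
Proof. by apply: (iffP exists_inP) => -[e eS /eqP]; exists e => //; apply/eqP. Qed.

Lemma sadj_sym S : symmetric (sadj S).
Proof. by move=> x y; apply/sadjP/sadjP => -[e eS E]; exists e; rewrite // setUC. Qed.

Lemma sadj_edge S x y : sadj S x y -> exists2 e, e \in S &
  (x = esrc e /\ y = edst e) \/ (x = edst e /\ y = esrc e).
Proof.
by case/sadjP => e eS; rewrite endsE => /esym/set2_eq; exists e.
Qed.

Definition cn S x y := connect (sadj S) x y.

Lemma cnxx S x : cn S x x. Proof. exact: connect0. Qed.

Lemma cnC S x y : cn S x y = cn S y x.
Proof. exact: sym_connect_sym (sadj_sym S) x y. Qed.

Lemma cn_trans S y x z : cn S x y -> cn S y z -> cn S x z.
Proof. exact: connect_trans. Qed.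

Lemma cn_left S x y : cn S x y -> forall z, cn S x z = cn S y z.
Proof.
move=> xy z; apply/idP/idP; last exact: cn_trans.
by apply: cn_trans; rewrite cnC.
Qed.

Lemma cn_ind S (P : pred G) x y :
  (forall u v, sadj S u v -> P u -> P v) -> cn S x y -> P x -> P y.
Proof.
move=> PS /connectP[p]; elim: p x => [|z p IHp] x /=; first by move=> _ ->.
by case/andP => /PS xz zp yE /xz; apply: IHp zp yE.
Qed.

(** Membership of [e] in the closure of [S] in the cycle matroid of the graph. *)
Definition joined S e := cn S (esrc e) (edst e).

Lemma joined_ends S e x y : ends e = [set x; y] -> joined S e = cn S x y.
Proof. by rewrite endsE /joined => /set2_eq[][-> ->] //; rewrite cnC. Qed.

Lemma joined_in S e : e \in S -> joined S e.
Proof. by move=> eS; apply/connect1/sadjP; exists e; rewrite ?endsE. Qed.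

Lemma cn_closure S T x y :
  (forall e, e \in S -> joined T e) -> cn S x y -> cn T x y.
Proof.
move=> ST; apply: connect_sub => u v /sadj_edge[e /ST].
by rewrite /joined => Te [][-> ->] //; rewrite -/(cn T _ _) cnC.
Qed.

Lemma cn_sub S T x y : S \subset T -> cn S x y -> cn T x y.
Proof. by move/subsetP => ST; apply: cn_closure => e /ST/joined_in. Qed.

Lemma joined_sub S T e : S \subset T -> joined S e -> joined T e.
Proof. exact: cn_sub. Qed.

Lemma joined_closure S T e :
  (forall f, f \in S -> joined T f) -> joined S e -> joined T e.
Proof. exact: cn_closure. Qed.

(** A walk in S + e can be shortened until it uses [e] at most once, in one of two directions. *)
Lemma cn_setU1 S e x y : cn (e |: S) x y =
  [|| cn S x y, cn S x (esrc e) && cn S (edst e) y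
    | cn S x (edst e) && cn S (esrc e) y].
Proof.
have Se : S \subset e |: S by apply: subsetUr.
have ee : joined (e |: S) e by apply/joined_in/setU11.
apply/idP/idP=> [xy|/or3P[|/andP[xa bv]|/andP[xb av]]].
- pose P z := [|| cn S x z, cn S x (esrc e) && cn S (edst e) z
    | cn S x (edst e) && cn S (esrc e) z].
  apply: (@cn_ind _ P x y _ xy) => [u v|]; last by rewrite /P cnxx.
  move=> /sadj_edge[f]; rewrite in_setU1 => /predU1P[->|fS].
    case=> -[-> ->]; rewrite /P !cnxx.
      case/or3P=> [->|/andP[->]|/andP[->]]; rewrite ?orbT ?andbT //=.
    by case/or3P=> [->|/andP[->]|/andP[->]]; rewrite ?orbT ?andbT //=.
  have uv : (u = esrc f /\ v = edst f) \/ (u = edst f /\ v = esrc f) -> cn S u v.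
    by case=> -[-> ->]; [|rewrite cnC]; apply: joined_in.
  move=> /uv {}uv; case/or3P=> [xu|/andP[xa bu]|/andP[xb au]]; apply/or3P.
  + by apply: Or31; apply: cn_trans uv.
  + by apply: Or32; rewrite xa (cn_trans bu uv).
  + by apply: Or33; rewrite xb (cn_trans au uv).
- exact: cn_sub.
- by apply: cn_trans (cn_sub Se xa) (cn_trans ee (cn_sub Se bv)).
apply: cn_trans (cn_sub Se xb) (cn_trans _ (cn_sub Se av)).
by rewrite cnC.
Qed.

Lemma cn_joined S e x y : joined S e -> cn (e |: S) x y = cn S x y.
Proof.
move=> Se; apply/idP/idP; last exact/cn_sub/subsetUr.
by apply: cn_closure => f; rewrite in_setU1 => /predU1P[->|/joined_in].
Qed.

(** The exchange property of matroid closure: a path joining [e] in S + f must run through [f]. *)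
Lemma exchange S e f :
  joined (f |: S) e -> ~~ joined S e -> joined (e |: S) f.
Proof.
rewrite /joined [cn (f |: S) _ _]cn_setU1 => /or3P[->//|/andP[ac db]|/andP[ad cb]] _.
  rewrite cn_setU1; apply/or3P/Or32; rewrite [cn S (esrc f) _]cnC ac /=.
  by rewrite cnC db.
by rewrite cn_setU1; apply/or3P/Or33; rewrite cb ad.
Qed.

Definition cl S X : {set G} := [set y | [exists x in X, cn S x y]].

Lemma clP S X y : reflect (exists2 x, x \in X & cn S x y) (y \in cl S X).
Proof. by rewrite inE; apply: exists_inP. Qed.

Lemma cl_id S X : X \subset cl S X.
Proof. by apply/subsetP => x xX; apply/clP; exists x => //; apply: cnxx. Qed.

(** Unions of components of [S]: the vertex sets that can carry the label x. *)
Definition saturated S X := cl S X == X.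

Lemma saturatedP S X :
  reflect (forall x y, cn S x y -> x \in X -> y \in X) (saturated S X).
Proof.
rewrite /saturated eqEsubset cl_id andbT.
apply: (iffP subsetP) => [sX x y xy xX|sX y /clP[x xX /sX]]; last exact.
by apply: sX; apply/clP; exists x.
Qed.

Lemma saturated_mem S X x y : saturated S X -> cn S x y -> (x \in X) = (y \in X).
Proof.
by move=> /saturatedP sX xy; apply/idP/idP; apply: sX => //; rewrite cnC.
Qed.

Lemma saturated_sub S T X : S \subset T -> saturated T X -> saturated S X.
Proof. by move=> ST /saturatedP sX; apply/saturatedP=> x y /(cn_sub ST)/sX. Qed.

Lemma cl_comp S T X : S \subset T -> cl T (cl S X) = cl T X.
Proof.
move=> ST; apply/setP => y; apply/clP/clP => -[x].
  by case/clP=> z zX /(cn_sub ST) zx xy; exists z => //; apply: cn_trans xy.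
by exists x => //; apply: (subsetP (cl_id _ _)).
Qed.

Lemma cl_saturated S X : saturated S (cl S X).
Proof. by rewrite /saturated cl_comp. Qed.

Lemma saturatedT S : saturated S setT.
Proof. by apply/saturatedP => x y; rewrite !inE. Qed.

Lemma saturatedC S X : saturated S (~: X) = saturated S X.
Proof.
suff CS Z : saturated S Z -> saturated S (~: Z).
  by apply/idP/idP => [/CS|/CS//]; rewrite setCK.
move=> sZ; apply/saturatedP => x y xy; rewrite !inE.
by rewrite (saturated_mem sZ xy).
Qed.

Definition ccomp S x : {set G} := [set y | cn S x y].

Lemma ccomp_saturated S x : saturated S (ccomp S x).
Proof. by apply/saturatedP => y z yz; rewrite !inE => /cn_trans; apply. Qed.

Lemma ccomp_id S x : x \in ccomp S x. Proof. by rewrite inE cnxx. Qed.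

Lemma ccomp_eq S x y : (ccomp S x == ccomp S y) = cn S x y.
Proof.
apply/eqP/idP => [E|xy]; last by apply/setP => z; rewrite !inE (cn_left xy).
by have := ccomp_id S y; rewrite -E inE.
Qed.

(** For saturated [X], the number of components labelled x, that is, the quantum degree. *)
Definition ncomp S X := #|ccomp S @: X|.

Section AddEdge.
Variables (S : {set edge G}) (e : edge G) (X : {set G}).
Hypothesis sX : saturated S X.
Local Notation S' := (e |: S).
Local Notation X' := (cl S' X).
Local Notation a := (esrc e).
Local Notation b := (edst e).

Lemma mem_cl_setU1 y : (y \in X') =
  [|| y \in X, (a \in X) && cn S b y | (b \in X) && cn S a y].
Proof.
have /saturatedP sX1 := sX.
apply/clP/idP => [[x xX]|/or3P[yX|/andP[aX bY]|/andP[bX aY]]].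
- rewrite cn_setU1 => /or3P[xy|/andP[xa ->]|/andP[xb ->]].
  + by rewrite (sX1 _ _ xy xX).
  + by rewrite (sX1 _ _ xa xX) orbT.
  + by rewrite (sX1 _ _ xb xX) !orbT.
- by exists y => //; apply: cnxx.
- by exists a => //; rewrite cn_setU1 bY cnxx orbT.
- by exists b => //; rewrite cn_setU1 aY cnxx !orbT.
Qed.

Lemma ccomp_setU1 x : ccomp S' x =
  if ccomp S x \in [set ccomp S a; ccomp S b] then ccomp S a :|: ccomp S b
  else ccomp S x.
Proof.
apply/setP => y; rewrite !inE !ccomp_eq cn_setU1.
case: ifP => [/orP[] xc|/norP[/negbTE-> /negbTE->]]; last by rewrite orbF !inE.
  by rewrite !inE xc (cn_left xc y); case: (cn S a y); case: (cn S b y); rewrite ?andbF.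
by rewrite !inE xc (cn_left xc y); case: (cn S a y); case: (cn S b y); rewrite ?orbT ?andbF.
Qed.

Let F (C : {set G}) :=
  if C \in [set ccomp S a; ccomp S b] then ccomp S a :|: ccomp S b else C.

Lemma imset_ccomp_setU1 : ccomp S' @: X' = F @: (ccomp S @: X).
Proof.
apply/setP => C; apply/imsetP/imsetP => [[y /clP[x xX xy] ->]|[D /imsetP[x xX ->] ->]].
  exists (ccomp S x); first exact: imset_f.
  by rewrite -[RHS]ccomp_setU1; apply/eqP; rewrite ccomp_eq cnC.
exists x; first exact: (subsetP (cl_id _ _)).
by rewrite [RHS]ccomp_setU1.
Qed.

Lemma ncomp_setU1_leq : (ncomp S' X' <= ncomp S X)%N.
Proof. by rewrite /ncomp imset_ccomp_setU1 leq_imset_card. Qed.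

(** Passing to S + e identifies only the components of the two ends of [e]. *)
Lemma F_inj (A : {set {set G}}) : A \subset ccomp S @: X ->
  ~~ ((ccomp S a \in A) && (ccomp S b \in A)) -> {in A &, injective F}.
Proof.
move=> /subsetP AX nab C D CA DA; rewrite /F.
have big E x : E \in A -> E = ccomp S a :|: ccomp S b -> (x \in [:: a; b]) -> E = ccomp S x.
  move=> /AX/imsetP[y _ ->] Eab xab; apply/eqP; rewrite ccomp_eq.
  have: x \in ccomp S a :|: ccomp S b.
    by move: xab; rewrite !inE => /orP[]/eqP->; rewrite cnxx ?orbT.
  by rewrite -Eab inE.
rewrite !inE; case: ifP => [Cab|/norP[Ca Cb]]; case: ifP => [Dab|/norP[Da Db]].
- move=> _; move: nab; case/orP: Cab CA => /eqP-> CA; case/orP: Dab DA => /eqP-> DA //;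
  by rewrite CA DA.
- by move=> /esym E; case/eqP: Da; apply: big; rewrite ?inE ?eqxx.
- by move=> E; case/eqP: Ca; apply: big; rewrite ?inE ?eqxx.
- by [].
Qed.

Lemma mem_imset_ccomp x : (ccomp S x \in ccomp S @: X) = (x \in X).
Proof.
apply/imsetP/idP => [[y yX /eqP]|xX]; last by exists x.
by rewrite ccomp_eq => xy; rewrite (saturated_mem sX xy).
Qed.

Lemma ncomp_setU1_merge : a \in X -> b \in X -> ~~ joined S e ->
  (ncomp S' X').+1 = ncomp S X.
Proof.
move=> aX bX nj; rewrite /ncomp imset_ccomp_setU1.
set A := ccomp S @: X.
have aA : ccomp S a \in A by rewrite mem_imset_ccomp.
have bA : ccomp S b \in A by rewrite mem_imset_ccomp.
have nab : ccomp S a != ccomp S b by rewrite ccomp_eq.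
(* Both end components have the same image; dropping one of them makes [F] injective. *)
have -> : F @: A = F @: (A :\ ccomp S b).
  apply/setP => C; apply/imsetP/imsetP => -[D].
    have [->|Db DA] := eqVneq D (ccomp S b) => [_|] ->; last first.
      by exists D; rewrite // !inE Db.
    by exists (ccomp S a); rewrite ?in_setD1 ?nab // /F !inE !eqxx orbT.
  by rewrite inE => /andP[_]; exists D.
rewrite card_in_imset ?(cardsD1 (ccomp S b) A) ?bA //.
by apply: F_inj; rewrite ?subsetDl // !inE eqxx andbF.
Qed.

(** The relation x^2 = 0: degree is lost exactly when two distinct components labelled x merge. *)
Lemma ncomp_setU1 : (ncomp S' X' == ncomp S X) =
  ~~ [&& a \in X, b \in X & ~~ joined S e].
Proof.
case: (boolP [&& _, _ & _]) => [/and3P[aX bX nj]|nabj] /=.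
  by rewrite -(ncomp_setU1_merge aX bX nj) ltn_eqF.
apply/eqP; rewrite /ncomp imset_ccomp_setU1.
case: (boolP (joined S e)) nabj => je nab.
  have ab : ccomp S a = ccomp S b by apply/eqP; rewrite ccomp_eq.
  rewrite (_ : F @: _ = ccomp S @: X) //.
  have FE C : F C = C by rewrite /F ab !setUid inE; case: eqP.
  by apply/setP => C; apply/imsetP/idP => [[D DX ->]|CX]; [|exists C]; rewrite ?FE.
apply: card_in_imset; apply: F_inj => //; rewrite !mem_imset_ccomp.
by move: nab; rewrite andbT.
Qed.

End AddEdge.

End Connectivity.

(** * Activities *)

Arguments edge_lt : simpl never.

Section Activity.
Variables (G : sgraph) (le : rel (edge G)).
Hypothesis le_order : total_order le.
Implicit Types (S T R : {set edge G}) (X : {set G}) (e f g : edge G) (x y z : G).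
Local Notation lt := (edge_lt le).

Lemma lt_irr e : lt e e = false.
Proof. by rewrite /edge_lt eqxx. Qed.

Lemma lt_trans f e g : lt e f -> lt f g -> lt e g.
Proof.
have [_ anti tr _] := le_order; rewrite /edge_lt.
move=> /andP[ef lef] /andP[fg lfg]; rewrite (tr _ _ _ lef lfg) andbT.
by apply: contraNneq ef => E; apply/eqP/anti; rewrite lef E lfg.
Qed.

Lemma lt_total e f : e != f -> lt e f || lt f e.
Proof.
have [_ _ _ tot] := le_order.
by rewrite /edge_lt => ef; rewrite ef eq_sym ef tot.
Qed.

Lemma lt_asym e f : lt e f -> lt f e = false.
Proof. by move=> ef; apply/negP => /(lt_trans ef); rewrite lt_irr. Qed.

Lemma leE e f : le e f = ~~ lt f e.
Proof.
have [refl _ _ _] := le_order.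
have [->|ef] := eqVneq e f; first by rewrite lt_irr refl.
have [lef|nef] := boolP (lt e f).
  by rewrite (lt_asym lef); case/andP: lef.
have := lt_total ef; rewrite (negbTE nef) /= => ->.
by move: nef; rewrite /edge_lt ef /= => /negbTE.
Qed.

Definition below e := [set f | lt f e].
Definition above e := [set f | lt e f].

Definition erank e := #|below e|.

Lemma erank_lt e f : lt e f -> (erank e < erank f)%N.
Proof.
move=> ef; apply/proper_card/properP; split.
  by apply/subsetP => g; rewrite !inE => /lt_trans; apply.
by exists e; rewrite !inE ?lt_irr.
Qed.

Lemma ltE e f : lt e f = (erank e < erank f)%N.
Proof.
apply/idP/idP; first exact: erank_lt.
apply: contraTT => nef; rewrite -leqNgt.
have [->//|ef] := eqVneq e f.
by have := lt_total ef; rewrite (negbTE nef) => /erank_lt/ltnW.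
Qed.

Lemma erank_inj : injective erank.
Proof.
move=> e f E; apply/eqP; apply: contraT => /lt_total.
by rewrite !ltE E ltnn.
Qed.

Lemma exists_smallest S : S != set0 ->
  exists2 e, e \in S & forall f, f \in S -> f != e -> lt e f.
Proof.
case/set0Pn => e0 e0S; have [e eS emin] := @arg_minnP _ e0 [in S] erank e0S.
exists e => // f fS fe; have := lt_total fe.
by rewrite [lt f e]ltE ltnNge (emin f fS).
Qed.

Lemma smallestP e S : reflect (e \in S /\ forall f, f \in S -> ~~ lt f e)
  (smallest le e S).
Proof.
apply: (iffP andP) => -[eS mS]; split=> //; last first.
  by apply/forall_inP => f /mS; rewrite leE.
by move=> f fS; rewrite -leE; apply: (forall_inP mS).
Qed.

Lemma largestP e S : reflect (e \in S /\ forall f, f \in S -> ~~ lt e f)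
  (largest le e S).
Proof.
apply: (iffP andP) => -[eS mS]; split=> //; last first.
  by apply/forall_inP => f /mS; rewrite leE.
by move=> f fS; rewrite -leE; apply: (forall_inP mS).
Qed.

(* External and internal activity of an arbitrary edge set [S]: for a spanning *)
(* tree these are Tutte's activities, and [ext S] is empty exactly when [S]    *)
(* contains no broken circuit.                                                 *)
Definition ext S := [set e | joined (S :&: above e) e].
Definition act S := [set e | ~~ joined ((S :\ e) :|: below e) e].
Definition nbc S := ext S == set0.
(** [inn S] and [tot S] bound the interval of the sets obtained from [S] by adding and removing
    active edges; for an NBC tree they are IN(T) and T. *)
Definition inn S := S :\: act S.
Definition tot S := S :|: act S.

Lemma in_inn S e : (e \in inn S) = (e \notin act S) && (e \in S).
Proof. exact: in_setD. Qed.

Lemma in_tot S e : (e \in tot S) = (e \in S) || (e \in act S).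
Proof. exact: in_setU. Qed.

Lemma nbcP S : reflect (forall e, ~~ joined (S :&: above e) e) (nbc S).
Proof.
apply: (iffP eqP) => [S0 e|nS].
  by have := in_set0 e; rewrite -S0 inE => ->.
by apply/setP => e; rewrite !inE (negbTE (nS e)).
Qed.

Lemma nbc_sub S T : S \subset T -> nbc T -> nbc S.
Proof.
move=> ST /nbcP nT; apply/nbcP => e; apply: contra (nT e).
exact/joined_sub/setSI.
Qed.

(** A minimal subset with an edge joined by its other edges is a circuit, and its smallest edge
    would be joined by larger edges of [S]. *)
Lemma nbc_forest S e : nbc S -> e \in S -> ~~ joined (S :\ e) e.
Proof.
move=> nS eS; apply/negP => je.
pose P (R : {set edge G}) := [exists e in R, joined (R :\ e) e].
have PS : P S by apply/exists_inP; exists e.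
have [R /minsetP[/exists_inP[g gR jg] minR] RS] := minset_exists PS.
(* If the rest of [R] did not join [f], then by [exchange] R - f would still have [g] joined by its
   other edges, against minimality. *)
have allR f : f \in R -> joined (R :\ f) f.
  move=> fR; have [->//|fg] := eqVneq f g.
  apply: contraT => njf; have: R :\ f = R; last first.
    by move/setP/(_ f); rewrite !inE eqxx fR.
  apply: minR; last exact: subsetDl.
  apply/exists_inP; exists g; first by rewrite !inE eq_sym fg.
  apply: contraNT njf => njg.
  have /exchange /(_ njg) : joined (f |: (R :\ f) :\ g) g.
    apply: joined_sub jg; apply/subsetP => h; rewrite !inE.
    by case: (h == f); case: (h == g).
  apply: joined_sub; apply/subsetP => h; rewrite !inE => /orP[/eqP->|/and3P[_ -> ->] //].
  by rewrite gR eq_sym fg.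
have [|f fR minf] := @exists_smallest R; first by apply/set0Pn; exists g.
have /nbcP/(_ f)/negP := nS; apply; apply: joined_sub (allR f fR).
apply/subsetP => h; rewrite !inE => /andP[hf hR].
by rewrite (subsetP RS) // minf.
Qed.

Lemma nbc_add_joined S e : nbc (e |: S) -> e \notin S -> ~~ joined S e.
Proof. by move=> nS eS; have := nbc_forest nS (setU11 e S); rewrite setU1K. Qed.

Lemma act_anti S T : S \subset T -> act T \subset act S.
Proof.
move=> ST; apply/subsetP => e; rewrite !inE; apply: contra.
exact/joined_sub/setSU/setSD.
Qed.

(** Could [e] make some active [f] inactive? If e < f, then [e] already lies in [below f]. If f < e,
    [exchange] would join [e] by [S] and smaller edges, against its activity. *)
Lemma act_setU1 S e : e \in act S -> act (e |: S) = act S.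
Proof.
move=> eS; have [eS'|neS] := boolP (e \in S).
  by rewrite (setUidPr _) // sub1set.
apply/eqP; rewrite eqEsubset act_anti ?subsetUr //=.
apply/subsetP => f fS; rewrite inE; apply/negP => jf.
have [ef|fe] := eqVneq f e.
  move: fS; rewrite inE => /negP; apply.
  apply: joined_sub jf; apply/subsetP => h; rewrite !inE ef.
  by case: eqP.
have njf : ~~ joined ((S :\ f) :|: below f) f by move: fS; rewrite inE.
have [ltef|nltef] := boolP (lt e f).
  case/negP: njf; apply: joined_sub jf; apply/subsetP => h; rewrite !inE.
  by case: (eqVneq h e) => [->|] //=; rewrite ltef !orbT.
have ltfe : lt f e by have := lt_total fe; rewrite (negbTE nltef) orbF.
move: eS; rewrite inE => /negP; apply.
have /exchange/(_ njf) : joined (e |: ((S :\ f) :|: below f)) f.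
  apply: joined_sub jf; apply/subsetP => h; rewrite !inE.
  by case: (h == f); case: (h == e).
apply: joined_sub; apply/subsetP => h; rewrite !inE.
case/or3P=> [/eqP->|/andP[_ hS]|hf]; rewrite ?ltfe ?orbT //.
  by rewrite hS andbT; apply/orP; left; apply: contraNneq neS => <-.
by rewrite (lt_trans hf ltfe) orbT.
Qed.

Lemma act_setU S R : R \subset act S -> act (S :|: R) = act S.
Proof.
have [n] := ubnP #|R|; elim: n R => // n IHn R; rewrite ltnS => Rn RS.
have [->|/set0Pn[e eR]] := eqVneq R set0; first by rewrite setU0.
have sR : R :\ e \subset act S by apply: subset_trans RS; apply: subsetDl.
have IH : act (S :|: R :\ e) = act S.
  by apply: IHn => //; move: Rn; rewrite (cardsD1 e) eR.
have -> : S :|: R = e |: (S :|: R :\ e).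
  by rewrite setUCA (setD1K eR).
by rewrite act_setU1 IH // (subsetP RS).
Qed.

Lemma act_setD S R : R \subset act S -> act (S :\: R) = act S.
Proof.
move=> RS; have sR : S :&: R \subset act (S :\: R).
  by apply: subset_trans (act_anti (subsetDl _ _)); apply: subset_trans RS; apply: subsetIr.
by rewrite -(act_setU sR) setUC setID.
Qed.

Lemma act_setD1 S e : e \in act S -> act (S :\ e) = act S.
Proof. by move=> eS; apply: act_setD; rewrite sub1set. Qed.

Lemma act_tot S : act (tot S) = act S. Proof. exact: act_setU. Qed.
Lemma act_inn S : act (inn S) = act S. Proof. exact: act_setD. Qed.

Lemma inn_tot S : inn (tot S) = inn S.
Proof. by rewrite /inn act_tot /tot setDUl setDv setU0. Qed.

Lemma inn_inn S : inn (inn S) = inn S.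
Proof. by rewrite {1}/inn act_inn /inn setDDl setUid. Qed.

Lemma tot_inn S : tot (inn S) = tot S.
Proof.
apply/setP => e; rewrite !(act_inn, inE).
by case: (e \in S); rewrite /= ?andbT ?orNb ?andbF.
Qed.

Lemma inn_mono S T : S \subset T -> inn S \subset inn T.
Proof. by move=> ST; apply: setDSS => //; apply: act_anti. Qed.

Lemma inn_setU1 S e : e \in act S -> inn (e |: S) = inn S.
Proof.
move=> eS; rewrite /inn act_setU1 // setDUl.
by rewrite (_ : [set e] :\: _ = set0) ?set0U //; apply/eqP; rewrite setD_eq0 sub1set.
Qed.

Lemma inn_setD1 S e : e \in act S -> inn (S :\ e) = inn S.
Proof.
move=> eS; rewrite /inn act_setD1 // setDDl (setUidPr _) //; by rewrite sub1set.
Qed.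

Lemma tot_setU1 S e : e \in act S -> tot (e |: S) = tot S.
Proof.
move=> eS; rewrite /tot act_setU1 // -setUA setUCA.
by rewrite (setUidPr (_ : [set e] \subset act S)) // sub1set.
Qed.

Lemma tot_setD1 S e : e \in act S -> tot (S :\ e) = tot S.
Proof.
move=> eS; rewrite /tot act_setD1 //; apply/setP => f; rewrite !inE.
by have [->|] := eqVneq f e => //=; move: eS; rewrite inE => ->; rewrite orbT.
Qed.

(** Leaving a block strictly enlarges [inn]; this makes the filtration work. *)
Lemma inn_add S e : e \notin S -> e \notin act S -> inn S \proper inn (e |: S).
Proof.
move=> eS eA; apply/properP; split; first exact/inn_mono/subsetUr.
exists e; last by rewrite inE (negbTE eS) andbF.
by rewrite inE setU11 andbT; apply: contra eA; apply/subsetP/act_anti/subsetUr.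
Qed.

(** If [e] helped larger edges to join some [f], then f < e, and [exchange] would join [e] by [S]
    and the smaller edge [f]. *)
Lemma nbc_setU1 S e : nbc S -> e \in act S -> nbc (e |: S).
Proof.
move=> nS eA; have [eS|eS] := boolP (e \in S).
  by rewrite (setUidPr _) // sub1set.
have /nbcP nS' := nS; apply/nbcP => f; apply/negP => jf.
have /exchange/(_ (nS' f)) : joined (e |: (S :&: above f)) f.
  apply: joined_sub jf; apply/subsetP => h; rewrite !inE.
  by case: (h == e).
have [lfe|nlfe] := boolP (lt f e); last first.
  case/negP: (nS' f); apply: joined_sub jf; apply/subsetP => h; rewrite !inE.
  by have [->|] := eqVneq h e => //=; rewrite (negbTE nlfe).
move: eA; rewrite inE => /negP nj /(joined_sub _) je; apply/nj/je.
apply/subsetP => h; rewrite !inE => /orP[/eqP->|/andP[hS _]]; first by rewrite lfe orbT.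
by rewrite hS andbT; apply/orP; left; apply: contraNneq eS => <-.
Qed.

Lemma nbc_setU S R : nbc S -> R \subset act S -> nbc (S :|: R).
Proof.
move=> nS; have [n] := ubnP #|R|; elim: n R => // n IHn R; rewrite ltnS => Rn RS.
have [->|/set0Pn[e eR]] := eqVneq R set0; first by rewrite setU0.
have sR : R :\ e \subset act S by apply: subset_trans RS; apply: subsetDl.
rewrite -(setD1K eR) setUCA; apply: nbc_setU1.
  by apply: IHn => //; move: Rn; rewrite (cardsD1 e) eR.
by rewrite act_setU // (subsetP RS).
Qed.

Lemma nbc_tot S : nbc S -> nbc (tot S).
Proof. by move=> nS; apply: nbc_setU. Qed.

(* Kruskal's algorithm modulo [S]. *)
Lemma act_spans S e : joined (S :|: (act S :\: above e)) e.
Proof.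
have [n] := ubnP (erank e); elim: n e => // n IHn e; rewrite ltnS => en.
have [eA|] := boolP (e \in act S).
  by apply: joined_in; rewrite in_setU in_setD eA inE lt_irr orbT.
rewrite inE negbK; apply: joined_closure => f; rewrite !inE => /orP[/andP[_ fS]|fe].
  by apply: joined_in; rewrite inE fS.
have: joined (S :|: (act S :\: above f)) f.
  by apply: IHn; apply: leq_trans en; rewrite -ltE.
apply: joined_sub; apply/setUS/setDS/subsetP => h.
by rewrite !inE; apply: lt_trans.
Qed.

Lemma tot_joined S e : joined (tot S) e.
Proof. by apply: joined_sub (act_spans S e); apply/setUS/subsetDl. Qed.

Lemma cn_tot (conn : connected_graph G) S x y : cn (tot S) x y.
Proof.
apply: connect_sub (conn x y) => u v uv.
have exy : is_edge [set u; v].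
  by apply/existsP; exists u; apply/existsP; exists v; rewrite uv eqxx.
have := tot_joined S (exist _ [set u; v] exy).
by rewrite (@joined_ends _ _ _ u v).
Qed.

Lemma cn0 x y : cn set0 x y = (x == y).
Proof.
apply/idP/eqP => [|->]; last exact: cnxx.
move/(@cn_ind _ _ (pred1 x)) => /= P; apply/esym/eqP/P; last exact: eqxx.
by move=> u v /sadjP[e]; rewrite inE.
Qed.

(** Euler's formula for a forest: removing an edge splits one component in two. *)
Lemma ncomp_nbc S : nbc S -> (ncomp S setT + #|S| = #|G|)%N.
Proof.
have [n] := ubnP #|S|; elim: n S => // n IHn S; rewrite ltnS => Sn nS.
have [->|/set0Pn[e eS]] := eqVneq S set0.
  rewrite cards0 addn0 /ncomp card_imset ?cardsT // => x y /eqP.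
  by rewrite ccomp_eq cn0 => /eqP.
have nj := nbc_forest nS eS.
have IH : (ncomp (S :\ e) setT + #|S :\ e| = #|G|)%N.
  apply: IHn; first by move: Sn; rewrite (cardsD1 e) eS.
  by apply: nbc_sub nS; apply: subsetDl.
rewrite -IH -(ncomp_setU1_merge (saturatedT _) _ _ nj) ?inE // setD1K //.
rewrite (_ : cl S setT = setT) ?(cardsD1 e S) ?eS ?addnS ?add1n ?addSn //.
by apply/eqP; apply: saturatedT.
Qed.

End Activity.

(** * Walks, cycles and spanning trees *)

Section Walks.
Variable G : sgraph.
Implicit Types (S T A R : {set edge G}) (e f g : edge G) (x y z : G) (p : seq G).

Lemma walk_edges_cons x y p :
  walk_edges x (y :: p) = [set e | ends e == [set x; y]] :|: walk_edges y p.
Proof. by apply/setP => e; rewrite !inE. Qed.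

Lemma walk_edges_rcons x p y : walk_edges x (rcons p y) =
  walk_edges x p :|: [set e | ends e == [set last x p; y]].
Proof.
elim: p x => [|z p IHp] x /=; last by rewrite !walk_edges_cons IHp setUA.
by apply/setP => e; rewrite !inE /= orbF.
Qed.

Lemma walk_edges_ends x p e z :
  e \in walk_edges x p -> z \in ends e -> z \in x :: p.
Proof.
elim: p x => [|y p IHp] x; first by rewrite inE.
rewrite walk_edges_cons in_setU inE => /orP[/eqP->|ep ze].
  by rewrite !inE => /orP[]->; rewrite ?orbT.
by rewrite inE (IHp y ep ze) orbT.
Qed.

Lemma sadj_adj S x y : sadj S x y -> adj x y.
Proof.
by case/sadj_edge=> e _ [][-> ->]; [|rewrite adj_sym]; apply: adj_esrc.
Qed.

Lemma adj_edge x y : adj x y -> exists e : edge G, ends e = [set x; y].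
Proof.
move=> xy; have exy : is_edge [set x; y].
  by apply/existsP; exists x; apply/existsP; exists y; rewrite xy eqxx.
by exists (exist _ [set x; y] exy).
Qed.

Lemma sub_sadj S T : S \subset T -> subrel (sadj S) (sadj T).
Proof.
by move=> /subsetP ST x y /sadjP[e /ST eT E]; apply/sadjP; exists e.
Qed.

Lemma walk_edges_path x p : path (@adj G) x p -> path (sadj (walk_edges x p)) x p.
Proof.
elim: p x => [|y p IHp] x //= /andP[xy yp]; apply/andP; split.
  have [e E] := adj_edge xy; apply/sadjP; exists e => //.
  by rewrite walk_edges_cons !inE E eqxx.
by apply: sub_path (IHp y yp); apply: sub_sadj; rewrite walk_edges_cons subsetUr.
Qed.

Lemma walk_edges_sub T x p : path (sadj T) x p -> walk_edges x p \subset T.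
Proof.
elim: p x => [|y p IHp] x /=.
  by move=> _; apply/subsetP => e; rewrite inE.
case/andP=> /sadjP[e eT E] /IHp yp; rewrite walk_edges_cons subUset yp andbT.
by apply/subsetP => f; rewrite inE -E => /eqP/ends_inj->.
Qed.

Lemma walk_avoid T R x p : path (sadj T) x p ->
  [disjoint R & walk_edges x p] -> cn (T :\: R) x (last x p).
Proof.
elim: p x => [|y p IHp] x /=; first by move=> _ _; apply: cnxx.
case/andP=> /sadjP[e eT E] /IHp yp; rewrite walk_edges_cons.
rewrite disjoints_subset setCU subsetI -!disjoints_subset => /andP[eR /yp].
apply: cn_trans; apply/connect1/sadjP; exists e => //.
rewrite inE eT andbT; apply: contraTN eR => eR.
by apply/pred0Pn; exists e; rewrite /= eR inE E eqxx.
Qed.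

Lemma walk_cut T x p g : path (sadj T) x p -> uniq (x :: p) ->
  g \in walk_edges x p -> exists a b,
    [/\ ends g = [set a; b], cn (T :\ g) x a & cn (T :\ g) b (last x p)].
Proof.
elim: p x => [|y p IHp] x; first by rewrite inE.
move=> /= /andP[xy yp] /andP[xyp uyp]; rewrite walk_edges_cons in_setU inE.
have [E _|nE /= gp] := eqVneq (ends g) [set x; y].
  exists x, y; split=> //; first exact: cnxx.
  apply: walk_avoid yp _; rewrite disjoints1; apply: contra xyp => /walk_edges_ends.
  by apply; rewrite E set21.
have [a [b [E ya bl]]] := IHp y yp uyp gp; exists a, b; split=> //.
apply: cn_trans ya; have [f fT F] := sadjP _ _ _ xy.
apply/connect1/sadjP; exists f; rewrite // !inE fT andbT.
by apply: contraNneq nE => <-; rewrite F.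
Qed.

(** Two steps at least are required so that the closing edge is not the first edge run backwards. *)
Lemma closing_edge x p f : (1 < size p)%N -> uniq (x :: p) ->
  ends f = [set last x p; x] -> f \notin walk_edges x p.
Proof.
case: p => [|y [|z p]] // _ /= /and3P[xp yp up] E.
rewrite walk_edges_cons in_setU inE [in X in X || _]E negb_or; apply/andP; split.
  apply: contra yp => /eqP/set2_eq[][lx xy]; last by rewrite -lx mem_last.
  by rewrite xy in_cons eqxx in xp.
apply: contra xp => /walk_edges_ends; apply; by rewrite E set22.
Qed.

Lemma cycle_joined A e : cycle_set A -> e \in A -> joined (A :\ e) e.
Proof.
move=> /asboolP[x [p [p1 up pA ->]]]; set B := walk_edges x _ => eB.
have pB : path (sadj B) x (rcons p x) by apply: walk_edges_path.
have [pB' lB] : path (sadj B) x p /\ sadj B (last x p) x.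
  by move: pB; rewrite rcons_path => /andP[].
have [f fB F] := sadjP _ _ _ lB; have fp := closing_edge p1 up F.
move: eB; rewrite {1}/B walk_edges_rcons in_setU => /orP[ep|]; last first.
  rewrite inE -F => /eqP/ends_inj->; rewrite (joined_ends _ F) cnC.
  by apply: walk_avoid pB' _; rewrite disjoints1.
have [a [b [E xa bl]]] := walk_cut pB' up ep; rewrite (joined_ends _ E) cnC.
apply: cn_trans bl (cn_trans _ xa); apply/connect1/sadjP; exists f => //.
by rewrite in_setD1 fB andbT; apply: contraNneq fp => ->.
Qed.

Lemma joined_cycle S e : joined S e -> e \notin S ->
  exists A, [/\ cycle_set A, e \in A & A \subset e |: S].
Proof.
case/connectP=> p0 /shortenP[p pS up _] lp eS.
have E : ends e = [set last (esrc e) p; esrc e] by rewrite endsE setUC lp.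
exists (walk_edges (esrc e) (rcons p (esrc e))); split.
- apply/asboolP; exists (esrc e), p; split=> //.
    case: p pS up lp E => [|y [|z p]] //=.
      by move=> _ _ lp; have := esrc_neq e; rewrite lp eqxx.
    rewrite andbT => /sadjP[f fS F] _ _; rewrite setUC -F => /ends_inj ef.
    by rewrite ef fS in eS.
  rewrite rcons_path (sub_path (@sadj_adj S)) //= -lp adj_sym.
  exact: adj_esrc.
- by rewrite walk_edges_rcons !inE E eqxx orbT.
rewrite walk_edges_rcons subUset; apply/andP; split.
  by apply: subset_trans (subsetUr _ _); apply: walk_edges_sub.
by apply/subsetP => f; rewrite inE -E => /eqP/ends_inj->; apply: setU11.
Qed.

Lemma cycle_set_neq0 A : cycle_set A -> A != set0.
Proof.
move=> /asboolP[x [[|y p] [// _ _ /= /andP[xy _] ->]]].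
have [e E] := adj_edge xy; apply/set0Pn; exists e.
by rewrite walk_edges_cons !inE E eqxx.
Qed.

End Walks.

(** * Activities, cycles and [psi] for NBC spanning trees *)

Section Trees.
Variables (G : sgraph) (le : rel (edge G)) (vd : G).
Hypothesis le_order : total_order le.
Implicit Types (S T R : {set edge G}) (X : {set G}) (e f g : edge G) (x y z : G).
Local Notation lt := (edge_lt le).
Local Notation nbc := (nbc le).
Local Notation act := (act le).
Local Notation inn := (inn le).
Local Notation tot := (tot le).

(** For an edge of a spanning tree, the side away from the root: the vertices whose path to the root
    uses [e]. *)
Definition far T e : {set G} := [set v | ~~ cn (T :\ e) vd v].

(** A cycle without its smallest edge joins that edge by larger ones; conversely a path of larger
    edges joining [e] closes up to a cycle with minimum [e]. *)
Lemma nbc_broken T : nbc T = [forall A, broken_circuit le A ==> ~~ (A \subset T)].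
Proof.
apply/(nbcP le _)/forall_inP => [nT A /existsP[Z /existsP[e]]|nT e].
  case/and3P=> Zc /(smallestP le_order)[eZ minZ] /eqP->; apply: contra (nT e) => ZT.
  apply: joined_sub (cycle_joined Zc eZ); rewrite subsetI ZT.
  apply/subsetP => f; rewrite !inE => /andP[fe /minZ].
  by have := lt_total le_order fe; case: (lt f e) => //= ->.
apply/negP => je; have eT : e \notin T :&: above le e.
  by rewrite !inE lt_irr andbF.
have [A [Ac eA AT]] := joined_cycle je eT.
have AeT : A :\ e \subset T :&: above le e by rewrite subDset.
have /nT/negP : broken_circuit le (A :\ e).
  apply/existsP; exists A; apply/existsP; exists e; rewrite Ac eqxx andbT /=.
  apply/(smallestP le_order); split=> // f fA; have [->|fe] := eqVneq f e.
    by rewrite lt_irr.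
  have: f \in T :&: above le e by apply: (subsetP AeT); rewrite !inE fe.
  by rewrite !inE => /andP[_ /(lt_asym le_order)->].
by apply; apply: subset_trans AeT (subsetIl _ _).
Qed.

Lemma nbc_acyclic T A : nbc T -> cycle_set A -> ~~ (A \subset T).
Proof.
move=> nT Ac; have /set0Pn[e eA] := cycle_set_neq0 Ac; apply/negP => AT.
have /negP := nbc_forest le_order nT (subsetP AT _ eA); apply.
by apply: joined_sub (cycle_joined Ac eA); apply: setSD.
Qed.

Lemma nbc_treeP T : reflect (nbc T /\ forall x y, cn T x y) (nbc_tree le T).
Proof.
apply: (iffP andP) => [[/andP[/forallP sp _]]|[nT sp]].
  by rewrite -nbc_broken => nT; split=> // x y; apply: (forallP (sp x)).
rewrite -nbc_broken; split=> //; apply/andP; split.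
  by apply/forallP => x; apply/forallP => y; apply: sp.
by apply/forall_inP => A; apply: nbc_acyclic.
Qed.

Section Tree.
Variable T : {set edge G}.
Hypothesis (nT : nbc T) (spT : forall x y, cn T x y).

Lemma tree_act_sub : act T \subset T.
Proof.
apply/subsetP => e; rewrite inE; apply: contraNT => eT.
apply: joined_sub (spT _ _ : joined T e).
by apply/subsetP => f fT; rewrite !inE fT andbT; apply/orP; left; apply: contraNneq eT => <-.
Qed.

Lemma tree_tot : tot T = T.
Proof. by apply/setUidPl/tree_act_sub. Qed.

Lemma cutE e f : (f \in cut T e) = ~~ joined (T :\ e) f.
Proof.
rewrite inE; apply/exists_inP/idP => [[x xf /exists_inP[y yf]]|nj].
  apply: contra => jf; move: xf yf; rewrite endsE !inE.
  by move=> /orP[]/eqP-> /orP[]/eqP->; rewrite -/(cn _ _ _) ?cnxx // cnC.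
exists (esrc f); first exact: esrc_in.
by apply/exists_inP; exists (edst f); first exact: edst_in.
Qed.

(** The cut of [e] consists of the edges not joined by T - e. If [e] is its minimum, all smaller
    edges are joined by T - e and do not help to join [e]; a smaller edge of the cut, by contrast,
    reconnects T - e. *)
Lemma IA_act : IA le T = act T.
Proof.
apply/setP => e; rewrite inE; apply/andP/idP => [[eT /(smallestP le_order)]|eA].
  rewrite cutE => -[nj minc]; rewrite inE; apply: contra nj.
  apply: joined_closure => f; rewrite in_setU => /orP[/joined_in//|].
  rewrite inE => fe; apply: contraLR fe => nj; apply: minc.
  by rewrite cutE.
have eT := subsetP tree_act_sub e eA; split=> //; apply/(smallestP le_order).
rewrite cutE (nbc_forest le_order nT eT); split=> // f; rewrite cutE; apply: contra => fe.
have [//|nj] := boolP (joined (T :\ e) f).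
have: joined (f |: (T :\ e)) e.
  by apply: exchange nj; rewrite setD1K //; apply: spT.
move: eA; rewrite inE => /negP nje je; case: nje; apply: joined_sub je.
by rewrite setUC; apply: setUS; rewrite sub1set inE.
Qed.

Lemma IN_inn : IN le T = inn T.
Proof. by rewrite /IN IA_act. Qed.

(** T - e has at most two components, as every vertex still reaches an end of [e]. *)
Lemma far_split e u v : e \in T -> cn (T :\ e) u v = ((u \in far T e) == (v \in far T e)).
Proof.
move=> eT; rewrite !inE.
have ab x : cn (T :\ e) x (esrc e) || cn (T :\ e) x (edst e).
  have: cn (e |: T :\ e) x (esrc e) by rewrite setD1K.
  rewrite cn_setU1.
  by case/or3P=> [->|/andP[->]|/andP[->]]; rewrite ?orbT.
apply/idP/eqP => [uv|]; first by rewrite cnC (cn_left uv) cnC.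
move/negb_inj => E; have [vu|vu] := boolP (cn (T :\ e) vd u); have vv := vu.
  by rewrite E in vv; apply: cn_trans vv; rewrite cnC.
rewrite E in vv.
have far_end w : ~~ cn (T :\ e) vd w -> forall z, cn (T :\ e) vd z ->
    cn (T :\ e) w z = false.
  by move=> nw z zz; apply: contraNF nw => wz; apply: cn_trans zz _; rewrite cnC.
case/orP: (ab vd) => vdx; have := ab u; have := ab v;
  rewrite !(far_end _ _ _ vdx) ?orbF //= => xv xu;
  by apply: cn_trans xu _; rewrite cnC.
Qed.

Lemma far_edst e : e \in T -> (edst e \in far T e) = (esrc e \notin far T e).
Proof.
move=> eT; have := nbc_forest le_order nT eT; rewrite /joined far_split //.
by case: (_ \in _); case: (_ \in _).
Qed.

Lemma far_end e : e \in T -> exists2 u, u \in ends e & u \in far T e.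
Proof.
move=> eT; have := far_edst eT; have [aF|_ bF] := boolP (esrc e \in far T e).
  by exists (esrc e); rewrite ?esrc_in.
by exists (edst e); rewrite ?edst_in.
Qed.

Lemma near_end e : e \in T -> exists2 u, u \in ends e & u \notin far T e.
Proof.
move=> eT; have := far_edst eT; have [aF bF|aF _] := boolP (esrc e \in far T e).
  by exists (edst e); rewrite ?edst_in ?bF.
by exists (esrc e); rewrite ?esrc_in.
Qed.

Lemma cn_ends S e u v : e \in S -> u \in ends e -> v \in ends e -> cn S u v.
Proof.
move=> eS; rewrite endsE !inE => /orP[]/eqP-> /orP[]/eqP->; rewrite ?cnxx //;
  [|rewrite cnC]; exact: joined_in.
Qed.

(** Both ends of [e] are beyond [f], so a walk from the root that stays on the near side of [f]
    never uses [e]. The near end of [e] makes the inclusion strict. *)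
Lemma far_nested e f u : e \in T -> f \in T -> e != f -> u \in ends e ->
  u \in far T f -> far T e \proper far T f.
Proof.
move=> eT fT ef ue uf.
have ends_far v : v \in ends e -> v \in far T f.
  move=> ve; have : cn (T :\ f) u v by apply: cn_ends ue ve; rewrite !inE ef.
  by rewrite far_split // uf => /eqP <-.
have sub : far T e \subset far T f.
  apply/subsetP => v; apply: contraLR; rewrite !inE !negbK => vdv.
  pose P z := (z \notin far T f) && cn (T :\ e) vd z.
  suff /andP[] : P v by [].
  apply: (@cn_ind _ _ P vd v _ vdv) => [x y|]; last by rewrite /P inE negbK !cnxx.
  move=> xy /andP[xf vx]; have /eqP xyf : (x \in far T f) == (y \in far T f).
    by rewrite -far_split //; apply: connect1.
  rewrite /P -xyf xf /=; apply: cn_trans vx _; apply: connect1.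
  have [g gT gE] := sadjP _ _ _ xy; apply/sadjP; exists g => //.
  move: gT; rewrite !inE => /andP[_ ->]; rewrite andbT.
  by apply: contraNneq xf => ge; apply: ends_far; rewrite -ge gE set21.
apply/properP; split=> //; have [v ve vF] := near_end eT.
by exists v => //; apply: ends_far.
Qed.

Lemma walk_far x p g : path (sadj T) x p -> uniq (x :: p) -> g \in T ->
  (g \in walk_edges x p) = ~~ cn (T :\ g) x (last x p).
Proof.
move=> pT up gT; apply/idP/idP => [gp|].
  have [a [b [E xa bl]]] := walk_cut pT up gp.
  have := nbc_forest le_order nT gT; apply: contra => xl.
  rewrite (joined_ends _ E) cnC; apply: cn_trans bl _.
  by rewrite cnC; apply: cn_trans xl; rewrite cnC.
apply: contraR => gp; apply: walk_avoid => //.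
by rewrite disjoints1.
Qed.

Lemma tree_pathE g v : g \in T -> (g \in tree_path vd T v) = (v \in far T g).
Proof.
move=> gT; rewrite /tree_path inE; case: pickP => [A /asboolP[p [pT <- up ->]]|no].
  exact: walk_far.
have /connectP[p0 /shortenP[p pT up _] lp] := spT vd v.
have /negP[] := negbT (no (walk_edges vd p)).
by apply/asboolP; exists p.
Qed.

Lemma IA_lengthE v : IA_length le vd T v = #|[set g in act T | v \in far T g]|.
Proof.
apply: eq_card => g; rewrite in_setI IA_act [RHS]inE.
have [gA|] //= := boolP (g \in act T).
by rewrite tree_pathE // (subsetP tree_act_sub).
Qed.

Lemma cycE e g : e \notin T -> g \in T -> (g \in cyc T e) = ~~ joined (T :\ g) e.
Proof.
move=> eT gT; rewrite /cyc; case: pickP => [A /andP[Ac AT]|no]; last first.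
  have [A [Ac _ AT]] := joined_cycle (spT _ _ : joined T e) eT.
  by have := no A; rewrite Ac AT.
have eA : e \in A.
  apply: contraT => eA; have /negP[] := nbc_acyclic nT Ac.
  apply/subsetP => f fA; have := subsetP AT f fA; rewrite in_setU1 => /predU1P[fe|//].
  by rewrite -fe fA in eA.
have ge : g != e by apply: contraNneq eT => <-.
apply/idP/idP => [gA|].
  have /negP ng := nbc_forest le_order nT gT; apply/negP => je; apply: ng.
  rewrite /joined -(cn_joined _ _ je); apply: cn_sub (cycle_joined Ac gA).
  apply/subsetP => f; rewrite !inE => /andP[fg /(subsetP AT)].
  by rewrite !inE fg.
apply: contraR => gA; apply: joined_sub (cycle_joined Ac eA).
apply/subsetP => f; rewrite !inE => /andP[fe fA].
have := subsetP AT f fA; rewrite in_setU1 (negbTE fe) /= => ->.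
by rewrite andbT; apply: contraNneq gA => <-.
Qed.

Lemma IA_cyc e : e \notin T ->
  IA le T :&: cyc T e = [set g in act T | ~~ joined (T :\ g) e].
Proof.
move=> eT; apply/setP => g; rewrite in_setI IA_act [RHS]inE.
have [gA|] //= := boolP (g \in act T).
by rewrite cycE // (subsetP tree_act_sub).
Qed.

(* The witness is the last active edge on the path from the root to [v]. *)
Lemma parent_edge v : ~~ cn (inn T) vd v -> exists e u,
  [/\ e \in act T, u \in ends e, u \in far T e & cn (inn T) u v].
Proof.
have /connectP[p0 /shortenP[p pT up _] ->] := spT vd v.
elim/last_ind: p pT up => [|p y IHp]; first by rewrite cnxx.
rewrite rcons_path last_rcons -rcons_cons rcons_uniq.
move=> /andP[pT py] /andP[yp up] nvy.
have [e eT eE] := sadjP _ _ _ py.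
have [eI|eI] := boolP (e \in inn T).
  have ly : cn (inn T) (last vd p) y by apply/connect1/sadjP; exists e.
  have [|f [u [fA uf uF ul]]] := IHp pT up; last first.
    by exists f, u; split=> //; apply: cn_trans ly.
  by apply: contra nvy => vl; apply: cn_trans ly.
have eA : e \in act T by move: eI; rewrite in_setD eT andbT negbK.
exists e, y; split=> //; [by rewrite eE set22 | | exact: cnxx].
rewrite inE; have := @walk_far vd (rcons p y) e; rewrite last_rcons => <- //.
- by rewrite walk_edges_rcons !inE eE eqxx orbT.
- by rewrite rcons_path pT.
- by rewrite -rcons_cons rcons_uniq yp.
Qed.

Lemma inn_setU1_notin e : e \notin T -> inn (e |: inn T) = e |: inn T.
Proof.
move=> eT; apply/eqP; rewrite eqEsubset subsetDl /=.
have eA : e \notin act T by apply: contra eT; apply: (subsetP tree_act_sub).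
rewrite subUset sub1set; apply/andP; split; last first.
  by have := inn_mono le (subsetUr [set e] (inn T)); rewrite inn_inn.
rewrite inE setU11 andbT; apply: contra eA; rewrite -[act T]act_inn //.
by apply/subsetP/act_anti/subsetUr.
Qed.

(** [tot (e |: inn T)] is a spanning tree inside T + e, so by counting it omits exactly one edge
    [g]. This [g] is active for [T] but not for [e |: inn T], which forces it to be the largest
    active edge of the cycle of [e]. *)
Lemma psiE (conn : connected_graph G) e :
  e \notin T -> nbc (e |: inn T) -> psi le T e = tot (e |: inn T).
Proof.
move=> eT nS; set S := e |: inn T; set C := IA le T :&: cyc T e.
have CE : C = [set g in act T | ~~ joined (T :\ g) e] by apply: IA_cyc.
have SA : act S \subset act T by rewrite -(act_inn le_order T) act_anti // subsetUr.
have large g : g \in act T -> g \notin act S -> largest le g C.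
  move=> gA; rewrite inE negbK => jg.
  have gT := subsetP tree_act_sub g gA.
  (* The smaller edges that witness the inactivity of [g] are replaced by smaller active edges of
     [T], by Kruskal's algorithm modulo [inn T]. *)
  have {}jg : joined (e |: (inn T :|: (act T :&: below le g))) g.
    apply: joined_closure jg => h; rewrite in_setU inE => /orP[/andP[_]|].
      rewrite in_setU1 => /predU1P[->|hI]; apply: joined_in; rewrite ?setU11 //.
      by rewrite !in_setU hI orbT.
    rewrite inE => hg.
    apply: joined_sub (act_spans le_order (inn T) h); rewrite act_inn //.
    apply: subset_trans (subsetUr _ _); apply/setUS/subsetP => k.
    rewrite !inE => /andP[nhk ->] /=.
    have [->//|kh] := eqVneq k h.
    have := lt_total le_order kh; rewrite (negbTE nhk) orbF => /(lt_trans le_order).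
    exact.
  have nj : ~~ joined (inn T :|: (act T :&: below le g)) g.
    apply: contra (nbc_forest le_order nT gT); apply: joined_sub.
    apply/subsetP => h; rewrite in_setU in_inn in_setI in_setD1.
    case/orP=> [/andP[hA hT]|/andP[hA]].
      by rewrite hT andbT; apply: contraNneq hA => ->.
    rewrite inE => hg; rewrite (subsetP tree_act_sub) // andbT.
    by apply: contraTneq hg => ->; rewrite lt_irr.
  (* So the cycle of [e] contains, besides inactive edges, only [g] and active edges below [g]. *)
  have je := exchange jg nj.
  have below_sub k : k \in act T -> ~~ lt k g -> k != g ->
      g |: (inn T :|: (act T :&: below le g)) \subset T :\ k.
    move=> kA kg nkg; apply/subsetP => h; rewrite in_setU1 in_setU in_inn in_setI.
    rewrite in_setD1 => /predU1P[->|/orP[/andP[hA hT]|/andP[hA]]].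
    - by rewrite gT eq_sym nkg.
    - by rewrite hT andbT; apply: contraNneq hA => ->.
    - rewrite inE => hg; rewrite (subsetP tree_act_sub) // andbT.
      by apply: contraTneq hg => ->.
  apply/(largestP le_order); rewrite CE; split.
    rewrite inE gA /=; apply: contra (nbc_forest le_order nT gT) => jTe.
    apply: (joined_closure _ jg) => h; rewrite in_setU1 => /predU1P[->//|hS].
    apply: joined_in; move: hS; rewrite in_setU in_inn in_setI in_setD1.
    case/orP=> [/andP[hA hT]|/andP[hA]].
      by rewrite hT andbT; apply: contraNneq hA => ->.
    rewrite inE => hg; rewrite (subsetP tree_act_sub) // andbT.
    by apply: contraTneq hg => ->; rewrite lt_irr.
  move=> k; rewrite inE => /andP[kA]; apply: contra => gk.
  apply: joined_sub je; apply: below_sub => //; first by rewrite (lt_asym le_order gk).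
  by apply: contraTneq gk => ->; rewrite lt_irr.
have nS' : nbc (tot S) by apply: nbc_tot.
have spS x y : cn (tot S) x y by apply: cn_tot.
have cardT R : nbc R -> (forall x y, cn R x y) -> #|R| = #|G|.-1.
  move=> nR spR; rewrite -(ncomp_nbc le_order nR) /ncomp.
  have -> : ccomp R @: setT = [set ccomp R vd]; last by rewrite cards1.
  apply/setP => D; rewrite inE; apply/imsetP/eqP => [[x _ ->]|->]; last by exists vd.
  by apply/eqP; rewrite ccomp_eq.
have totS : tot S \subset e |: T.
  rewrite subUset; apply/andP; split; first exact/setUS/subsetDl.
  by apply: subset_trans SA (subset_trans tree_act_sub (subsetUr _ _)).
have card1 : #|(e |: T) :\: tot S| = 1%N.
  have := cardsID (tot S) (e |: T); rewrite (setIidPr totS) cardsU1 eT.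
  by rewrite (cardT _ nS' spS) (cardT _ nT spT) addnC; move/addIn.
have /eqP/cards1P[g gE] := card1.
have: g \in (e |: T) :\: tot S by rewrite gE set11.
rewrite in_setD in_tot => /andP[/norP[gS gA]]; rewrite in_setU1 => /predU1P[ge|gT].
  by rewrite ge /S setU11 in gS.
have gAT : g \in act T.
  by move: gS; rewrite in_setU1 in_inn gT andbT negb_or negbK => /andP[].
have gl := large g gAT gA.
have -> : tot S = (e |: T) :\ g by rewrite -gE setDDr setDv set0U (setIidPr totS).
rewrite /psi; congr (_ :\: _); apply/setP => k; rewrite in_set1 inE.
apply/idP/eqP => [/(largestP le_order)[kC kmax]|->//].
have /(largestP le_order)[gC gmax] := gl.
apply/eqP; apply: contraT => /(lt_total le_order).
by rewrite (negbTE (gmax _ kC)) (negbTE (kmax _ gC)).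
Qed.

End Tree.

End Trees.

(** * Complexes of labelled edge sets *)

Section PairComplex.
Variables (G : sgraph) (le : rel (edge G)).
Implicit Types (S T R : {set edge G}) (X : {set G}) (e f g : edge G).

(* [(S, X)] is the spanning subgraph [S] whose components inside [X] are       *)
(* labelled x, all others being labelled 1.                                    *)
Definition pstate := ({set edge G} * {set G})%type.
Implicit Types p q : pstate.

Definition sg S e : int := (-1) ^+ #|[set e' in S | edge_lt le e' e]|.

Lemma sg_sq S e : sg S e * sg S e = 1.
Proof. by rewrite /sg -expr2 sqrr_sign. Qed.

Lemma sg_setD1 S e : sg (S :\ e) e = sg S e.
Proof.
congr (_ ^+ _); apply: eq_card => f; rewrite !inE.
by have [->|] //= := eqVneq f e; rewrite lt_irr andbF.
Qed.

Lemma sg_setU1 S e f : e \notin S -> sg (e |: S) f = (-1) ^+ edge_lt le e f * sg S f.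
Proof.
move=> eS; rewrite /sg -exprD; congr (_ ^+ _).
have [ef|nef] := boolP (edge_lt le e f).
  rewrite (_ : [set _ in _ | _] = e |: [set e' in S | edge_lt le e' f]).
    by rewrite cardsU1 inE (negbTE eS).
  apply/setP => h; rewrite !inE.
  by have [->|] //= := eqVneq h e; rewrite ef.
apply: eq_card => h; rewrite !inE.
by have [->|] //= := eqVneq h e; rewrite (negbTE nef) (negbTE eS).
Qed.

Hypothesis le_order : total_order le.

Lemma sg_anti S e f : e \notin S -> f \notin S -> e != f ->
  sg S e * sg (e |: S) f = - (sg S f * sg (f |: S) e).
Proof.
move=> eS fS ef; rewrite !sg_setU1 // !mulrA [sg S e * _]mulrC [sg S f * _]mulrC.
rewrite -!mulrA [sg S f * _]mulrC -mulNr; congr (_ * _).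
case/orP: (lt_total le_order ef) => lef; rewrite lef (lt_asym le_order lef) ?opprK //.
Qed.

Definition padd e p : pstate := (e |: p.1, cl (e |: p.1) p.2).

(** For a saturated pair: [e] is new and no product x^2 arises, so its term in the differential is
    nonzero. *)
Definition pok e p :=
  (e \notin p.1) && (ncomp (padd e p).1 (padd e p).2 == ncomp p.1 p.2).

Definition pdeg p : nat * nat := (#|p.1|, ncomp p.1 p.2).

Lemma padd_comm e f p : padd e (padd f p) = padd f (padd e p).
Proof. by rewrite /padd /= !cl_comp ?subsetUr // setUCA. Qed.

Lemma padd_deg e p : pok e p -> pdeg (padd e p) = ((pdeg p).1.+1, (pdeg p).2).
Proof. by case/andP => eS /eqP E; rewrite /pdeg E cardsU1 eS. Qed.

Definition psat p := saturated p.1 p.2.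

(** The number of components in [X] never increases, so two additions are both allowed exactly when
    the final count equals the initial one, a condition symmetric in [e] and [f]. *)
Lemma pok_comm e f p :
  pok e p && pok f (padd e p) = pok f p && pok e (padd f p).
Proof.
have n_leq g q : (ncomp (padd g q).1 (padd g q).2 <= ncomp q.1 q.2)%N.
  exact: ncomp_setU1_leq.
have H g h : pok g p && pok h (padd g p) = [&& g \notin p.1, h \notin g |: p.1 &
    ncomp (padd h (padd g p)).1 (padd h (padd g p)).2 == ncomp p.1 p.2].
  rewrite /pok; set n1 := ncomp (padd g p).1 _; set n2 := ncomp (padd h _).1 _.
  have n10 : (n1 <= ncomp p.1 p.2)%N := n_leq g p.
  have n21 : (n2 <= n1)%N := n_leq h _.
  rewrite -andbA /=.
  case: (g \notin p.1) => //=; case: (h \notin _); rewrite ?andbF //=.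
  apply/andP/idP => [[/eqP <- ->] //|/eqP n20]; rewrite -n20 in n10 *.
  by split; rewrite eqn_leq ?n10 ?n21.
rewrite !H padd_comm !in_setU1 !negb_or [f == e]eq_sym.
by case: (e \notin p.1); case: (f \notin p.1); rewrite ?andbF ?andbT.
Qed.

Section Basis.
Variable P : pred pstate.

Definition pbasis : finType := {p : pstate | P p}.

(* [bv p] vanishes on pairs that do not satisfy [P]. *)
Definition bv p : freeAb pbasis :=
  if insub p is Some b then basisv (b : pbasis) else 0.

Lemma bv_val (b : pbasis) : bv (val b) = basisv b.
Proof. by rewrite /bv valK. Qed.

Lemma bv0 p : ~~ P p -> bv p = 0.
Proof. by move=> nP; rewrite /bv insubN. Qed.

Lemma linext_bv (B : finType) (F : pstate -> freeAb B) p : P p ->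
  linext (fun b : pbasis => F (val b)) (bv p) = F p.
Proof. by move=> Pp; rewrite /bv insubT linext_basisv. Qed.

Lemma bv_supported (Q : pred pstate) p : (P p -> Q p) ->
  bv p \in supported (fun b : pbasis => Q (val b)).
Proof.
move=> PQ; have [Pp|nP] := boolP (P p); last by rewrite bv0 ?rpred0.
by rewrite /bv insubT supported_basisv //; apply: PQ.
Qed.

Definition padd_op e p : freeAb pbasis :=
  if pok e p then bv (padd e p) *~ sg p.1 e else 0.

Definition pdiff p : freeAb pbasis := \sum_e padd_op e p.

(** Terms outside [P] are dropped; when the states violating [P] span a subcomplex, this is the
    quotient by it. *)
Definition pcomplex : bigradedEnd :=
  BigradedEnd (fun b : pbasis => pdeg (val b))
    (linext (fun b : pbasis => pdiff (val b))).

Lemma pcomplex_diff_bv p : P p -> bg_diff pcomplex (bv p) = pdiff p.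
Proof. exact: (@linext_bv _ pdiff). Qed.

Lemma padd_op_deg e p : padd_op e p \in supported
  (fun b : pbasis => pdeg (val b) == ((pdeg p).1.+1, (pdeg p).2)).
Proof.
rewrite /padd_op; case: ifP => [ok|_]; last exact: rpred0.
apply: supportedMz.
apply: (@bv_supported (fun q => pdeg q == ((pdeg p).1.+1, (pdeg p).2))) => _.
by rewrite padd_deg.
Qed.

Lemma pcomplex_diff_homog i j (x : 'C[pcomplex]) :
  x \in homog pcomplex i j -> bg_diff pcomplex x \in homog pcomplex i.+1 j.
Proof.
rewrite !homog_supported; apply: supported_map => b /eqP db.
rewrite /= linext_basisv; apply: rpred_sum => e _.
by apply: supported_sub (padd_op_deg e (val b)) => c; rewrite [pdeg (val b)]db.
Qed.

End Basis.

Lemma pok_notin e p : pok e p -> e \notin p.1.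
Proof. by case/andP. Qed.

Definition padd2 P e f p : freeAb (pbasis P) :=
  if pok e p && pok f (padd e p) then
    bv P (padd f (padd e p)) *~ (sg p.1 e * sg (e |: p.1) f) else 0.

Lemma padd2_anti P e f p : padd2 P e f p = - padd2 P f e p.
Proof.
rewrite /padd2 (pok_comm f e).
have [/andP[/pok_notin eS /pok_notin]|_] := boolP (pok e p && _); last by rewrite oppr0.
rewrite in_setU1 negb_or => /andP[fe fS].
by rewrite (padd_comm e f) sg_anti // 1?eq_sym // mulrNz.
Qed.

Lemma pcomplex_dd (x : 'C[pcomplex psat]) :
  bg_diff (pcomplex psat) (bg_diff (pcomplex psat) x) = 0.
Proof.
set d := bg_diff _; apply: (@additive_ext _ _ (d \o d) \0) => b /=.
have db : d (basisv b) = pdiff psat (val b) by apply: linext_basisv.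
rewrite db /pdiff raddf_sum.
pose A e f := padd2 psat e f (val b).
have dA e : d (padd_op psat e (val b)) = \sum_f A e f.
  rewrite /padd_op /A /padd2; have [ok|_] := boolP (pok e (val b)); last first.
    by rewrite raddf0 big1.
  rewrite raddfMz /d pcomplex_diff_bv; last exact: cl_saturated.
  rewrite /pdiff mulrz_suml; apply: eq_bigr => f _; rewrite /padd_op andTb.
  by case: ifP => _; rewrite ?mul0rz // mulrC mulrzA.
rewrite (eq_bigr _ (fun e _ => dA e)).
apply/ffunP => c; rewrite ffunE; set s := \sum_e _.
(* Exchanging the two added edges changes the sign, and the integers have no 2-torsion. *)
have : s = - s.
  rewrite {1}/s exchange_big /= /s -sumrN; apply: eq_bigr => e _.
  by rewrite -sumrN; apply: eq_bigr => f _; apply: padd2_anti.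
move/ffunP/(_ c); rewrite ffunE; move: (s c) => n; lia.
Qed.

(* A matching on the basis: [first p] is the edge along which [p] is matched   *)
(* and [rem f p] is its partner when [f] belongs to [p]; states without        *)
(* partner are critical.  The weight [w] makes the perturbation triangular.    *)
Section Matching.
Variables (P : pred pstate) (first : pstate -> option (edge G)).
Variables (rem : edge G -> pstate -> pstate) (w : pstate -> nat).

Definition valid e p := pok e p && P (padd e p).

Hypothesis rem_valid : forall p f, P p -> first p = Some f -> f \in p.1 ->
  [/\ P (rem f p), (w (rem f p) <= w p)%N, (rem f p).1 = p.1 :\ f,
      pok f (rem f p) & padd f (rem f p) = p].
Hypothesis add_first : forall p f, P p -> first p = Some f -> f \notin p.1 ->
  [/\ valid f p, first (padd f p) = Some f & rem f (padd f p) = p].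
(** For [p] without lower partner, hd may contribute only lower terms along edges other than the
    matching edge. *)
Hypothesis add_other : forall p e, P p -> valid e p ->
  (forall f, first p = Some f -> f \notin p.1 /\ f != e) ->
  (w (padd e p) < w p)%N \/
  (forall f, first (padd e p) = Some f -> f \notin (padd e p).1).
(** For [p] with a lower partner, adding [e] either gives lower terms on both sides or commutes with
    passing to the partner, and then dh and hd cancel. *)
Hypothesis add_rem : forall p f e, P p -> first p = Some f -> f \in p.1 ->
  e \notin p.1 ->
  ((valid e p -> (w (padd e p) < w p)%N) /\
   (valid e (rem f p) -> (w (padd e (rem f p)) < w p)%N)) \/
  (valid e p = valid e (rem f p) /\ (valid e p -> first (padd e p) = Some f /\
     rem f (padd e p) = padd e (rem f p))).

Definition hmatch p : freeAb (pbasis P) :=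
  if first p is Some f then
    if f \in p.1 then bv P (rem f p) *~ sg p.1 f else 0
  else 0.

Definition hmatch_lin : {additive 'C[pcomplex P] -> 'C[pcomplex P]} :=
  linext (fun b : pbasis P => hmatch (val b)).

Lemma hmatch_bv p : P p -> hmatch_lin (bv P p) = hmatch p.
Proof. exact: linext_bv. Qed.

Lemma hmatch_homotopy : homotopy_operator hmatch_lin.
Proof.
move=> i j x; rewrite homog_supported homog_pred_supported.
apply: supported_map => b /eqP db; rewrite /= linext_basisv /hmatch.
case fE: first => [f|]; last exact: rpred0.
case: ifP => [fS|_]; last exact: rpred0; apply: supportedMz.
have [_ _ _ ok addE] := rem_valid (valP b) fE fS.
apply: (@bv_supported _ (fun q => ((pdeg q).1.+1, (pdeg q).2) == (i, j))) => _.
by rewrite -(padd_deg ok) addE; apply/eqP.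
Qed.

Local Notation low k := (supported (fun b : pbasis P => (w (val b) < k)%N)).

Lemma bv_low p k : (P p -> w p < k)%N -> bv P p \in low k.
Proof. by move=> wk; apply: (@bv_supported _ (fun q => (w q < k)%N)). Qed.

Lemma hmatch_low p k : P p -> (w p < k)%N -> hmatch p \in low k.
Proof.
move=> Pp wk; rewrite /hmatch; case fE: first => [f|]; last exact: rpred0.
case: ifP => [fS|_]; last exact: rpred0; apply/supportedMz/bv_low => _.
by have [_ wf _ _ _] := rem_valid Pp fE fS; apply: leq_ltn_trans wk.
Qed.

Lemma hmatch0 p : (forall f, first p = Some f -> f \notin p.1) -> hmatch p = 0.
Proof.
by rewrite /hmatch; case: first => // f /(_ f erefl) /negbTE->.
Qed.

Lemma padd_op_valid e p :
  padd_op P e p = if valid e p then bv P (padd e p) *~ sg p.1 e else 0.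
Proof.
rewrite /padd_op /valid; case: ifP => //= _.
by case: ifP => // /negbT/bv0->; rewrite mul0rz.
Qed.

Lemma hmatch_padd_op e p : hmatch_lin (padd_op P e p) =
  if valid e p then hmatch (padd e p) *~ sg p.1 e else 0.
Proof.
rewrite padd_op_valid; case: ifP => [/andP[_ Pe]|_]; last by rewrite raddf0.
by rewrite raddfMz hmatch_bv.
Qed.

Definition padd_lin e : {additive 'C[pcomplex P] -> 'C[pcomplex P]} :=
  linext (fun b : pbasis P => padd_op P e (val b)).

Lemma pcomplex_diffE x : bg_diff (pcomplex P) x = \sum_e padd_lin e x.
Proof.
rewrite [LHS]additive_basisv; under [RHS]eq_bigr do rewrite additive_basisv.
rewrite exchange_big /=; apply: eq_bigr => b _.
rewrite linext_basisv /pdiff mulrz_suml; apply: eq_bigr => e _.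
by rewrite /padd_lin linext_basisv.
Qed.

(** The contribution of one edge [e] to dh + hd: the matching edge gives [p] back, any other edge
    only terms of lower weight, after cancellation. *)
Lemma padd_hmatch_low e p : P p ->
  padd_lin e (hmatch p) + hmatch_lin (padd_op P e p)
    - (if first p == Some e then bv P p else 0) \in low (w p).
Proof.
move=> Pp; rewrite hmatch_padd_op; case fE: (first p) => [f|]; last first.
  rewrite {1}/hmatch fE raddf0 add0r subr0.
  case: ifP => [ve|_]; last exact: rpred0.
  have nf g : first p = Some g -> g \notin p.1 /\ g != e by rewrite fE.
  have [we|/hmatch0->] := add_other Pp ve nf; last by rewrite mul0rz rpred0.
  by apply/supportedMz/hmatch_low => //; case/andP: ve.
(* Along the matching edge only one of dh and hd is nonzero: the edge is removed and restored, or
   added and removed. *)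
have [fe|fe] := eqVneq f e; rewrite /hmatch ?fE.
  rewrite -fe eqxx; have [fS|fS] := boolP (f \in p.1).
    have [Pr _ rE ok addE] := rem_valid Pp fE fS.
    rewrite /valid /pok fS addr0 raddfMz /= linext_bv // /padd_op ok addE rE sg_setD1.
    by rewrite -mulrzA sg_sq subrr rpred0.
  have [vf -> ->] := add_first Pp fE fS; rewrite vf raddf0 add0r /= setU11.
  have -> : sg (f |: p.1) f = sg p.1 f by rewrite -sg_setD1 setU1K.
  by rewrite -mulrzA sg_sq subrr rpred0.
rewrite (_ : Some f == Some e = false) ?subr0; last by apply/negbTE.
have [eS|eS] := boolP (e \in p.1).
  rewrite /valid /pok eS addr0.
  case: ifP => [fS|_]; last by rewrite raddf0 rpred0.
  have [Pr _ rE _ _] := rem_valid Pp fE fS.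
  rewrite raddfMz /= linext_bv // /padd_op /pok rE in_setD1 eS eq_sym fe /= mul0rz.
  exact: rpred0.
have [fS|fS] := boolP (f \in p.1); last first.
  rewrite raddf0 add0r; case: ifP => [ve|_]; last exact: rpred0.
  have nf g : first p = Some g -> g \notin p.1 /\ g != e by rewrite fE => -[<-].
  have [we|zero] := add_other Pp ve nf.
    by apply/supportedMz/hmatch_low => //; case/andP: ve.
  by have := hmatch0 zero; rewrite /hmatch => ->; rewrite mul0rz rpred0.
have [Pr _ rE _ _] := rem_valid Pp fE fS.
rewrite raddfMz /= linext_bv // padd_op_valid.
have [[lowp lowr]|[vE vf]] := add_rem Pp fE fS eS.
  apply: rpredD; first apply: supportedMz; case: ifP => [ve|_]; try exact: rpred0.
    by apply/supportedMz/bv_low => _; apply: lowr.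
  by apply/supportedMz/hmatch_low; [case/andP: ve | apply: lowp].
rewrite -vE; case: ifP => [ve|_]; last by rewrite mul0rz addr0 rpred0.
have [-> ->] := vf ve; rewrite in_setU1 fS orbT rE -!mulrzA -mulrzDr.
(* Removing [f] and adding [e] anticommute; the sign comes from whichever of the two edges is
   smaller. *)
have -> : sg (p.1 :\ f) e * sg p.1 f + sg (e |: p.1) f * sg p.1 e = 0.
  set R := p.1 :\ f; have fR : f \notin R by rewrite !inE eqxx.
  have eR : e \notin R by rewrite !inE negb_and eS orbT.
  have -> : p.1 = f |: R by rewrite setD1K.
  have <- : sg (f |: (e |: R)) f = sg (e |: (f |: R)) f by rewrite setUCA.
  rewrite -[sg (f |: R) f]sg_setD1 setU1K // -[sg (f |: _) f]sg_setD1 setU1K; last first.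
    by rewrite in_setU1 negb_or fe.
  rewrite mulrC [sg (e |: R) f * _]mulrC [sg (f |: R) e * _]mulrC.
  rewrite [sg R f * sg R e]mulrC.
  rewrite !sg_setU1 //; case/orP: (lt_total le_order fe) => l;
    rewrite l (lt_asym le_order l) expr0 expr1; lia.
by rewrite mulr0z rpred0.
Qed.

Lemma matching_low p : P p ->
  bg_diff (pcomplex P) (hmatch p) + hmatch_lin (pdiff P p)
    - (if first p then bv P p else 0) \in low (w p).
Proof.
move=> Pp; rewrite pcomplex_diffE /pdiff raddf_sum -big_split /=.
have -> : (if first p then bv P p else 0) =
    \sum_e (if first p == Some e then bv P p else 0).
  case: (first p) => [f|]; last by rewrite big1.
  rewrite (bigD1 f) //= eqxx big1 ?addr0 // => e ef.
  by rewrite (_ : Some f == Some e = false) //; apply/negbTE; rewrite eq_sym.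
by rewrite -sumrB; apply: rpred_sum => e _; apply: padd_hmatch_low.
Qed.

End Matching.
End PairComplex.

(** * Reduction to edge sets without broken circuits *)

Section PickMin.
Variables (E : finType) (key : E -> nat).
Implicit Types A : {set E}.

Definition pickmin A := [pick e in A | [forall f in A, key e <= key f]%N].

Variant pickmin_spec A : option E -> Prop :=
| PickMin e of e \in A & (forall f, f \in A -> key e <= key f)%N :
    pickmin_spec A (Some e)
| PickMinNone of A = set0 : pickmin_spec A None.

Lemma pickminP A : pickmin_spec A (pickmin A).
Proof.
rewrite /pickmin; case: pickP => [e /andP[eA /forall_inP]|no]; constructor => //.
apply/eqP; apply: contraT => /set0Pn[e0 e0A].
have [e eA emin] := @arg_minnP _ e0 [in A] key e0A.
by have := no e; rewrite /= [e \in A]eA; case/forall_inP => f /emin.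
Qed.

Hypothesis key_inj : injective key.

Lemma pickmin_eq A e : e \in A -> (forall f, f \in A -> key e <= key f)%N ->
  pickmin A = Some e.
Proof.
move=> eA emin; case: pickminP => [f fA fmin|A0]; last by rewrite A0 inE in eA.
by congr Some; apply/key_inj/eqP; rewrite eqn_leq fmin ?emin.
Qed.

End PickMin.

Section NbcReduction.
Variables (G : sgraph) (le : rel (edge G)).
Hypothesis le_order : total_order le.
Implicit Types (S T R : {set edge G}) (X : {set G}) (e f g : edge G).
Implicit Types p q : pstate G.

Lemma cl_joined S e X : joined S e -> cl (e |: S) X = cl S X.
Proof.
move=> je; apply/setP => y; apply/clP/clP => -[x xX xy]; exists x => //;
  by move: xy; rewrite cn_joined.
Qed.

Lemma ncomp_joined S e X : joined S e -> ncomp (e |: S) X = ncomp S X.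
Proof.
move=> je; congr #|pred_of_set _|; apply: eq_imset => x.
by apply/setP => y; rewrite !inE cn_joined.
Qed.

Lemma ext_mono S T : S \subset T -> ext le S \subset ext le T.
Proof.
by move=> ST; apply/subsetP => e; rewrite !inE; apply/joined_sub/setSI.
Qed.

(** Where [a] helps to join a smaller [f], it can be replaced by the edges of [S] above [a] that
    join its ends. *)
Lemma ext_setU1 S a : a \in ext le S -> ext le (a |: S) = ext le S.
Proof.
move=> aS; apply/eqP; rewrite eqEsubset [X in _ && X]ext_mono ?subsetUr // andbT.
apply/subsetP => f; rewrite !inE; apply: joined_closure => h.
rewrite in_setI in_setU1 inE => /andP[/predU1P[->|hS] fh]; last first.
  by apply: joined_in; rewrite !inE hS.
move: aS; rewrite inE; apply: joined_sub; apply: setIS.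
by apply/subsetP => k; rewrite !inE; apply: lt_trans.
Qed.

Lemma ext_joined S a : a \in ext le S -> joined (S :\ a) a.
Proof.
rewrite inE; apply: joined_sub; apply/subsetP => h; rewrite !inE => /andP[-> ah].
by rewrite andbT; apply: contraTneq ah => ->; rewrite lt_irr.
Qed.

Lemma ext_setD1 S a : a \in ext le S -> ext le (S :\ a) = ext le S.
Proof.
move=> aS; have [aS'|aS'] := boolP (a \in S); last first.
  by congr ext; apply/setDidPl; rewrite disjoint_sym disjoints1.
rewrite -[in RHS](setD1K aS') ext_setU1 //; move: aS; rewrite !inE.
apply: joined_sub; apply/subsetP => h; rewrite !inE => /andP[-> ah].
by rewrite ah !andbT; apply: contraTneq ah => ->; rewrite lt_irr.
Qed.

Definition kfirst p := pickmin (erank le) (ext le p.1).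
(** The labels stay: [a] is removed only when the other edges join its ends. *)
Definition krem (a : edge G) p : pstate G := (p.1 :\ a, p.2).
(** Adding edges enlarges [ext], so it never raises this weight; the default, for states without
    broken circuits, lies above all ranks. *)
Definition kweight p := oapp (erank le) #|edge G| (kfirst p).

Lemma erank_card e : (erank le e < #|edge G|)%N.
Proof.
rewrite -cardsT; apply/proper_card/properP; split; first exact: subsetT.
by exists e; rewrite !inE ?lt_irr.
Qed.

Lemma kweight_le p a : a \in ext le p.1 -> (kweight p <= erank le a)%N.
Proof.
by rewrite /kweight /kfirst; case: pickminP => [e _|->]; [exact|rewrite inE].
Qed.

Lemma kweight_eq p q : ext le p.1 = ext le q.1 -> kweight p = kweight q.
Proof. by rewrite /kweight /kfirst => ->. Qed.

Lemma kfirst_ext p f : kfirst p = Some f -> f \in ext le p.1.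
Proof. by rewrite /kfirst; case: pickminP => // e ? _ [<-]. Qed.

Lemma krem_valid p f : psat p -> kfirst p = Some f -> f \in p.1 ->
  [/\ psat (krem f p), (kweight (krem f p) <= kweight p)%N,
      (krem f p).1 = p.1 :\ f, pok f (krem f p) & padd f (krem f p) = p].
Proof.
move=> sp /kfirst_ext fX fS; have je := ext_joined fX.
have sr : psat (krem f p) by apply: saturated_sub sp; apply: subsetDl.
split=> //.
- by rewrite (@kweight_eq _ p) //= ext_setD1.
- rewrite /pok /= ncomp_setU1 // je !andbF andbT.
  by rewrite !inE eqxx.
by rewrite /padd /= setD1K // (eqP sp) -surjective_pairing.
Qed.

Lemma kadd_first p f : psat p -> kfirst p = Some f -> f \notin p.1 ->
  [/\ valid (@psat G) f p, kfirst (padd f p) = Some f & krem f (padd f p) = p].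
Proof.
move=> sp fE fS; have fX := kfirst_ext fE.
have je : joined p.1 f by apply: joined_sub (ext_joined fX); apply: subsetDl.
split; first by rewrite /valid /pok fS ncomp_setU1 // je !andbF; apply: cl_saturated.
  by rewrite /kfirst /= ext_setU1.
by rewrite /krem /= setU1K // cl_joined // (eqP sp) -surjective_pairing.
Qed.

(** If the smallest edge of [ext] does not drop, it is still [f], which remains absent because it
    differs from [e]. *)
Lemma kadd_other p e : psat p -> valid (@psat G) e p ->
  (forall f, kfirst p = Some f -> f \notin p.1 /\ f != e) ->
  (kweight (padd e p) < kweight p)%N \/
  (forall f, kfirst (padd e p) = Some f -> f \notin (padd e p).1).
Proof.
move=> sp _ fS; rewrite {1}/kweight.
case fE: (kfirst (padd e p)) => [a|]; last by right.
have aX := kfirst_ext fE; case gE: (kfirst p) => [f|]; last first.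
  by left; rewrite /kweight gE; apply: erank_card.
have [fS' fe] := fS f gE; have fX := kfirst_ext gE.
have fX' : f \in ext le (padd e p).1.
  exact: (subsetP (ext_mono (subsetUr [set e] p.1)) f fX).
have := kweight_le fX'.
rewrite /kweight fE gE /= leq_eqVlt => /orP[/eqP/(erank_inj le_order)->|]; last by left.
by right=> _ [<-]; rewrite in_setU1 negb_or fe.
Qed.

(** [ext] does not see the removal of [f], so adding [e] to [p] and to its partner gives equal
    weights: both drop, or [f] stays first. *)
Lemma kadd_rem p f e : psat p -> kfirst p = Some f -> f \in p.1 ->
  e \notin p.1 ->
  ((valid (@psat G) e p -> (kweight (padd e p) < kweight p)%N) /\
   (valid (@psat G) e (krem f p) -> (kweight (padd e (krem f p)) < kweight p)%N)) \/
  (valid (@psat G) e p = valid (@psat G) e (krem f p) /\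
   (valid (@psat G) e p -> kfirst (padd e p) = Some f /\
     krem f (padd e p) = padd e (krem f p))).
Proof.
move=> sp fE fS eS; have fX := kfirst_ext fE.
have fe : f != e by apply: contraNneq eS => <-.
have fX' : f \in ext le (e |: p.1) by apply: subsetP (ext_mono (subsetUr _ _)) f fX.
have DU : e |: p.1 :\ f = (e |: p.1) :\ f.
  apply/setP => h; rewrite !inE; case: (eqVneq h e) => [->|] //=.
  by rewrite eq_sym fe.
have wE : kweight (padd e (krem f p)) = kweight (padd e p).
  by apply: kweight_eq; rewrite /= DU ext_setD1.
have wf : (kweight (padd e p) <= kweight p)%N.
  by rewrite [in X in (_ <= X)%N]/kweight fE; apply: kweight_le.
move: wf; rewrite leq_eqVlt => /orP[/eqP wf|wf]; last by left; rewrite wE.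
right; have fpE : kfirst (padd e p) = Some f.
  move: wf; rewrite /kweight fE; case: (kfirst (padd e p)) => [a|] /=.
    by move/(erank_inj le_order)->.
  by move=> E; have := erank_card f; rewrite E ltnn.
have je := ext_joined fX; have je' := ext_joined fX'.
have eK : f |: (p.1 :\ f) = p.1 by rewrite setD1K.
have eK' : f |: ((e |: p.1) :\ f) = e |: p.1 by rewrite setD1K // in_setU1 fS orbT.
have clE X : cl (e |: p.1) X = cl (e |: p.1 :\ f) X by rewrite DU -eK' cl_joined // eK'.
split.
  congr (_ && _); last by rewrite /psat !cl_saturated.
  rewrite /pok /= clE !inE negb_and negbK eS orbT /=.
  have -> Y : ncomp (e |: p.1) Y = ncomp (e |: p.1 :\ f) Y.
    by rewrite DU -{1}eK' ncomp_joined.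
  by have <- : ncomp p.1 p.2 = ncomp (p.1 :\ f) p.2 by rewrite -{1}eK ncomp_joined.
by move=> _; split=> //; rewrite /krem /padd /= DU -DU -clE.
Qed.

Definition pnbc p := psat p && nbc le p.1.

Lemma kfirst_nbc p : (kfirst p : bool) = ~~ nbc le p.1.
Proof.
rewrite /nbc /kfirst; case: pickminP => [a aX _|->]; last by rewrite eqxx.
by apply/esym/set0Pn; exists a.
Qed.

Lemma linext_sub_bv (P Q : pred (pstate G)) p : (Q p -> P p) ->
  linext (fun b : pbasis P => bv Q (val b)) (bv P p) = bv Q p.
Proof.
move=> QP; have [Pp|nP] := boolP (P p); first exact: linext_bv.
by rewrite !bv0 ?raddf0 //; apply: contra nP.
Qed.

Local Notation CQ := (pcomplex le pnbc).
Local Notation CP := (pcomplex le (@psat G)).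

Definition nbc_proj : {additive 'C[CP] -> 'C[CQ]} :=
  linext (fun b : pbasis (@psat G) => bv pnbc (val b)).

Definition nbc_sect : {additive 'C[CQ] -> 'C[CP]} :=
  linext (fun b : pbasis pnbc => bv (@psat G) (val b)).

Lemma nbc_proj_bv p : nbc_proj (bv (@psat G) p) = bv pnbc p.
Proof. by apply: linext_sub_bv => /andP[]. Qed.

Lemma nbc_sect_bv p : pnbc p -> nbc_sect (bv pnbc p) = bv (@psat G) p.
Proof. exact: linext_bv. Qed.

Lemma nbc_proj_basisv b : nbc_proj (basisv b) = bv pnbc (val b).
Proof. exact: linext_basisv. Qed.

Lemma nbc_sect_basisv b : nbc_sect (basisv b) = bv (@psat G) (val b).
Proof. exact: linext_basisv. Qed.

Lemma nbc_sectK : cancel nbc_sect nbc_proj.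
Proof.
apply: (@additive_ext _ _ (nbc_proj \o nbc_sect) idfun) => b /=.
by rewrite nbc_sect_basisv nbc_proj_bv bv_val.
Qed.

(** Adding edges never destroys a broken circuit, so the discarded states span a subcomplex. *)
Lemma nbc_proj_cochain : cochain_map nbc_proj.
Proof.
have prD p e : nbc_proj (padd_op le (@psat G) e p) = padd_op le pnbc e p.
  by rewrite /padd_op; case: ifP => _; rewrite ?raddf0 // raddfMz nbc_proj_bv.
split=> [i j x|x].
  rewrite !homog_supported; apply: supported_map => b db.
  rewrite nbc_proj_basisv.
  exact: (@bv_supported _ _ (fun q => pdeg q == (i, j))).
apply: (@additive_ext _ _ (nbc_proj \o bg_diff CP) (bg_diff CQ \o nbc_proj)) => b.
rewrite -bv_val [LHS]/= [RHS]/= nbc_proj_bv pcomplex_diff_bv ?(valP b) // raddf_sum.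
under eq_bigr do rewrite prD.
have [nb|nb] := boolP (pnbc (val b)); first by rewrite pcomplex_diff_bv.
rewrite bv0 // raddf0 big1 // => e _; rewrite /padd_op bv0 ?mul0rz ?if_same //.
apply: contra nb; rewrite /pnbc (valP b) => /andP[_]; apply: nbc_sub.
exact: subsetUr.
Qed.

Lemma pnbc_dd x : bg_diff CQ (bg_diff CQ x) = 0.
Proof.
have [_ prd] := nbc_proj_cochain.
by rewrite -[x]nbc_sectK -!prd pcomplex_dd // raddf0.
Qed.

Lemma nbc_reduction : chain_homotopy_equivalent CQ CP.
Proof.
pose h := hmatch_lin le (@psat G) kfirst krem.
have hb b : h (basisv b) = hmatch le (@psat G) kfirst krem (val b).
  by apply: linext_basisv.
apply: (@surjection_homotopy_equivalence CQ CP _ _ h _ #|edge G|.+1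
  (fun b => kweight (val b)) _ nbc_proj nbc_sect).
- exact: pcomplex_diff_homog.
- exact: pcomplex_dd.
- exact: hmatch_homotopy krem_valid.
- move=> b; rewrite ltnS /kweight; case: (kfirst _) => //= a.
  by rewrite ltnW // erank_card.
- exact: nbc_proj_cochain.
- move=> i j x; rewrite !homog_supported; apply: supported_map => b db.
  rewrite nbc_sect_basisv.
  exact: (@bv_supported _ _ (fun q => pdeg q == (i, j))).
- exact: nbc_sectK.
(* The partner of a matched state still contains a broken circuit, so the projection kills it. *)
- apply: (@additive_ext _ _ (nbc_proj \o h) \0) => b /=.
  rewrite hb /hmatch; case fE: kfirst => [f|]; last by rewrite raddf0.
  case: ifP => fS; last by rewrite raddf0.
  rewrite raddfMz nbc_proj_bv bv0 ?mul0rz //; apply/nandP; right.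
  have fX := kfirst_ext fE; apply/set0Pn; exists f.
  by rewrite /= ext_setD1.
move=> b; have := matching_low le_order krem_valid kadd_first kadd_other kadd_rem (valP b).
have -> : pdiff le (@psat G) (val b) = bg_diff CP (basisv b).
  by rewrite -bv_val pcomplex_diff_bv ?(valP b).
rewrite /pert /= -hb nbc_proj_basisv kfirst_nbc => low.
have -> : nbc_sect (bv pnbc (val b)) =
    basisv b - (if ~~ nbc le (val b).1 then bv (@psat G) (val b) else 0).
  have [nb|nb] := boolP (nbc le (val b).1); last first.
    by rewrite bv_val subrr bv0 ?raddf0 // /pnbc (negbTE nb) andbF.
  have nb' : pnbc (val b) by rewrite /pnbc (valP b).
  by rewrite subr0 nbc_sect_bv // bv_val.
by rewrite -addrA addrC -addrA [- _ + (_ - _)]addrA addNr add0r.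
Qed.

End NbcReduction.

(** * The chromatic complex as a complex of labelled edge sets *)

Section Relabel.
Variables (G : sgraph) (le : rel (edge G)).
Implicit Types (S T R : {set edge G}) (X : {set G}) (e f g : edge G) (v : G).
Local Notation state := (enhanced_state G 2).
Implicit Types s t : state.

Lemma components_ccomp S : components S = ccomp S @: setT.
Proof. by apply: eq_imset => x; apply/setP => y; rewrite !inE. Qed.

Fact ccomp_component S v : ccomp S v \in components S.
Proof. by rewrite components_ccomp imset_f. Qed.

Definition cc S v : {C : {set G} | C \in components S} :=
  exist _ (ccomp S v) (ccomp_component S v).

Lemma ccP S (C : {C : {set G} | C \in components S}) : exists v, C = cc S v.
Proof.
have: val C \in ccomp S @: setT by rewrite -components_ccomp (valP C).
by case/imsetP => v _ E; exists v; apply: val_inj.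
Qed.

Lemma cc_eq S u v : (cc S u == cc S v) = cn S u v.
Proof. by rewrite -ccomp_eq; apply/eqP/eqP => [[]|E] //; apply: val_inj. Qed.

Definition xset s : {set G} := [set v | tagged s (cc (tag s) v) != ord0].

Lemma xset_label s v : (tagged s (cc (tag s) v) : nat) = (v \in xset s).
Proof. by rewrite inE; case: (tagged s _) => [[|[|]]]. Qed.

Definition pair_of_state s : pstate G := (tag s, xset s).

Fact pair_of_state_sat s : psat (pair_of_state s).
Proof.
apply/saturatedP => x y /=; rewrite -cc_eq => /eqP xy.
by rewrite !inE xy.
Qed.

Definition relabel s : pbasis (@psat G) :=
  exist (fun p => psat p) (pair_of_state s) (pair_of_state_sat s).

Definition state_of_pair (p : pbasis (@psat G)) : state :=
  Tagged (fun S => {ffun {C : {set G} | C \in components S} -> 'I_2})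
    [ffun C : {C | C \in components (val p).1} =>
       inord (val C \subset (val p).2) : 'I_2].

Lemma relabelK : cancel relabel state_of_pair.
Proof.
move=> s; rewrite -[RHS]taggedK; congr existT; apply/ffunP => C.
rewrite ffunE; apply: val_inj; have [v ->] := ccP C.
rewrite /= inordK ?xset_label; last by case: (_ \subset _).
congr nat_of_bool; apply/subsetP/idP => [sub|vX u]; first exact/sub/ccomp_id.
by rewrite inE => vu; rewrite -(saturated_mem (pair_of_state_sat s) vu).
Qed.

Lemma state_of_pairK : cancel state_of_pair relabel.
Proof.
move=> [[S X] sX]; apply: val_inj; congr (_, _); apply/setP => v.
rewrite inE /= ffunE -val_eqE /= inordK; last by case: (_ \subset _).
have -> : ccomp S v \subset X = (v \in X); last by case: (v \in X).
apply/subsetP/idP => [sub|vX u]; first exact/sub/ccomp_id.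
by rewrite inE => vu; rewrite -(saturated_mem sX vu).
Qed.

Lemma relabel_deg s : pdeg (val (relabel s)) = estate_deg s.
Proof.
congr (_, _); rewrite /= /ncomp.
have -> : ccomp (tag s) @: xset s = val @: [set C | tagged s C != ord0].
  apply/setP => D; apply/imsetP/imsetP => [[v vX ->]|[C]].
    by exists (cc (tag s) v); rewrite // inE; move: vX; rewrite inE.
  by have [v ->] := ccP C; rewrite inE => vX ->; exists v; rewrite // inE.
rewrite card_imset; last exact: val_inj.
rewrite -sum1_card big_mkcond; apply: eq_bigr => C _.
by rewrite inE; case: (tagged s C) => [[|[|]]].
Qed.

Section AddEdge.
Variables (s : state) (e : edge G).
Hypothesis eS : e \notin tag s.
Local Notation S := (tag s).
Local Notation X := (xset s).
Local Notation S' := (e |: S).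
Local Notation a := (esrc e).
Local Notation b := (edst e).

Let sX : saturated S X := pair_of_state_sat s.

Lemma merge_exp_cc (D : {set G}) v : D = ccomp S v ->
  merge_exp s e D = (v \in X).
Proof.
move=> ->; rewrite /merge_exp insubT ?ccomp_component // => H.
by rewrite -xset_label; congr (nat_of_ord (tagged s _)); apply: val_inj.
Qed.

(** A component of S + e is an old one, or the union of the distinct components at the ends of [e],
    whose exponents add up. *)
Lemma merge_expE v : merge_exp s e (ccomp S' v) =
  if joined S e || ~~ cn S' v a then (v \in X) : nat else ((a \in X) + (b \in X))%N.
Proof.
case: ifP => [jv|/norP[nj /negPn va]].
  apply: merge_exp_cc; case/orP: jv => [je|nva].
    by apply/setP => u; rewrite !inE cn_joined.
  rewrite ccomp_setU1 ifN // !inE !ccomp_eq negb_or.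
  move: nva; rewrite cn_setU1 !negb_or => /and3P[-> _]; rewrite cnxx andbT.
  by move=> ->.
have E : ccomp S' v = ccomp S a :|: ccomp S b.
  rewrite (_ : ccomp S' v = ccomp S' a); last by apply/eqP; rewrite ccomp_eq.
  by rewrite ccomp_setU1 !inE eqxx.
rewrite /merge_exp insubN; last first.
  rewrite E components_ccomp; apply: contra nj => /imsetP[u _ uE].
  have: a \in ccomp S u by rewrite -uE !inE cnxx.
  have: b \in ccomp S u by rewrite -uE !inE cnxx orbT.
  rewrite !inE /joined => ub ua; apply: cn_trans ub.
  by rewrite cnC.
have disjE u : ~~ [disjoint val (cc S u) & ends e] = cn S u a || cn S u b.
  rewrite endsE; apply/pred0Pn/orP => [[z /= /andP[]]|[ua|ub]].
  - by rewrite !inE => uz /orP[]/eqP zE; rewrite -zE; [left|right].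
  - by exists a; rewrite /= !inE eqxx ua.
  - by exists b; rewrite /= !inE eqxx ub orbT.
rewrite (bigD1 (cc S a)) ?disjE ?cnxx //= (bigD1 (cc S b)) /=; last first.
  by rewrite disjE cnxx orbT /= cc_eq cnC.
rewrite !xset_label big1 ?addn0 // => C; have [u ->] := ccP C.
by rewrite disjE !cc_eq => /andP[/andP[/orP[]->]].
Qed.

Lemma pokE : pok e (pair_of_state s) = ~~ [&& a \in X, b \in X & ~~ joined S e].
Proof. by rewrite /pok /= eS; apply: ncomp_setU1. Qed.

Lemma merge_exp_ok v : pok e (pair_of_state s) ->
  merge_exp s e (ccomp S' v) = (v \in cl S' X).
Proof.
rewrite pokE merge_expE mem_cl_setU1 // => ok.
have [je /=|nj] := boolP (joined S e).
  have H u : [|| u \in X, (a \in X) && cn S b u | (b \in X) && cn S a u] =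
      (u \in X).
    have [//|/= uX] := boolP (u \in X).
    apply/negbTE; apply: contra uX => /orP[]/andP[wX wu].
      by rewrite -(saturated_mem sX wu) -(saturated_mem sX je).
    by rewrite -(saturated_mem sX wu) (saturated_mem sX je).
  by rewrite H.
rewrite nj /= in ok *; rewrite cn_setU1 cnxx andbT.
have ba : cn S b a = false by rewrite cnC; apply/negbTE.
rewrite [_ && cn S b a]andbC ba [cn S b v]cnC [cn S a v]cnC /=.
have [va|nva] := boolP (cn S v a).
  rewrite (saturated_mem sX va); have vb : cn S v b = false.
    by apply: contraNF nj => vb; apply: cn_trans vb; rewrite cnC.
  by rewrite vb /=; move: ok; case: (a \in X); case: (b \in X).
have [vb|nvb] := boolP (cn S v b); rewrite /= ?andbF ?orbF //.
by rewrite (saturated_mem sX vb); move: ok; case: (a \in X); case: (b \in X).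
Qed.

(** Labels of [t] are exponents below 2, so no [t] exists when two components labelled x merge. *)
Lemma adds_edgeE t : adds_edge s e t =
  pok e (pair_of_state s) && (pair_of_state t == padd e (pair_of_state s)).
Proof.
apply/andP/andP => [[/eqP tE /forallP lab]|[ok /eqP[tE XE]]].
  have labv v : (v \in xset t) = merge_exp s e (ccomp S' v) :> nat.
    by rewrite -xset_label -tE; apply/eqP/(lab (cc (tag t) v)).
  have ok : pok e (pair_of_state s).
    rewrite pokE; apply/negP => /and3P[aX bX nj].
    have := labv a; rewrite merge_expE (negbTE nj) cnxx aX bX /=.
    by case: (_ \in _).
  split=> //; apply/eqP; congr (_, _) => //; apply/setP => v.
  by have := labv v; rewrite merge_exp_ok //; do 2![case: (_ \in _)].
split; first exact/eqP; apply/forallP => D; have [v ->] := ccP D.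
by rewrite xset_label XE /= tE merge_exp_ok.
Qed.

End AddEdge.

Lemma chromatic_relabel :
  chain_homotopy_equivalent (chromatic_complex le 2) (pcomplex le (@psat G)).
Proof.
apply: (@relabel_homotopy_equivalence (chromatic_complex le 2)
  (pcomplex le (@psat G)) relabel _ relabelK state_of_pairK relabel_deg) => s.
have -> : bg_diff (chromatic_complex le 2) (basisv s) = chromatic_diff le s.
  exact: linext_basisv.
have -> : bg_diff (pcomplex le (@psat G)) (basisv (relabel s)) =
    pdiff le (@psat G) (pair_of_state s).
  exact: linext_basisv.
rewrite /chromatic_diff raddf_sum big_mkcond; apply: eq_bigr => e _.
have [eS|eS] := boolP (e \in tag s); first by rewrite /padd_op /pok eS.
rewrite raddf_sum /padd_op.
under eq_bigl do rewrite (adds_edgeE eS).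
case: ifP => [ok|_]; last by rewrite big_pred0.
have pS : psat (padd e (pair_of_state s)) by apply: cl_saturated.
pose b0 : pbasis (@psat G) := exist (fun p => psat p) _ pS.
pose t0 := state_of_pair b0.
have t0E : relabel t0 = b0 by apply: state_of_pairK.
rewrite (big_pred1 t0) => [|t].
  rewrite raddfMz [X in X *~ _](linext_basisv _ t0) t0E -bv_val //.
rewrite /= -(can_eq relabelK) t0E -val_eqE //.
Qed.

End Relabel.

(** * Contracting the block of a spanning tree *)

Section TreeMatching.
Variables (G : sgraph) (conn : connected_graph G) (le : rel (edge G)) (vd : G).
Hypothesis le_order : total_order le.
Implicit Types (S T R : {set edge G}) (X : {set G}) (e f g : edge G) (u v : G).
Implicit Types p q : pstate G.
Local Notation nbc := (nbc le).
Local Notation act := (act le).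
Local Notation inn := (inn le).
Local Notation tot := (tot le).
Local Notation far := (far vd).
Local Notation pnbc := (pnbc le).

Lemma disjointsP (A B : {set G}) :
  reflect (forall v, v \in A -> v \notin B) [disjoint A & B].
Proof. by rewrite disjoints_subset; apply: (iffP subsetP) => H v /H; rewrite inE. Qed.

(** For active [e], the component of S - e at the end of [e] away from the root. The far end is read
    off in [tot S], so it is the same throughout a block. *)
Definition fcomp S e : {set G} :=
  [set v | [exists u in ends e, (u \in far (tot S) e) && cn (S :\ e) u v]].

Lemma fcompP S e v : reflect
  (exists u, [/\ u \in ends e, u \in far (tot S) e & cn (S :\ e) u v])
  (v \in fcomp S e).
Proof.
rewrite inE; apply: (iffP exists_inP) => [[u ue /andP[]]|[u [ue uF uv]]]; exists u => //.
by rewrite uF.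
Qed.

Lemma fcomp_sat S e : saturated (S :\ e) (fcomp S e).
Proof.
apply/saturatedP => x y xy /fcompP[u [ue uF ux]]; apply/fcompP; exists u.
by split=> //; apply: cn_trans xy.
Qed.

Lemma fcomp_mono S T e : S \subset T -> tot S = tot T -> fcomp S e \subset fcomp T e.
Proof.
move=> ST tE; apply/subsetP => v /fcompP[u [ue uF uv]]; apply/fcompP.
exists u; split; [exact: ue | by rewrite -tE | by apply: cn_sub uv; apply: setSD].
Qed.

Lemma fcomp_eq S T e : S :\ e = T :\ e -> tot S = tot T -> fcomp S e = fcomp T e.
Proof. by move=> E tE; rewrite /fcomp E tE. Qed.

(** Lexicographic in the size of the far side and the rank: branches near the leaves come first, and
    the rank makes the key injective. [qtop] exceeds all keys. *)
Definition qkey T e := (#|far T e| * #|edge G| + erank le e)%N.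
Definition qtop := (#|G|.+1 * #|edge G|)%N.

Lemma qkey_lt T e : (qkey T e < qtop)%N.
Proof.
have := erank_card le e; have : (#|far T e| <= #|G|)%N by apply: max_card.
by rewrite /qkey /qtop; nia.
Qed.

Lemma qkey_inj T : injective (qkey T).
Proof.
move=> e f; rewrite /qkey => E; apply: (erank_inj le_order).
have := congr1 (modn^~ #|edge G|) E.
by rewrite !modnMDl !modn_small ?erank_card.
Qed.

Section Block.
Variable S : {set edge G}.
Hypothesis nS : nbc S.

Lemma nbc_totS : nbc (tot S). Proof. exact: nbc_tot. Qed.
Lemma span_totS x y : cn (tot S) x y. Proof. exact: cn_tot. Qed.

Lemma act_in_tot e : e \in act S -> e \in tot S.
Proof. by rewrite in_tot => ->; rewrite orbT. Qed.

Lemma act_njoined e : e \in act S -> ~~ joined (S :\ e) e.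
Proof. by rewrite inE; apply: contra; apply/joined_sub/subsetUl. Qed.

Lemma fcomp_far e : e \in act S -> fcomp S e \subset far (tot S) e.
Proof.
move=> eA; apply/subsetP => v /fcompP[u [_ uF uv]].
have: cn (tot S :\ e) u v by apply: cn_sub uv; apply: setSD; apply: subsetUl.
by rewrite (far_split vd span_totS) ?act_in_tot // uF => /eqP<-.
Qed.

Lemma fcomp_end e u : e \in act S -> u \in ends e ->
  (u \in fcomp S e) = (u \in far (tot S) e).
Proof.
move=> eA ue; apply/idP/idP => [|uF]; first exact/subsetP/fcomp_far.
by apply/fcompP; exists u; rewrite cnxx.
Qed.

Lemma fcomp_edst e : e \in act S -> (edst e \in fcomp S e) = (esrc e \notin fcomp S e).
Proof.
move=> eA; rewrite !fcomp_end ?esrc_in ?edst_in //.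
exact: (far_edst vd le_order nbc_totS span_totS (act_in_tot eA)).
Qed.

(* An edge touching the far component of [f] lies below [f], so its far side  *)
(* is strictly smaller and it has a smaller key.                              *)
Lemma fcomp_ends e f u : e \in act S -> f \in act S -> (qkey (tot S) f < qkey (tot S) e)%N ->
  u \in ends e -> u \notin fcomp S f.
Proof.
move=> eA fA fe ue; apply/negP => /(subsetP (fcomp_far fA)) uF.
have ef : e != f by apply: contraTneq fe => ->; rewrite ltnn.
have := proper_card (far_nested le_order nbc_totS span_totS
  (act_in_tot eA) (act_in_tot fA) ef ue uF).
move: fe; rewrite /qkey; have := erank_card le e; have := erank_card le f; nia.
Qed.

(** An edge of larger key has no end in the far component of [f], by [fcomp_ends], and cannot extend
    it. *)
Lemma fcomp_setU1 e f : e \in act S -> f \in act S -> e \notin S ->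
  (qkey (tot S) f < qkey (tot S) e)%N -> fcomp (e |: S) f = fcomp S f.
Proof.
move=> eA fA eS fe; have ef : e != f by apply: contraTneq fe => ->; rewrite ltnn.
have tE : tot (e |: S) = tot S by apply: tot_setU1.
apply/eqP; rewrite eqEsubset andbC fcomp_mono ?subsetUr ?tE //=.
apply/subsetP => v /fcompP[u [uf uF]]; rewrite tE in uF.
have -> : (e |: S) :\ f = e |: (S :\ f).
  apply/setP => h; rewrite !inE; case: (eqVneq h e) => [->|] //=.
  by rewrite ef.
rewrite cn_setU1 => /or3P[uv|/andP[ua _]|/andP[ub _]]; first by apply/fcompP; exists u.
  have /negP[] := fcomp_ends eA fA fe (esrc_in e).
  by apply/fcompP; exists u.
have /negP[] := fcomp_ends eA fA fe (edst_in e).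
by apply/fcompP; exists u.
Qed.

End Block.

(** The edges offering a partner: a present active edge can be removed, an absent one can be added
    when its far component is labelled 1. *)
Definition qactive p :=
  [set e in act p.1 | (e \in p.1) || [disjoint fcomp p.1 e & p.2]].
Definition qfirst p := pickmin (qkey (tot p.1)) (qactive p).
(** The far component gets the label 1 and the near one keeps its label, so merging them again
    multiplies by 1 and restores [p]. *)
Definition qrem f p : pstate G := (p.1 :\ f, p.2 :\: fcomp p.1 f).
Definition qidx p := oapp (qkey (tot p.1)) qtop (qfirst p).
(** Lexicographic: blocks with larger [inn] weigh less; inside a block the key of the matching edge
    decides, and critical states weigh most. *)
Definition qweight p := ((#|edge G| - #|inn p.1|) * qtop.+1 + qidx p)%N.

Lemma qidx_le_top p : (qidx p <= qtop)%N.
Proof. by rewrite /qidx; case: (qfirst p) => [e|]; [apply/ltnW/qkey_lt | apply: leqnn]. Qed.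

Lemma qidx_le p e : e \in qactive p -> (qidx p <= qkey (tot p.1) e)%N.
Proof.
by rewrite /qidx /qfirst; case: pickminP => [f _ fmin /fmin|->] //; rewrite inE.
Qed.

Lemma qfirst_active p f : qfirst p = Some f -> f \in qactive p.
Proof. by rewrite /qfirst; case: pickminP => // e ? _ [<-]. Qed.

Lemma qfirst_min p f g : qfirst p = Some f -> g \in qactive p ->
  (qkey (tot p.1) f <= qkey (tot p.1) g)%N.
Proof.
rewrite /qfirst; case: pickminP => [h _ hmin [<-]|_]; [exact: hmin | discriminate].
Qed.

Lemma qactive_act p f : f \in qactive p -> f \in act p.1.
Proof. by rewrite inE => /andP[]. Qed.

Lemma qweight_inn p q : inn p.1 \proper inn q.1 -> (qweight q < qweight p)%N.
Proof.
move=> /proper_card pq; rewrite /qweight.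
have := qidx_le_top p; have := qidx_le_top q.
have : (#|inn q.1| <= #|edge G|)%N by apply: max_card.
nia.
Qed.

Lemma qweight_idx p q : inn p.1 = inn q.1 -> (qweight q < qweight p)%N = (qidx q < qidx p)%N.
Proof. by move=> E; rewrite /qweight E ltn_add2l. Qed.

Lemma saturatedD S X Y : saturated S X -> saturated S Y -> saturated S (X :\: Y).
Proof.
move=> sX sY; apply/saturatedP => x y xy.
by rewrite !inE (saturated_mem sX xy) (saturated_mem sY xy).
Qed.

(** Adding [e] can only enlarge [X] and the far components, so disjointness afterwards implies
    disjointness before. *)
Lemma qadd_active p e g : e \in act p.1 -> g != e ->
  g \in qactive (padd e p) -> g \in qactive p.
Proof.
move=> eA ge; rewrite [_ \in qactive _]inE [in X in _ -> X]inE /= act_setU1 //.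
rewrite in_setU1 (negbTE ge) /= => /andP[-> /orP[->//|disj]]; rewrite /=.
apply/orP; right; apply: disjointWl (disjointWr (cl_id _ _) disj).
by apply: fcomp_mono; rewrite ?subsetUr ?tot_setU1.
Qed.

Lemma qrem_valid p f : pnbc p -> qfirst p = Some f -> f \in p.1 ->
  [/\ pnbc (qrem f p), (qweight (qrem f p) <= qweight p)%N,
      (qrem f p).1 = p.1 :\ f, pok f (qrem f p) & padd f (qrem f p) = p].
Proof.
case: p => S X /andP[sX nS] fE fS; rewrite /= in sX nS fS.
have fact := qfirst_active fE; have fA : f \in act S by apply: qactive_act fact.
have nSf : nbc (S :\ f) by apply: nbc_sub nS; apply: subsetDl.
have sX' : saturated (S :\ f) (X :\: fcomp S f).
  by apply: saturatedD (fcomp_sat _ _); apply: saturated_sub sX; apply: subsetDl.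
have fE' := fcomp_edst nS fA.
split.
- by rewrite /pnbc nSf andbT.
- have innE : inn (qrem f (S, X)).1 = inn (S, X).1 by apply: inn_setD1.
  rewrite /qweight innE leq_add2l.
  rewrite [X in (_ <= X)%N]/qidx fE /=.
  have := @qidx_le (qrem f (S, X)) f; rewrite /= tot_setD1 //; apply.
  rewrite inE /= act_setD1 // fA /=; apply/orP; right.
  rewrite (@fcomp_eq _ S) ?tot_setD1 //; last by rewrite setDDl setUid.
  by apply/disjointsP => v vF; rewrite in_setD vF.
- by [].
- rewrite /pok /= ncomp_setU1 // in_setD1 eqxx /= !in_setD; apply/negP => /and3P[/andP[na _] /andP[nb _] _].
  by move: nb; rewrite fE' na.
rewrite /padd /= setD1K //; congr (_, _); apply/setP => v; apply/clP/idP.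
  by case=> x; rewrite in_setD => /andP[_ xX] xv; rewrite -(saturated_mem sX xv).
move=> vX; have [vF|vF] := boolP (v \in fcomp S f); last first.
  by exists v; [rewrite in_setD vF vX | apply: cnxx].
have [u [ue uF uv]] := fcompP _ _ _ vF.
(* The near end keeps the label x, which [f] carries back to the far component. *)
have [w we wF] := near_end vd le_order (nbc_totS nS) (span_totS S) (act_in_tot fA).
have wv : cn S w v.
  by apply: cn_trans (cn_ends fS we ue) _; apply: cn_sub uv; apply: subsetDl.
exists w => //; rewrite in_setD (fcomp_end fA we) wF.
by rewrite (saturated_mem sX wv).
Qed.

Lemma qadd_first p f : pnbc p -> qfirst p = Some f -> f \notin p.1 ->
  [/\ valid pnbc f p, qfirst (padd f p) = Some f & qrem f (padd f p) = p].
Proof.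
case: p => S X /andP[sX nS] fE fS; rewrite /= in sX nS fS.
have fact := qfirst_active fE; have fA : f \in act S by apply: qactive_act fact.
have disj : [disjoint fcomp S f & X] by move: fact; rewrite inE fA (negbTE fS).
have notX v : v \in fcomp S f -> v \notin X by move=> vF; rewrite (disjointFr disj).
have fE' := fcomp_edst nS fA.
have tE : tot (f |: S) = tot S by apply: tot_setU1.
have fcE : fcomp (f |: S) f = fcomp S f.
  by apply: fcomp_eq; rewrite // setU1K //; apply/esym/setDidPl; rewrite disjoint_sym disjoints1.
split.
- rewrite /valid /pok /= fS ncomp_setU1 //= /pnbc /psat cl_saturated nbc_setU1 // !andbT.
  apply/negP => /and3P[aX bX _]; have [/notX|/negbTE aF] := boolP (esrc f \in fcomp S f).
    by rewrite aX.
  by have /notX := etrans fE' (negbT aF); rewrite bX.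
- rewrite /qfirst; apply: (pickmin_eq (@qkey_inj _)).
    by rewrite inE /= act_setU1 // fA setU11.
  move=> g gA; rewrite /= tE; have [->//|gf] := eqVneq g f.
  exact: (@qfirst_min (S, X) f g fE (@qadd_active (S, X) f g fA gf gA)).
rewrite /qrem /= setU1K // fcE; congr (_, _); apply/setP => v.
rewrite in_setD mem_cl_setU1 //; apply/idP/idP => [/andP[vF]|vX]; last first.
  by rewrite vX andbT; apply: contraL vX => /notX.
have SfE : S = S :\ f by apply/esym/setDidPl; rewrite disjoint_sym disjoints1.
have sF : saturated S (fcomp S f) by rewrite {1}SfE; apply: fcomp_sat.
case/or3P=> [//|/andP[aX bv]|/andP[bX av]].
  have: edst f \in fcomp S f by rewrite fE'; apply: contraL aX => /notX.
  by rewrite (saturated_mem sF bv) (negbTE vF).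
have: esrc f \in fcomp S f by rewrite -[_ \in _]negbK -fE'; apply: contraL bX => /notX.
by rewrite (saturated_mem sF av) (negbTE vF).
Qed.

Lemma qfirst_padd S X e f : nbc S -> e \in act S -> e \notin S ->
  (qkey (tot S) f < qkey (tot S) e)%N -> qfirst (S, X) = Some f ->
  f \in qactive (padd e (S, X)) -> qfirst (padd e (S, X)) = Some f.
Proof.
move=> nS eA eS fe fE fact; rewrite /qfirst; apply: (pickmin_eq (@qkey_inj _)) => // g gA.
rewrite /= tot_setU1 //; have [->|ge] := eqVneq g e; first exact: ltnW.
exact: (@qfirst_min (S, X) f g fE (@qadd_active (S, X) e g eA ge gA)).
Qed.

Lemma padd_idx p e : e \in act p.1 -> (qidx (padd e p) <= qkey (tot p.1) e)%N.
Proof.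
move=> eA; have := @qidx_le (padd e p) e; rewrite /= tot_setU1 //; apply.
by rewrite inE /= act_setU1 // eA setU11.
Qed.

(** An inactive [e] enlarges [inn]. An active [e] of key below that of [f] lowers the index. One of
    larger key leaves the far component of [f] intact and labelled 1, so [f] stays first and
    absent. *)
Lemma qadd_other p e : pnbc p -> valid pnbc e p ->
  (forall f, qfirst p = Some f -> f \notin p.1 /\ f != e) ->
  (qweight (padd e p) < qweight p)%N \/
  (forall f, qfirst (padd e p) = Some f -> f \notin (padd e p).1).
Proof.
case: p => S X /andP[sX nS] /andP[/andP[eS _] _] fP; rewrite /= in sX nS eS.
have [eA|eA] := boolP (e \in act S); last by left; apply: qweight_inn; apply: inn_add.
have lowE : (qweight (padd e (S, X)) < qweight (S, X))%N
  = (qidx (padd e (S, X)) < qidx (S, X))%N by rewrite qweight_idx //= inn_setU1.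
have padd_le := @padd_idx (S, X) e eA.
case fE: (qfirst (S, X)) => [f|]; last first.
  by left; rewrite lowE {2}/qidx fE; apply: leq_ltn_trans padd_le (qkey_lt _ _).
have [fS fe] := fP f fE; rewrite /= in fS.
have [lt_ef|le_fe] := ltnP (qkey (tot S) e) (qkey (tot S) f).
  by left; rewrite lowE {2}/qidx fE; apply: leq_ltn_trans lt_ef.
have lt_fe : (qkey (tot S) f < qkey (tot S) e)%N.
  by rewrite ltn_neqAle le_fe andbT; apply: contra fe => /eqP/qkey_inj->.
right=> g; rewrite (qfirst_padd _ _ _ lt_fe fE) //.
  by case=> <-; rewrite in_setU1 negb_or fe.
have fact := qfirst_active fE; have fA : f \in act S by apply: qactive_act fact.
have disj : [disjoint fcomp S f & X] by move: fact; rewrite inE fA (negbTE fS).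
have notX v : v \in fcomp S f -> v \notin X by move=> vF; rewrite (disjointFr disj).
have SfE : S = S :\ f by apply/esym/setDidPl; rewrite disjoint_sym disjoints1.
have sF : saturated S (fcomp S f) by rewrite {1}SfE; apply: fcomp_sat.
rewrite inE /= act_setU1 // fA fcomp_setU1 //; apply/orP; right.
apply/disjointsP => v vF; rewrite mem_cl_setU1 // (negbTE (notX v vF)) /=.
apply/negP; case/orP=> /andP[_ wv].
  have /negP[] := fcomp_ends nS eA fA lt_fe (edst_in e).
  by rewrite (saturated_mem sF wv).
have /negP[] := fcomp_ends nS eA fA lt_fe (esrc_in e).
by rewrite (saturated_mem sF wv).
Qed.

(** The same cases. For an active [e] of larger key, both ends avoid the far component of [f], so
    relabelling that component commutes with adding [e]. *)
Lemma qadd_rem p f e : pnbc p -> qfirst p = Some f -> f \in p.1 -> e \notin p.1 ->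
  ((valid pnbc e p -> (qweight (padd e p) < qweight p)%N) /\
   (valid pnbc e (qrem f p) -> (qweight (padd e (qrem f p)) < qweight p)%N)) \/
  (valid pnbc e p = valid pnbc e (qrem f p) /\
   (valid pnbc e p -> qfirst (padd e p) = Some f /\
     qrem f (padd e p) = padd e (qrem f p))).
Proof.
move=> Pp fE fS eS; have [/andP[sX' nS'] _ _ _ _] := qrem_valid Pp fE fS.
case: p Pp fE fS eS sX' nS' => S X /andP[sX nS] fE fS eS sX' nS'.
rewrite /= in sX nS fS eS sX' nS'.
have fA : f \in act S by apply: qactive_act (qfirst_active fE).
have fe : f != e by apply: contraNneq eS => <-.
have eS' : e \notin S :\ f by rewrite in_setD1 negb_and eS orbT.
have [eA|eA] := boolP (e \in act S); last first.
  left; split=> _; apply: qweight_inn; first exact: inn_add.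
  by rewrite /= -(inn_setD1 le_order fA); apply: inn_add; rewrite ?act_setD1.
have eA' : e \in act (S :\ f) by rewrite act_setD1.
have [lt_ef|le_fe] := ltnP (qkey (tot S) e) (qkey (tot S) f).
  left; split=> _.
    rewrite qweight_idx /= ?inn_setU1 // {2}/qidx fE /=.
    by apply: leq_ltn_trans lt_ef; apply: (@padd_idx (S, X)).
  rewrite qweight_idx /= ?inn_setU1 // ?inn_setD1 // {2}/qidx fE /=.
  apply: leq_ltn_trans lt_ef; rewrite -(tot_setD1 le_order fA).
  exact: (@padd_idx (qrem f (S, X))).
have lt_fe : (qkey (tot S) f < qkey (tot S) e)%N.
  by rewrite ltn_neqAle le_fe andbT; apply: contra fe => /eqP/qkey_inj->.
have endsF u : u \in ends e -> u \notin fcomp S f by apply: fcomp_ends lt_fe.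
have [aF bF] : esrc e \notin fcomp S f /\ edst e \notin fcomp S f.
  by rewrite !endsF ?esrc_in ?edst_in.
have DU : (e |: S) :\ f = e |: S :\ f.
  by apply/setP => h; rewrite !inE; case: (eqVneq h e) => [->|] //=; rewrite eq_sym fe.
right; split.
  rewrite /valid /pok /= !ncomp_setU1 // eS eS' /= !in_setD aF bF /=.
  congr (_ && _).
    have nj R : e \in act R -> e \notin R -> ~~ joined R e.
      move=> eR neR; have := act_njoined eR; rewrite (_ : R :\ e = R) //.
      by apply/setDidPl; rewrite disjoint_sym disjoints1.
    by rewrite !nj.
  by rewrite /pnbc /psat !cl_saturated /= !nbc_setU1.
move=> _; split.
  apply: qfirst_padd => //; rewrite inE /= act_setU1 // fA.
  by rewrite in_setU1 fS orbT.
rewrite /qrem /padd /= DU fcomp_setU1 //; congr (_, _); apply/setP => v.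
have sF := fcomp_sat S f; have fE' := fcomp_edst nS fA.
rewrite in_setD !mem_cl_setU1 // !in_setD aF bF /=.
apply/andP/idP => [[vF]|].
  rewrite vF /= => /or3P[->//|/andP[-> bv]|/andP[-> av]]; apply/orP; right; apply/orP.
    left; move: bv; rewrite /= -{1}(setD1K fS) cn_setU1 => /or3P[//|/andP[ba bv]|/andP[bb av]].
      have: edst f \in fcomp S f by rewrite fE' -(saturated_mem sF ba).
      by rewrite (saturated_mem sF bv) (negbTE vF).
    have: esrc f \in fcomp S f by rewrite -[_ \in _]negbK -fE' -(saturated_mem sF bb).
    by rewrite (saturated_mem sF av) (negbTE vF).
  right; move: av; rewrite /= -{1}(setD1K fS) cn_setU1 => /or3P[//|/andP[ba bv]|/andP[bb av]].
    have: edst f \in fcomp S f by rewrite fE' -(saturated_mem sF ba).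
    by rewrite (saturated_mem sF bv) (negbTE vF).
  have: esrc f \in fcomp S f by rewrite -[_ \in _]negbK -fE' -(saturated_mem sF bb).
  by rewrite (saturated_mem sF av) (negbTE vF).
have sub : S :\ f \subset S by apply: subsetDl.
case/or3P=> [/andP[vF ->]|/andP[-> bv]|/andP[-> av]] //.
  by rewrite -(saturated_mem sF bv) bF (cn_sub sub bv) orbT.
by rewrite -(saturated_mem sF av) aF (cn_sub sub av) !orbT.
Qed.

End TreeMatching.

(** * The spanning tree complex inside the reduced complex *)

Section TreeInclusion.
Variables (G : sgraph) (conn : connected_graph G) (le : rel (edge G)) (vd : G).
Hypothesis le_order : total_order le.
Implicit Types (S T R : {set edge G}) (X C : {set G}) (e f g : edge G) (u v : G).
Local Notation nbc := (nbc le).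
Local Notation act := (act le).
Local Notation inn := (inn le).
Local Notation tot := (tot le).
Local Notation far := (far vd).
Local Notation pnbc := (pnbc le).
Local Notation sg := (sg le).
Local Notation CQ := (pcomplex le pnbc).
Local Notation bv := (bv pnbc).

Lemma ncomp_span S : (forall x y, cn S x y) -> ncomp S setT = 1%N.
Proof.
move=> spS; rewrite /ncomp; have -> : ccomp S @: setT = [set ccomp S vd].
  apply/setP => D; rewrite in_set1; apply/imsetP/eqP => [[x _ ->]|->]; last by exists vd.
  by apply/eqP; rewrite ccomp_eq.
exact: cards1.
Qed.

Lemma ncomp_setC S v : (ncomp S (~: ccomp S v)).+1 = ncomp S setT.
Proof.
rewrite /ncomp; have -> : ccomp S @: setT = ccomp S v |: ccomp S @: (~: ccomp S v).
  apply/setP => D; rewrite in_setU1; apply/imsetP/predU1P => [[x _ ->]|[->|]].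
  - have [vx|vx] := boolP (cn S v x); first by left; apply/eqP; rewrite ccomp_eq cnC.
    by right; apply: imset_f; rewrite !inE.
  - by exists v.
  - by case/imsetP=> x _ ->; exists x.
rewrite cardsU1 mem_imset_ccomp ?saturatedC ?ccomp_saturated //.
by rewrite inE ccomp_id.
Qed.

(* The sign with which the state labelled 1 exactly on [C] enters T^+. *)
Definition csg T C : int := (-1) ^+ #|[set g in act T | C \subset far T g]|.

Definition tplus T : freeAb (pbasis pnbc) :=
  \sum_(C in ccomp (inn T) @: setT) bv (inn T, ~: C) *~ csg T C.

Definition incl (b : nbcTree le * bool) : freeAb (pbasis pnbc) :=
  if b.2 then tplus (val b.1) else bv (inn (val b.1), setT).

Section OneTree.
Variable T : {set edge G}.
Hypothesis (nT : nbc T) (spT : forall x y, cn T x y).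
Local Notation I := (inn T).

Lemma nbc_inn : nbc I.
Proof. by apply: nbc_sub nT; apply: subsetDl. Qed.

Lemma pnbc_full : pnbc (I, setT).
Proof. by rewrite /pnbc /psat saturatedT nbc_inn. Qed.

Lemma pnbc_minus v : pnbc (I, ~: ccomp I v).
Proof. by rewrite /pnbc /psat saturatedC ccomp_saturated nbc_inn. Qed.

Lemma act_in_tree g : g \in act T -> g \in T.
Proof. exact/subsetP/tree_act_sub. Qed.

Lemma inn_sub_setD1 g : g \in act T -> I \subset T :\ g.
Proof.
move=> gA; apply/subsetP => h; rewrite in_inn in_setD1 => /andP[hA ->].
by rewrite andbT; apply: contraNneq hA => ->.
Qed.

Lemma far_sat g : g \in act T -> saturated I (far T g).
Proof.
move=> gA; apply/saturatedP => x y /(cn_sub (inn_sub_setD1 gA)).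
by rewrite (far_split vd spT) ?act_in_tree // => /eqP->.
Qed.

(** Far sides of active edges are unions of components of [inn T], so one vertex decides. The
    exponent counts the active edges between the root and [v]. *)
Lemma csgE v : csg T (ccomp I v) = (-1) ^+ #|[set g in act T | v \in far T g]|.
Proof.
congr (_ ^+ _); apply: eq_card => g; rewrite inE [RHS]inE.
have [gA|] := boolP (g \in act T); last by [].
apply/subsetP/idP => [sub|vF u]; first exact/sub/ccomp_id.
by rewrite inE => vu; rewrite -(saturated_mem (far_sat gA) vu).
Qed.

Lemma far_sep g u v : g \in act T ->
  ~~ cn (T :\ g) u v = (u \in far T g) (+) (v \in far T g).
Proof.
move=> gA; rewrite (far_split vd spT) ?act_in_tree //.
by case: (u \in _); case: (v \in _).
Qed.

(** The active edges separating [u] from [v] form the symmetric difference of the two counted sets,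
    so their parity compares the signs. *)
Lemma csg_add u v : csg T (ccomp I u) + csg T (ccomp I v) =
  if odd #|[set g in act T | ~~ cn (T :\ g) u v]| then 0
  else 2 * csg T (ccomp I u).
Proof.
rewrite !csgE; set A := [set g in act T | u \in far T g].
set B := [set g in act T | v \in far T g]; set D := [set g in act T | _].
have -> : D = (A :\: B) :|: (B :\: A).
  have inA g : (g \in A) = (g \in act T) && (u \in far T g) by rewrite inE.
  have inB g : (g \in B) = (g \in act T) && (v \in far T g) by rewrite inE.
  apply/setP => g; rewrite in_setU !in_setD inA inB inE.
  have [gA|_] := boolP (g \in act T); last by [].
  by rewrite far_sep //; case: (u \in _); case: (v \in _).
have disj : (A :\: B) :&: (B :\: A) = set0.
  by apply/setP => g; rewrite in_setI !in_setD in_set0; case: (g \in A); case: (g \in B).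
rewrite cardsU disj cards0 subn0 oddD.
rewrite -signr_odd -[(-1) ^+ #|B|]signr_odd -(cardsID B A) -(cardsID A B) !oddD setIC.
by case: (odd _); case: (odd _); case: (odd _).
Qed.

(** [e] is the only edge of [T] separating its own ends. *)
Lemma csg_act e : e \in act T ->
  csg T (ccomp I (esrc e)) + csg T (ccomp I (edst e)) = 0.
Proof.
move=> eA; have eT := act_in_tree eA; rewrite csg_add.
have -> : [set g in act T | ~~ cn (T :\ g) (esrc e) (edst e)] = [set e].
  apply/setP => g; rewrite inE in_set1; have [->|ge] := eqVneq g e.
    by rewrite eA (nbc_forest le_order nT eT).
  rewrite -/(joined (T :\ g) e) joined_in ?andbF //.
  by rewrite in_setD1 eq_sym ge.
by rewrite cards1.
Qed.

Lemma padd_op_nnbc e p : ~~ nbc (e |: p.1) -> padd_op le pnbc e p = 0.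
Proof.
move=> nb; rewrite /padd_op bv0 ?mul0rz ?if_same //.
by rewrite /pnbc negb_and nb orbT.
Qed.

Lemma padd_minus e v : e \notin I -> ~~ joined I e -> v \in ends e ->
  padd_op le pnbc e (I, ~: ccomp I v) = bv (e |: I, setT) *~ sg I e.
Proof.
move=> eI nj ve; have sC : saturated I (~: ccomp I v).
  by rewrite saturatedC ccomp_saturated.
have vX : v \notin ~: ccomp I v by rewrite inE negbK ccomp_id.
have ok : pok e (I, ~: ccomp I v).
  rewrite /pok /= eI ncomp_setU1 // andTb; apply: contra vX.
  move: ve; rewrite endsE => /set2P[->|->]; first by case/and3P.
  by case/and3P.
rewrite /padd_op ok; congr (bv (_, _) *~ _); apply/setP => w.
rewrite [w \in setT]inE mem_cl_setU1 // !in_setC.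
have [vw|//] := boolP (w \in ccomp I v); rewrite inE in vw.
move: ve; rewrite endsE => /set2P[vE|vE]; rewrite vE in vw *.
  have -> : edst e \notin ccomp I (esrc e) by rewrite inE.
  by rewrite vw !orbT.
have -> : esrc e \notin ccomp I (edst e) by rewrite inE cnC.
by rewrite vw.
Qed.

Lemma padd_other e w : ~~ joined I e -> ~~ cn I w (esrc e) -> ~~ cn I w (edst e) ->
  padd_op le pnbc e (I, ~: ccomp I w) = 0.
Proof.
move=> nj wa wb; rewrite /padd_op.
have -> : pok e (I, ~: ccomp I w) = false; last by [].
rewrite /pok /= ncomp_setU1 ?saturatedC ?ccomp_saturated // nj !in_setC.
by rewrite ![_ \in ccomp _ _]inE wa wb andbF.
Qed.

(** When [e] merges two components, a state survives only if its component labelled 1 is one of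
    them; otherwise x^2 appears. If [e] closes a cycle, a broken circuit appears and both sides
    vanish. *)
Lemma padd_tplus e : e \notin I ->
  \sum_(C in ccomp I @: setT) padd_op le pnbc e (I, ~: C) *~ csg T C =
  bv (e |: I, setT) *~
    (sg I e * (csg T (ccomp I (esrc e)) + csg T (ccomp I (edst e)))).
Proof.
move=> eI; have [je|nj] := boolP (joined I e).
  have nb : ~~ nbc (e |: I) by apply: contraL je => /(nbc_add_joined le_order); apply.
  rewrite bv0 ?mul0rz; last by rewrite /pnbc negb_and nb orbT.
  by apply: big1 => C _; rewrite padd_op_nnbc // mul0rz.
have ab : ccomp I (edst e) != ccomp I (esrc e) by rewrite ccomp_eq cnC.
rewrite (bigD1 (ccomp I (esrc e))) ?imset_f //=.
rewrite (bigD1 (ccomp I (edst e))) ?imset_f ?ab //=.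
rewrite [X in _ + (_ + X)]big1; last first.
  move=> C /andP[/andP[/imsetP[w _ ->]]]; rewrite !ccomp_eq => wa wb.
  by rewrite padd_other // mul0rz.
rewrite [X in _ + X]addr0 (padd_minus eI nj (esrc_in e)).
rewrite (padd_minus eI nj (edst_in e)).
by rewrite mulrDr mulrzDr !mulrzA.
Qed.

Lemma diff_full : bg_diff CQ (bv (I, setT)) = 0.
Proof.
rewrite pcomplex_diff_bv ?pnbc_full // /pdiff big1 // => e _.
have [nb|nb] := boolP (nbc (e |: I)); last exact: (padd_op_nnbc (p := (I, setT)) nb).
rewrite /padd_op; have -> : pok e (I, setT) = false; last by [].
rewrite /pok /=; have [eI|eI] := boolP (e \in I); first by [].
by rewrite ncomp_setU1 ?saturatedT // !in_setT (nbc_add_joined le_order nb eI).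
Qed.

Lemma diff_tplus : bg_diff CQ (tplus T) = \sum_(e | e \notin T)
  bv (e |: I, setT) *~
    (sg I e * (csg T (ccomp I (esrc e)) + csg T (ccomp I (edst e)))).
Proof.
rewrite pcomplex_diffE [RHS]big_mkcond; apply: eq_bigr => e _.
have -> : padd_lin le pnbc e (tplus T) =
    \sum_(C in ccomp I @: setT) padd_op le pnbc e (I, ~: C) *~ csg T C.
  rewrite raddf_sum; apply: eq_bigr => C /imsetP[v _ ->].
  by rewrite raddfMz /padd_lin; congr (_ *~ _); apply: linext_bv; apply: pnbc_minus.
have [eT|eT] := boolP (e \in T); last first.
  by rewrite padd_tplus //; apply: contra eT; apply/subsetP/subsetDl.
have [eI|eI] := boolP (e \in I).
  by apply: big1 => C _; rewrite /padd_op /pok /= eI mul0rz.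
rewrite padd_tplus // csg_act ?mulr0 ?mulr0z //.
by move: eI; rewrite in_inn eT andbT negbK.
Qed.

(** Origin of the factor 2: the active edges of the cycle of [e] are those separating its ends, and
    when they are even in number both ends carry the same sign. *)
Lemma sgn_csg e : e \notin T ->
  2 * sgn le vd T e = csg T (ccomp I (esrc e)) + csg T (ccomp I (edst e)).
Proof.
move=> eT; rewrite /sgn (IA_cyc le_order nT spT eT) csg_add.
rewrite -/(joined _ e); case: ifP => [_|ev]; first by rewrite mulr0.
have -> : (-1) ^+ IA_length le vd T (endpoint vd e) = csg T (ccomp I (endpoint vd e)).
  by rewrite (IA_lengthE vd le_order nT spT) csgE.
rewrite /endpoint; case: pickP => [v|none]; last by have := none (esrc e); rewrite esrc_in.
rewrite endsE => /set2P[->|->] //=.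
have := csg_add (esrc e) (edst e); rewrite ev; lia.
Qed.

Lemma psi_sub e : e \notin T -> e |: I \subset psi le T e.
Proof.
move=> eT; rewrite /psi; apply/subsetP => h hI; rewrite inE; apply/andP; split.
  rewrite inE; apply/negP => /andP[]; rewrite in_setI (IA_act le_order nT spT) => /andP[hA _] _.
  move: hI; rewrite in_setU1 in_inn hA /= orbF => /eqP he.
  by move: eT; rewrite -he (act_in_tree hA).
by move: hI; rewrite !in_setU1 in_inn => /orP[->//|/andP[_ ->]]; rewrite orbT.
Qed.

(** Contracting [inn T] turns [T] into a tree with edge set [act T]. *)
Lemma card_act : ncomp I setT = #|act T|.+1.
Proof.
have := ncomp_nbc le_order nbc_inn; rewrite -(ncomp_nbc le_order nT) (ncomp_span spT).
have -> : #|T| = (#|I| + #|act T|)%N.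
  by rewrite -(cardsID (act T) T) (setIidPr (tree_act_sub le spT)) addnC.
lia.
Qed.

End OneTree.

Lemma val_nbcTree (T : nbcTree le) : nbc (val T) /\ forall x y, cn (val T) x y.
Proof. exact/(nbc_treeP le_order)/(valP T). Qed.

(** If [e |: inn T] contains no broken circuit, [psiE] makes [psi T e] an NBC tree with exactly this
    inactive set, the only term of the sum. Otherwise no NBC tree contains it and both sides
    vanish. *)
Lemma incl_st_edge (T : nbcTree le) e : e \notin val T ->
  \sum_(T' : nbcTree le | (val T' == psi le (val T) e) &&
                           (#|IN le (val T')| == #|IN le (val T)|.+1))
    bv (inn (val T'), setT) *~ ((-1) ^+ xi le (val T) e * 2 * sgn le vd (val T) e) =
  bv (e |: inn (val T), setT) *~ (sg (inn (val T)) e *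
    (csg (val T) (ccomp (inn (val T)) (esrc e)) +
     csg (val T) (ccomp (inn (val T)) (edst e)))).
Proof.
move=> eT; have [nT spT] := val_nbcTree T.
have -> : (-1) ^+ xi le (val T) e = sg (inn (val T)) e.
  by rewrite /xi (IN_inn le_order nT spT).
rewrite -mulrA sgn_csg //; set c := sg _ _ * _.
have [nb|nb] := boolP (nbc (e |: inn (val T))); last first.
  rewrite bv0 ?mul0rz; last by rewrite /pnbc negb_and nb orbT.
  rewrite big_pred0 // => T'; apply: contraNF nb => /andP[/eqP T'E _].
  have [nT' _] := val_nbcTree T'; apply: nbc_sub nT'.
  by rewrite T'E; apply: psi_sub.
have psE := psiE vd le_order nT spT conn eT nb.
have innE := inn_setU1_notin le_order spT eT.
have tP : nbc_tree le (psi le (val T) e).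
  apply/(nbc_treeP le_order); rewrite psE; split; first exact: nbc_tot.
  by move=> x y; apply: cn_tot.
pose T0 : nbcTree le := exist (fun R => nbc_tree le R) _ tP.
have innT0 : inn (val T0) = e |: inn (val T) by rewrite /= psE inn_tot.
rewrite (big_pred1 T0) => [|T']; first by rewrite innT0.
apply/andP/eqP => [[/eqP T'E _]|->]; first exact: val_inj.
split; first exact: eqxx.
have [nT0 spT0] := val_nbcTree T0.
rewrite (IN_inn le_order nT0 spT0) (IN_inn le_order nT spT) innT0 cardsU1.
rewrite (_ : e \notin inn (val T)) ?add1n //.
by apply: contra eT; apply/subsetP/subsetDl.
Qed.

End TreeInclusion.

Section TreeEquivalence.
Variables (G : sgraph) (conn : connected_graph G) (le : rel (edge G)) (vd : G).
Hypothesis le_order : total_order le.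
Implicit Types (S T R : {set edge G}) (X C : {set G}) (e f g : edge G) (u v : G).
Local Notation nbc := (nbc le).
Local Notation act := (act le).
Local Notation inn := (inn le).
Local Notation tot := (tot le).
Local Notation far := (far vd).
Local Notation pnbc := (pnbc le).
Local Notation CQ := (pcomplex le pnbc).
Local Notation CST := (spanning_tree_complex le vd).
Local Notation bv := (bv pnbc).
Local Notation qf := (qfirst le vd).
Local Notation qw := (qweight le vd).

(** With this sum fixed, one more inactive edge means one active edge less, which compensates the
    degree shift from T^+ to T^-. *)
Lemma tree_card (T : nbcTree le) :
  (#|IN le (val T)| + #|IA le (val T)|).+1 = #|G|.
Proof.
have [nT spT] := val_nbcTree le_order T.
rewrite (IN_inn le_order nT spT) (IA_act le_order nT spT).
have := ncomp_nbc le_order (nbc_inn nT); rewrite (card_act vd le_order nT spT).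
lia.
Qed.

Lemma st_diff_basisv b : bg_diff CST (basisv b) = st_diff vd b.
Proof. exact: linext_basisv. Qed.

Lemma st_bigraded : bigraded_cochain_complex CST.
Proof.
split=> [i j x|x].
  rewrite !homog_supported; apply: supported_map => -[T []] /eqP[dT1 dT2];
    rewrite st_diff_basisv /st_diff /=; last exact: rpred0.
  apply: rpred_sum => e _; apply: rpred_sum => T' /andP[_ /eqP INE].
  apply/supportedMz/supported_basisv; apply/eqP; rewrite /bg_deg /= /st_deg /=.
  have := tree_card T; have := tree_card T'.
  by move: dT1 dT2 INE => /= <- <- ->; move=> ? ?; congr (_, _); lia.
apply: (@additive_ext _ _ (bg_diff CST \o bg_diff CST) \0) => -[T b].
rewrite [LHS]/= st_diff_basisv /st_diff; case: b; last by rewrite raddf0.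
rewrite [RHS]/= raddf_sum big1 // => e _; rewrite raddf_sum big1 // => T' _.
by rewrite raddfMz st_diff_basisv /st_diff mul0rz.
Qed.

Definition incl_lin : {additive 'C[CST] -> 'C[CQ]} := linext (@incl G le vd).

Lemma incl_linE b : incl_lin (basisv b) = incl vd b.
Proof. exact: linext_basisv. Qed.

Lemma incl_deg b : incl vd b \in supported (fun q : pbasis pnbc => pdeg (val q) == st_deg b).
Proof.
case: b => T b; have [nT spT] := val_nbcTree le_order T.
have INE := IN_inn le_order nT spT; have IAE := IA_act le_order nT spT.
have cA := card_act vd le_order nT spT.
rewrite /incl /st_deg INE IAE; case: b => /=; last first.
  apply: (@bv_supported _ pnbc (fun q => pdeg q == _)) => _.
  by rewrite /pdeg /= cA addn1.
apply: rpred_sum => C /imsetP[v _ ->]; apply: supportedMz.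
apply: (@bv_supported _ pnbc (fun q => pdeg q == _)) => _.
have := ncomp_setC (inn (val T)) v; rewrite cA => -[E].
by rewrite /pdeg /= E addn0.
Qed.

Lemma incl_cochain : cochain_map incl_lin.
Proof.
split=> [i j x|x].
  rewrite !homog_supported; apply: supported_map => b /eqP db.
  rewrite incl_linE; apply: supported_sub (incl_deg b) => q /eqP qd.
  by apply/eqP; rewrite -db; apply: qd.
apply: (@additive_ext _ _ (incl_lin \o bg_diff CST) (bg_diff CQ \o incl_lin)) => -[T b].
have [nT spT] := val_nbcTree le_order T.
rewrite [LHS]/= [RHS]/= st_diff_basisv incl_linE /incl /st_diff.
case: b => /=; last by rewrite raddf0 (diff_full le_order nT).
rewrite (diff_tplus vd le_order nT spT) raddf_sum; apply: eq_bigr => e eT.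
rewrite -(incl_st_edge conn vd le_order eT) raddf_sum; apply: eq_bigr => T' _.
by rewrite raddfMz incl_linE.
Qed.

(** Only critical states are kept; T^+ is recognised by its leading state, labelled 1 exactly on the
    component of the root. *)
Definition retr (p : pstate G) : 'C[CST] :=
  if qf p then 0 else
  if insub (tot p.1) is Some T then basisv (T : nbcTree le, p.2 != setT) else 0.

Definition retr_lin : {additive 'C[CQ] -> 'C[CST]} :=
  linext (fun b : pbasis pnbc => retr (val b)).

Lemma far_end_unique T e u v : nbc T -> (forall x y, cn T x y) -> e \in T ->
  u \in ends e -> v \in ends e -> u \in far T e -> v \in far T e -> u = v.
Proof.
move=> nT spT eT; have := far_edst vd le_order nT spT eT.
rewrite endsE => E /set2P[->|->] /set2P[->|->] // uF vF.
  by move: vF; rewrite E uF.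
by move: uF; rewrite E vF.
Qed.

Lemma fcomp_inn T e u v : nbc T -> (forall x y, cn T x y) -> e \in act T ->
  u \in ends e -> u \in far T e ->
  (v \in fcomp le vd (inn T) e) = cn (inn T) u v.
Proof.
move=> nT spT eA ue uF; have eT : e \in T by apply: act_in_tree eA.
have ID : inn T :\ e = inn T.
  apply/setDidPl; rewrite disjoint_sym disjoints1.
  by rewrite in_inn eA.
have tE : tot (inn T) = T by rewrite tot_inn // tree_tot.
apply/fcompP/idP => [[w [we]]|uv]; rewrite ?tE ?ID.
  by move=> wF; rewrite (far_end_unique nT spT eT we ue wF uF).
by exists u.
Qed.

Lemma qactive_inn T e X : e \in qactive le vd (inn T, X) =
  (e \in act T) && [disjoint fcomp le vd (inn T) e & X].
Proof.
rewrite inE /= act_inn //; have [eA|] := boolP (e \in act T); last by [].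
by rewrite in_inn eA.
Qed.

Lemma qfirst_none p : (qf p = None) <-> (qactive le vd p = set0).
Proof.
rewrite /qfirst; case: pickminP => [e eA _|->]; split=> // E.
by rewrite E inE in eA.
Qed.

Lemma qfirst_full T : nbc T -> (forall x y, cn T x y) -> qf (inn T, setT) = None.
Proof.
move=> nT spT; apply/qfirst_none/eqP; apply: contraT => /set0Pn[e].
rewrite qactive_inn => /andP[eA].
have eT : e \in T by apply: act_in_tree eA.
have [u ue uF] := far_end vd le_order nT spT eT.
move/disjointsP/(_ u); rewrite in_setT (fcomp_inn _ nT spT eA ue uF) cnxx => /(_ isT).
by [].
Qed.

Lemma qfirst_root T : nbc T -> (forall x y, cn T x y) ->
  qf (inn T, ~: ccomp (inn T) vd) = None.
Proof.
move=> nT spT; apply/qfirst_none/eqP; apply: contraT => /set0Pn[e].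
rewrite qactive_inn => /andP[eA].
have eT : e \in T by apply: act_in_tree eA.
have [u ue uF] := far_end vd le_order nT spT eT.
move/disjointsP/(_ u); rewrite (fcomp_inn _ nT spT eA ue uF) cnxx => /(_ isT).
rewrite in_setC negbK inE => vu; move: uF; rewrite inE.
by rewrite (cn_sub (inn_sub_setD1 eA) vu).
Qed.

(** The active edge through which the root path enters the component of [v] has that component,
    labelled 1, as its far component. *)
Lemma qfirst_other T v : nbc T -> (forall x y, cn T x y) -> ~~ cn (inn T) vd v ->
  qf (inn T, ~: ccomp (inn T) v) <> None.
Proof.
move=> nT spT nv /qfirst_none A0.
have [e [u [eA ue uF uv]]] := parent_edge le_order nT spT nv.
have: e \in qactive le vd (inn T, ~: ccomp (inn T) v).
  rewrite qactive_inn eA; apply/disjointsP => w; rewrite (fcomp_inn _ nT spT eA ue uF).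
  by move=> uw; rewrite in_setC negbK inE -(cn_left uv).
by rewrite A0 inE.
Qed.

(** An unmatched state has no active edge, and each component other than that of the root, being the
    far component of an active edge, must be labelled x. Only the label at the root is free. *)
Lemma critical p : pnbc p -> qf p = None ->
  inn p.1 = p.1 /\ (p.2 = setT \/ p.2 = ~: ccomp p.1 vd).
Proof.
case: p => S X /andP[sX nS] /qfirst_none A0; rewrite /= in sX nS.
have SI : inn S = S.
  apply/setDidPl; rewrite -setI_eq0; apply: contraT => /set0Pn[e].
  rewrite in_setI => /andP[eS eA]; have: e \in qactive le vd (S, X).
    by rewrite inE /= eA eS.
  by rewrite A0 inE.
split=> //=; pose T := tot S.
have nT : nbc T by apply: nbc_tot.
have spT x y : cn T x y by apply: cn_tot.
have TI : inn T = S by rewrite /T inn_tot.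
have sub v : ~~ cn S vd v -> v \in X.
  rewrite -TI => nv; have [e [u [eA ue uF uv]]] := parent_edge le_order nT spT nv.
  have: e \notin qactive le vd (inn T, X) by rewrite TI A0 inE.
  rewrite qactive_inn eA /=; case/pred0Pn => w /andP[/=].
  rewrite (fcomp_inn _ nT spT eA ue uF) TI => uw wX.
  rewrite TI in uv; have vw : cn S v w by rewrite -(cn_left uv).
  by rewrite (saturated_mem sX vw).
have [vX|vX] := boolP (vd \in X).
  left; apply/setP => v; rewrite in_setT; have [vv|/sub//] := boolP (cn S vd v).
  by rewrite -(saturated_mem sX vv).
right; apply/setP => v; rewrite in_setC inE.
have [vv|/sub->//] := boolP (cn S vd v); rewrite -(saturated_mem sX vv).
exact: negbTE.
Qed.

Lemma insub_tot S : nbc S -> exists2 T : nbcTree le, insub (tot S) = Some T & val T = tot S.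
Proof.
move=> nS; have tP : nbc_tree le (tot S).
  apply/(nbc_treeP le_order); split; first exact: nbc_tot.
  by move=> x y; apply: cn_tot.
by exists (exist (fun R => nbc_tree le R) _ tP); rewrite ?insubT.
Qed.

Lemma retr_inn (T : nbcTree le) X : qf (inn (val T), X) = None ->
  retr (inn (val T), X) = basisv (T, X != setT).
Proof.
move=> q0; have [nT spT] := val_nbcTree le_order T.
by rewrite /retr q0 /= tot_inn // tree_tot // valK.
Qed.

Lemma setC_ccomp S v : ~: ccomp S v != setT.
Proof.
by apply/eqP => /setP/(_ v); rewrite in_setC in_setT ccomp_id.
Qed.

Lemma csg_root T : nbc T -> (forall x y, cn T x y) -> csg le vd T (ccomp (inn T) vd) = 1.
Proof.
move=> nT spT; rewrite csgE // (_ : [set g in _ | _] = set0) ?cards0 //.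
by apply/setP => g; rewrite inE in_set0 [vd \in _]inE cnxx andbF.
Qed.

(** The other states of T^+ lie in the same block and have a matching edge, so their index is below
    the default [qtop] of a critical state. *)
Lemma incl_critical (T : nbcTree le) p : pnbc p -> qf p = None -> tot p.1 = val T ->
  incl vd (T, p.2 != setT) - bv p \in supported (fun q : pbasis pnbc => qw (val q) < qw p)%N.
Proof.
case: p => S X Pp q0 ST; have [/= SI XE] := critical Pp q0.
have [nT spT] := val_nbcTree le_order T.
have TI : inn (val T) = S by rewrite -ST inn_tot.
case: XE => XE; rewrite XE in q0 Pp *.
  by rewrite eqxx /incl /= TI subrr rpred0.
rewrite setC_ccomp; have -> : incl vd (T, true) = tplus le vd (val T) by [].
rewrite /tplus TI.
have cg : csg le vd (val T) (ccomp S vd) = 1 by rewrite -TI csg_root.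
rewrite (bigD1 (ccomp S vd)) ?imset_f // cg mulr1z.
rewrite [X in X - _]addrC addrK; apply: rpred_sum => C /andP[/imsetP[v _ ->] vv].
apply: supportedMz; apply: (@bv_supported _ pnbc (fun q => qw q < _)%N) => _.
rewrite qweight_idx //= /qidx q0 /=.
have: qf (S, ~: ccomp S v) <> None.
  by rewrite -TI; apply: qfirst_other => //; rewrite TI -ccomp_eq eq_sym.
by case: (qfirst _ _ _) => //= e _; apply: qkey_lt.
Qed.

Lemma retr_graded : graded_map retr_lin.
Proof.
move=> i j x; rewrite !homog_supported; apply: supported_map => b /eqP db.
rewrite /retr_lin [X in X \in _]linext_basisv; case: b db => -[S X] Pp db.
have [_ nS] := andP Pp; rewrite /= in db nS.
rewrite [val _]/= /retr; case q0: (qf (S, X)) => [e|]; first exact: rpred0.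
have [T -> TE] := insub_tot nS; have [nT spT] := val_nbcTree le_order T.
have [/= SI XE] := critical Pp q0; have TI : inn (val T) = S by rewrite TE inn_tot.
apply: supported_basisv; rewrite -db; apply/eqP; rewrite /bg_deg /= /st_deg /=.
rewrite (IN_inn le_order nT spT) (IA_act le_order nT spT) TI /pdeg /=.
have cA := card_act vd le_order nT spT; rewrite TI in cA.
case: XE => ->; first by rewrite eqxx cA addn1.
have := ncomp_setC S vd; rewrite cA => -[->].
by rewrite setC_ccomp addn0.
Qed.

Lemma retr_bv p : pnbc p -> retr_lin (bv p) = retr p.
Proof. exact: linext_bv. Qed.

Lemma retr_some p : qf p <> None -> retr p = 0.
Proof. by rewrite /retr; case: (qfirst _ _ _). Qed.

(** Among the states of T^+ only the one labelled 1 at the root is critical, and its coefficient is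
    1. *)
Lemma incl_linK : cancel incl_lin retr_lin.
Proof.
apply: (@additive_ext _ _ (retr_lin \o incl_lin) idfun) => -[T b].
have [nT spT] := val_nbcTree le_order T.
rewrite [LHS]/= [RHS]/= incl_linE /incl; case: b => /=; last first.
  by rewrite (retr_bv (pnbc_full nT)) retr_inn ?eqxx // qfirst_full.
rewrite raddf_sum (bigD1 (ccomp (inn (val T)) vd)) ?imset_f //=.
rewrite [X in _ + X]big1; last first.
  move=> C /andP[/imsetP[v _ ->]]; rewrite ccomp_eq => vv.
  rewrite raddfMz (retr_bv (pnbc_minus nT v)) retr_some ?mul0rz //.
  by apply: qfirst_other => //; rewrite cnC.
rewrite [LHS]addr0 raddfMz (retr_bv (pnbc_minus nT vd)) retr_inn ?qfirst_root //.
by rewrite csg_root // mulr1z setC_ccomp.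
Qed.

Lemma tree_reduction : chain_homotopy_equivalent CST CQ.
Proof.
pose h := hmatch_lin le pnbc qf (qrem le vd).
have hv := @qrem_valid _ conn le vd le_order.
have hb b : h (basisv b) = hmatch le pnbc qf (qrem le vd) (val b).
  exact: linext_basisv.
have hbv p : pnbc p -> h (bv p) = hmatch le pnbc qf (qrem le vd) p by apply: hmatch_bv.
have rb b : retr_lin (basisv b) = retr (val b) by apply: linext_basisv.
(* Matching edges are active and [inn T] contains none, so [h] vanishes on the image of the
   inclusion. *)
have hinn T X : hmatch le pnbc qf (qrem le vd) (inn T, X) = 0.
  apply: hmatch0 => f /qfirst_active; rewrite qactive_inn => /andP[fA _].
  by rewrite /= in_inn fA.
apply: (@injection_homotopy_equivalence CST CQ _ _ h _
  (#|edge G|.+1 * (qtop G).+1)%N (fun b => qw (val b)) _ incl_lin retr_lin).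
- exact: pcomplex_diff_homog.
- exact: pnbc_dd.
- exact: hmatch_homotopy hv.
- move=> b; rewrite /qweight; have := qidx_le_top le vd (val b); nia.
- exact: incl_cochain.
- exact: retr_graded.
- exact: incl_linK.
- apply: (@additive_ext _ _ (h \o incl_lin) \0) => -[T b].
  have [nT spT] := val_nbcTree le_order T.
  rewrite [LHS]/= [RHS]/= incl_linE /incl; case: b => /=; last first.
    by rewrite (hbv _ (pnbc_full nT)) hinn.
  rewrite raddf_sum big1 // => C /imsetP[v _ ->].
  by rewrite raddfMz (hbv _ (pnbc_minus nT v)) hinn mul0rz.
move=> b; have := matching_low le_order hv (@qadd_first _ conn le vd le_order)
  (@qadd_other _ conn le vd le_order) (@qadd_rem _ conn le vd le_order) (valP b).
have -> : pdiff le pnbc (val b) = bg_diff CQ (basisv b).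
  by rewrite -bv_val pcomplex_diff_bv ?(valP b).
rewrite /pert /= -hb rb => low.
(* Inclusion after retraction fixes a critical state up to lower weight and kills the matched
   states, on which dh + hd supplies the identity up to lower weight. *)
have critE : incl_lin (retr (val b)) - (basisv b - (if qf (val b) then bv (val b) else 0))
    \in supported (fun c : pbasis pnbc => qw (val c) < qw (val b))%N.
  rewrite -bv_val; case q0: (qf (val b)) => [f|].
    by rewrite subrr retr_some ?q0 // raddf0 subr0 rpred0.
  rewrite /retr q0; have /andP[_ nS] := valP b.
  have [T -> TE] := insub_tot nS; rewrite incl_linE subr0.
  exact: incl_critical (valP b) q0 (esym TE).
have E (V : zmodType) (x y z t : V) : x + y - z = x - (z - t) + (y - t).
  by rewrite opprB addrACA [t - z]addrC addrK.
rewrite (E _ _ _ _ (if qf (val b) then bv (val b) else 0)).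
exact: rpredD critE low.
Qed.

End TreeEquivalence.

Theorem theorem1p1 (G : sgraph) (conn : connected_graph G)
    (le : rel (edge G)) (le_order : total_order le) (vd : G) :
  [/\ bigraded_cochain_complex (spanning_tree_complex le vd),
      chain_homotopy_equivalent (spanning_tree_complex le vd)
        (chromatic_complex le 2)
    & forall i j : nat,
        isomorphic (homology (spanning_tree_complex le vd) i j)
          (homology (chromatic_complex le 2) i j)].
Proof.
have che : chain_homotopy_equivalent (spanning_tree_complex le vd)
    (chromatic_complex le 2).
  apply: che_trans (tree_reduction conn vd le_order) _.
  apply: che_trans (nbc_reduction le_order) _.
  exact/che_sym/chromatic_relabel.
split=> [|//|i j]; first exact: st_bigraded.
exact: che_isomorphic_homology.
Qed.
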